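(* Let $M$ be a proper lightlike isotropic Lagrangian, Lorentzian surface of Type 2 in $\mathbb{C}^2_1$. Then $M$ is (locally) congruent with one of the following surfaces, where $(u,v)$ are real parameters: (1) the surface $$f(u,v)=(vA_1+A_2)e^{iu},$$ where $A_1=\big(\tfrac{\sqrt2}{2},\tfrac{\sqrt2}{2}\big)$ and $A_2=\big(-\tfrac{\sqrt2}{2}i,\tfrac{\sqrt2}{2}i\big)$; (2) the surface $$f(u,v)=(A_1e^{rv}+A_2e^{-rv})e^{iu}+(A_1e^{rv}-A_2e^{-rv}),$$ where $r$ is a positive constant, $A_1=\big(-\tfrac{\sqrt2}{4r},\tfrac{\sqrt2}{4r}\big)$ and $A_2=\big(\tfrac{1-2ir}{2\sqrt2\,r},\tfrac{-1-2ir}{2\sqrt2\,r}\big)$.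
   Context: $\mathbb{C}^2_1$ is $\mathbb{C}^2$ with the flat metric $\langle z,w\rangle=\mathrm{Re}(-z_1\bar w_1+z_2\bar w_2)$ and complex structure $J$ given by multiplication by $i$. A Lagrangian, Lorentzian surface $M$ is an immersed real surface whose induced metric has signature $(1,1)$ and such that $J$ interchanges the tangent and the normal spaces. Let $h$ be its second fundamental form, $\widetilde\nabla_XY=\nabla_XY+h(X,Y)$. A tangent vector $v\neq 0$ is lightlike if $\langle v,v\rangle=0$. $M$ is lightlike (pseudo-)isotropic if for every lightlike tangent vector $v$ one has $\langle h(v,v),h(v,v)\rangle=0$. It is proper lightlike (pseudo-)isotropic if in addition it has no minimal points, i.e. the trace of $h$ vanishes at no point. A proper lightlike isotropic surface is of Type 2 if at every point, for every lightlike tangent vector $v$, the vectors $h(v,v)$ and $Jv$ are linearly dependent (over $\mathbb{R}$). (Locally) congruent means: every point of $M$ has a neighbourhood whose image, after applying a holomorphic isometry of $\mathbb{C}^2_1$, coincides with the image under one of the listed maps $f$ of an open subset of the $(u,v)$-plane. *)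

(* Defs.v *)
From Stdlib Require Export Reals Lra.
From Coquelicot Require Export Coquelicot.

Open Scope R_scope.

(** * The pseudo-Euclidean complex plane [C^2_1] *)

Definition C2 : Type := (C * C)%type.

Definition add2 (z w : C2) : C2 := plus z w.
Definition sub2 (z w : C2) : C2 := minus z w.
Definition cscal (c : C) (z : C2) : C2 := scal c z.
Definition rscal (c : R) (z : C2) : C2 := scal c z.
Definition zero2 : C2 := zero.

Definition metric (z w : C2) : R :=
  Re (- (fst z * Cconj (fst w)) + snd z * Cconj (snd w))%C.

Definition J (z : C2) : C2 := cscal Ci z.

(* A C-linear differential is part of [filterdiff] over [C_AbsRing]. *)
Definition holomorphic_isometry (Phi : C2 -> C2) : Prop :=
  (exists Psi : C2 -> C2,
      (forall z, Psi (Phi z) = z) /\ (forall z, Phi (Psi z) = z)) /\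
  exists dPhi : C2 -> C2 -> C2,
    (forall z : C2,
        @filterdiff C_AbsRing
          (prod_NormedModule C_AbsRing C_NormedModule C_NormedModule)
          (prod_NormedModule C_AbsRing C_NormedModule C_NormedModule)
          Phi (locally z) (dPhi z)) /\
    (forall z v w : C2, metric (dPhi z v) (dPhi z w) = metric v w).

(** * Smooth surfaces *)

(* All iterated partial derivatives exist and are continuous at [p]; imposed at
   every point of an open set, this is smoothness there. *)
Definition smooth_at (f : R -> R -> R) (p : R * R) : Prop :=
  forall n : nat, ex_diff_n f n (fst p) (snd p).

(* Charts are given by the inverse maps [param i : dom i -> M]; [param i] has
   no meaning outside [dom i]. *)
Record atlas (M : Type) : Type := {
  chart : Type;
  dom : chart -> R * R -> Prop;
  param : chart -> R * R -> M;
  dom_open : forall i, open (dom i);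
  param_inj : forall i p q, dom i p -> dom i q -> param i p = param i q -> p = q;
  param_cover : forall m : M, exists i p, dom i p /\ param i p = m;
  overlap : chart -> chart -> R * R -> Prop :=
    fun i j p => dom i p /\ exists q, dom j q /\ param j q = param i p;
  overlap_open : forall i j, open (overlap i j);
  transition_smooth : forall i j, exists t1 t2 : R -> R -> R,
    forall p, overlap i j p ->
      dom j (t1 (fst p) (snd p), t2 (fst p) (snd p)) /\
      param j (t1 (fst p) (snd p), t2 (fst p) (snd p)) = param i p /\
      smooth_at t1 p /\ smooth_at t2 p
}.

Arguments chart {M} _.
Arguments dom {M} _ _ _.
Arguments param {M} _ _ _.

(* The manifold topology induced by the atlas. *)
Definition atlas_open {M : Type} (A : atlas M) (W : M -> Prop) : Prop :=
  forall i : chart A, open (fun p => dom A i p /\ W (param A i p)).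

Record surface : Type := {
  carrier :> Type;
  surface_atlas : atlas carrier;
  surface_hausdorff : forall x y : carrier, x <> y ->
    exists U V, atlas_open surface_atlas U /\ atlas_open surface_atlas V /\
      U x /\ V y /\ forall z, ~ (U z /\ V z);
  surface_second_countable : exists B : nat -> carrier -> Prop,
    (forall n, atlas_open surface_atlas (B n)) /\
    forall W x, atlas_open surface_atlas W -> W x ->
      exists n, B n x /\ forall y, B n y -> W y
}.

Definition surf_open {M : surface} (W : M -> Prop) : Prop :=
  atlas_open (surface_atlas M) W.

(** * Geometry of a parametrized surface [F : R -> R -> C2] *)

Definition curve_derive (g : R -> C2) (t : R) : C2 :=
  ((Derive (fun s => Re (fst (g s))) t, Derive (fun s => Im (fst (g s))) t),
   (Derive (fun s => Re (snd (g s))) t, Derive (fun s => Im (snd (g s))) t)).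

Definition pd1 (F : R -> R -> C2) (u v : R) : C2 :=
  curve_derive (fun t => F t v) u.
Definition pd2 (F : R -> R -> C2) (u v : R) : C2 :=
  curve_derive (fun t => F u t) v.

Definition smooth_map_at (F : R -> R -> C2) (p : R * R) : Prop :=
  smooth_at (fun u v => Re (fst (F u v))) p /\
  smooth_at (fun u v => Im (fst (F u v))) p /\
  smooth_at (fun u v => Re (snd (F u v))) p /\
  smooth_at (fun u v => Im (snd (F u v))) p.

(* [dF F p a] is the tangent vector with coordinates [a]. *)
Definition dF (F : R -> R -> C2) (p a : R * R) : C2 :=
  add2 (rscal (fst a) (pd1 F (fst p) (snd p)))
       (rscal (snd a) (pd2 F (fst p) (snd p))).

Definition immersive_at (F : R -> R -> C2) (p : R * R) : Prop :=
  forall a : R * R, dF F p a = zero2 -> a = (0, 0).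

Definition tangent (F : R -> R -> C2) (p : R * R) (w : C2) : Prop :=
  exists a : R * R, w = dF F p a.

Definition normal (F : R -> R -> C2) (p : R * R) (w : C2) : Prop :=
  forall t : C2, tangent F p t -> metric w t = 0.

Definition lorentzian_at (F : R -> R -> C2) (p : R * R) : Prop :=
  exists e1 e2 : C2, tangent F p e1 /\ tangent F p e2 /\
    metric e1 e1 = -1 /\ metric e2 e2 = 1 /\ metric e1 e2 = 0.

Definition lagrangian_at (F : R -> R -> C2) (p : R * R) : Prop :=
  forall w : C2,
    (tangent F p w <-> normal F p (J w)) /\ (normal F p w <-> tangent F p (J w)).

Definition gE (F : R -> R -> C2) (p : R * R) : R :=
  metric (pd1 F (fst p) (snd p)) (pd1 F (fst p) (snd p)).
Definition gF (F : R -> R -> C2) (p : R * R) : R :=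
  metric (pd1 F (fst p) (snd p)) (pd2 F (fst p) (snd p)).
Definition gG (F : R -> R -> C2) (p : R * R) : R :=
  metric (pd2 F (fst p) (snd p)) (pd2 F (fst p) (snd p)).
Definition gdet (F : R -> R -> C2) (p : R * R) : R :=
  gE F p * gG F p - gF F p * gF F p.

(* Orthogonal projection onto the tangent plane, by inverting the Gram matrix;
   meaningful when [gdet F p <> 0] (see [normal_part_normal]). *)
Definition tangential_part (F : R -> R -> C2) (p : R * R) (w : C2) : C2 :=
  let a := metric w (pd1 F (fst p) (snd p)) in
  let b := metric w (pd2 F (fst p) (snd p)) in
  dF F p ((a * gG F p - b * gF F p) / gdet F p,
          (b * gE F p - a * gF F p) / gdet F p).

Definition normal_part (F : R -> R -> C2) (p : R * R) (w : C2) : C2 :=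
  sub2 w (tangential_part F p w).

(* The ambient derivative of the tangent field [q |-> dF F q b] (constant
   coordinates [b]) in the direction [dF F p a]. *)
Definition ambient_deriv (F : R -> R -> C2) (p a b : R * R) : C2 :=
  dF (fun u v => dF F (u, v) b) p a.

(* Second fundamental form: the normal part in Gauss' formula.  As it is
   tensorial, extending by constant coordinates loses no generality. *)
Definition sff (F : R -> R -> C2) (p a b : R * R) : C2 :=
  normal_part F p (ambient_deriv F p a b).

(* Metric trace of the second fundamental form. *)
Definition trace_sff (F : R -> R -> C2) (p : R * R) : C2 :=
  rscal (/ gdet F p)
    (add2 (sub2 (rscal (gG F p) (sff F p (1, 0) (1, 0)))
                (rscal (2 * gF F p) (sff F p (1, 0) (0, 1))))
          (rscal (gE F p) (sff F p (0, 1) (0, 1)))).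

Definition lightlike (F : R -> R -> C2) (p a : R * R) : Prop :=
  dF F p a <> zero2 /\ metric (dF F p a) (dF F p a) = 0.

Definition lightlike_isotropic_at (F : R -> R -> C2) (p : R * R) : Prop :=
  forall a, lightlike F p a -> metric (sff F p a a) (sff F p a a) = 0.

Definition type2_at (F : R -> R -> C2) (p : R * R) : Prop :=
  forall a, lightlike F p a ->
    exists s t : R, (s, t) <> (0, 0) /\
      add2 (rscal s (sff F p a a)) (rscal t (J (dF F p a))) = zero2.

(** * Immersed surfaces in [C^2_1] *)

Definition in_chart {M : surface} (X : M -> C2) (i : chart (surface_atlas M)) :
  R -> R -> C2 := fun u v => X (param (surface_atlas M) i (u, v)).

(* [P] is invariant under reparametrization in each use below. *)
Definition at_every_point {M : surface} (X : M -> C2)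
    (P : (R -> R -> C2) -> R * R -> Prop) : Prop :=
  forall (i : chart (surface_atlas M)) (p : R * R),
    dom (surface_atlas M) i p -> P (in_chart X i) p.

Definition immersion {M : surface} (X : M -> C2) : Prop :=
  at_every_point X smooth_map_at /\ at_every_point X immersive_at.

Definition lorentzian {M : surface} (X : M -> C2) : Prop :=
  at_every_point X lorentzian_at.

Definition lagrangian {M : surface} (X : M -> C2) : Prop :=
  at_every_point X lagrangian_at.

Definition lightlike_isotropic {M : surface} (X : M -> C2) : Prop :=
  at_every_point X lightlike_isotropic_at.

Definition proper_lightlike_isotropic {M : surface} (X : M -> C2) : Prop :=
  lightlike_isotropic X /\ at_every_point X (fun F p => trace_sff F p <> zero2).

Definition type2 {M : surface} (X : M -> C2) : Prop :=
  at_every_point X type2_at.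

(** * The model surfaces *)

Definition cis (u : R) : C := (cos u, sin u).

Definition model1 (u v : R) : C2 :=
  let A1 : C2 := (RtoC (sqrt 2 / 2), RtoC (sqrt 2 / 2)) in
  let A2 : C2 := ((- (RtoC (sqrt 2 / 2) * Ci))%C, (RtoC (sqrt 2 / 2) * Ci)%C) in
  cscal (cis u) (add2 (rscal v A1) A2).

Definition model2 (r u v : R) : C2 :=
  let A1 : C2 := (RtoC (- (sqrt 2 / (4 * r))), RtoC (sqrt 2 / (4 * r))) in
  let A2 : C2 :=
    (((1 - 2 * Ci * RtoC r) / RtoC (2 * sqrt 2 * r))%C,
     ((- (1) - 2 * Ci * RtoC r) / RtoC (2 * sqrt 2 * r))%C) in
  add2
    (cscal (cis u) (add2 (rscal (exp (r * v)) A1) (rscal (exp (- (r * v))) A2)))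
    (sub2 (rscal (exp (r * v)) A1) (rscal (exp (- (r * v))) A2)).

(* After applying [Phi], the image of [W] is the image under [f] of an open
   subset of the parameter plane. *)
Definition congruent_via {M : surface} (X : M -> C2) (W : M -> Prop)
    (Phi : C2 -> C2) (f : R -> R -> C2) : Prop :=
  exists Omega : R * R -> Prop, open Omega /\
    forall z : C2,
      (exists m : M, W m /\ z = Phi (X m)) <->
      (exists p : R * R, Omega p /\ z = f (fst p) (snd p)).

(** * Gauss' decomposition *)

Lemma metricC z w : metric z w = metric w z.
Proof. destruct z as [[] []], w as [[] []]; compute; ring. Qed.

Lemma metric_addl z1 z2 w : metric (add2 z1 z2) w = metric z1 w + metric z2 w.
Proof. destruct z1 as [[] []], z2 as [[] []], w as [[] []]; compute; ring. Qed.

Lemma metric_subl z1 z2 w : metric (sub2 z1 z2) w = metric z1 w - metric z2 w.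
Proof. destruct z1 as [[] []], z2 as [[] []], w as [[] []]; compute; ring. Qed.

Lemma metric_scall c z w : metric (rscal c z) w = c * metric z w.
Proof. destruct z as [[] []], w as [[] []]; compute; ring. Qed.

Lemma tangential_part_tangent F p w : tangent F p (tangential_part F p w).
Proof. eexists; reflexivity. Qed.

Lemma normal_part_normal F p w :
  gdet F p <> 0 -> normal F p (normal_part F p w).
Proof.
intros Hd t [a ->].
rewrite metricC; unfold dF; rewrite metric_addl, !metric_scall, !(metricC _ (normal_part _ _ _)).
unfold normal_part, tangential_part, dF; cbn [fst snd].
rewrite !metric_subl, !metric_addl, !metric_scall.
rewrite (metricC (pd2 F _ _) (pd1 F _ _)).
fold (gE F p) (gF F p) (gG F p).
unfold gdet in *; field; exact Hd.
Qed.

Lemma lorentzian_gdet F p : lorentzian_at F p -> gdet F p <> 0.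
Proof.
intros (e1 & e2 & [a ->] & [b ->] & H11 & H22 & H12) Hd.
assert (E : forall c d, metric (dF F p c) (dF F p d) =
  fst c * fst d * gE F p + (fst c * snd d + snd c * fst d) * gF F p
  + snd c * snd d * gG F p).
{ intros c d; unfold dF.
  rewrite metric_addl, !metric_scall, !(metricC _ (add2 _ _)), !metric_addl,
    !metric_scall, (metricC (pd2 F _ _) (pd1 F _ _)).
  fold (gE F p) (gF F p) (gG F p); ring. }
rewrite E in H11, H22, H12; unfold gdet in Hd.
set (k := fst a * snd b - snd a * fst b).
assert (Hk : k * k * (gE F p * gG F p - gF F p * gF F p) = -1 * 1 - 0 * 0).
{ rewrite <- H11 at 1; rewrite <- H22 at 1; rewrite <- H12; unfold k; ring. }
rewrite Hd in Hk; lra.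
Qed.

(* Main.v *)
(* Along a Type 2 surface choose null vector fields N1, N2 with images Z, W
   satisfying <Z, W> = 1, scaled so that h(N1, N1) = J Z; one of the two null
   directions has h nonzero because the mean curvature does not vanish.  The
   Gauss and Codazzi equations then force, for real functions om and la,
     N1 Z = iZ,  N1 W = i(la Z + W),
     N2 Z = (-om + i la)Z + iW,  N2 W = (om + i la)W,
     N1 la = om,  N1 om = -la,  N2 la = la om,  N2 om = -la^2,
     [N1, N2] = om N1,
   so la^2 + om^2 = r^2 is constant.  If r = 0, then W = e^{iu} B and
   Z = e^{iu}(A - ivB) with A, B constant, and X + iZ is constant: the first
   model.  If r > 0, then om + i la = r e^{iu} defines u, the fields
   S = -i e^{-iu} Z and T = e^{-iu}(W + i om Z)/r satisfy N1 S = N1 T = 0,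
   N2 S = rT, N2 T = rS, and X - (e^{iu} S + T) is constant: the second model.
   The zeros of la need no separate treatment: they are the points sin u = 0.
   A unitary map sending one null pair of C^2 to another with the same
   Hermitian product matches the surface with the model. *)

Require Import Defs.

(** * Smooth functions of two real variables *)

(** In general [N1] and [N2] do not commute, so they are not coordinate fields. The parameters [u]
    and [v] are therefore read off the solution itself: [u] as the argument of a complex function,
    [v] as a linear component or a logarithm. Every integration step then says that an explicit
    expression is annihilated by both fields, hence constant on a square.

    The second fundamental form is handled through the Hermitian form [herm]. On a Lagrangian
    surface [Im (herm v w)] with [w] tangent sees only the normal part of [v], so [h] becomes a
    totally symmetric cubic form, and Type 2 says that this form vanishes on null vectors. Two mixed
    coefficients remain. Not both vanish at a point with nonzero mean curvature, and the two
    scalings of the null directions normalise one of them and the product of the frame to 1.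

    It remains to see that [(u, v)] fills an open set of the parameter plane. The Jacobian is
    computed in the frame, and a contraction argument gives local surjectivity. *)

Definition open2 (U : R -> R -> Prop) := forall x y, U x y -> locally_2d U x y.

Definition smooth_on (U : R -> R -> Prop) (f : R -> R -> R) :=
  forall x y, U x y -> smooth_at f (x, y).

Section RealSmooth.

Variable U : R -> R -> Prop.
Hypothesis HU : open2 U.

Definition diff_on (n : nat) (f : R -> R -> R) :=
  forall x y, U x y -> ex_diff_n f n x y.

(** [ex_diff_n] speaks of [Derive f] as a function near a point. Openness of [U] lets any formulas
    [f1], [f2] valid on [U] stand for it, so closure under an operation reduces to its
    differentiation formula. *)
Lemma diff_on_S_intro n f f1 f2 :
  (forall x y, U x y -> continuity_2d_pt f x y) ->
  (forall x y, U x y -> is_derive (fun z => f z y) x (f1 x y)) ->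
  (forall x y, U x y -> is_derive (fun z => f x z) y (f2 x y)) ->
  diff_on n f1 -> diff_on n f2 -> diff_on (S n) f.
Proof.
intros Hc H1 H2 D1 D2 x y Hxy; simpl; repeat split.
- now apply Hc.
- exists (f1 x y); now apply H1.
- exists (f2 x y); now apply H2.
- apply ex_diff_n_ext_loc with f1; [|now apply D1].
  apply locally_2d_impl with (2 := HU x y Hxy); apply locally_2d_forall.
  intros u v Huv; symmetry; now apply is_derive_unique, H1.
- apply ex_diff_n_ext_loc with f2; [|now apply D2].
  apply locally_2d_impl with (2 := HU x y Hxy); apply locally_2d_forall.
  intros u v Huv; symmetry; now apply is_derive_unique, H2.
Qed.

Lemma diff_on_cont n f : diff_on n f -> forall x y, U x y -> continuity_2d_pt f x y.
Proof. intros H x y Hxy; specialize (H x y Hxy); destruct n; apply H. Qed.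

Definition partial1 (f : R -> R -> R) x y := Derive (fun z => f z y) x.
Definition partial2 (f : R -> R -> R) x y := Derive (fun z => f x z) y.

Lemma diff_on_S_elim n f : diff_on (S n) f ->
  (forall x y, U x y -> is_derive (fun z => f z y) x (partial1 f x y)) /\
  (forall x y, U x y -> is_derive (fun z => f x z) y (partial2 f x y)) /\
  diff_on n (partial1 f) /\ diff_on n (partial2 f).
Proof.
intros H; split; [|split; [|split]]; intros x y Hxy;
  destruct (H x y Hxy) as (_ & E1 & E2 & D1 & D2); try assumption; now apply Derive_correct.
Qed.

(** Differentiation formulas contain the undifferentiated functions again, and the induction needs
    these one order lower than assumed. *)
Lemma diff_on_pred n f : diff_on (S n) f -> diff_on n f.
Proof.
revert f; induction n as [|n IH]; intros f H.
- intros x y Hxy; split; [|exact I]; now apply (diff_on_cont _ _ H).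
- destruct (diff_on_S_elim _ _ H) as (E1 & E2 & D1 & D2).
  apply diff_on_S_intro with (partial1 f) (partial2 f); auto.
  exact (diff_on_cont _ _ H).
Qed.

Lemma diff_on_plus n f g : diff_on n f -> diff_on n g ->
  diff_on n (fun x y => f x y + g x y).
Proof.
revert f g; induction n as [|n IH]; intros f g Hf Hg.
- intros x y Hxy; split; [|exact I].
  apply continuity_2d_pt_plus; [now apply (diff_on_cont _ _ Hf)|now apply (diff_on_cont _ _ Hg)].
- destruct (diff_on_S_elim _ _ Hf) as (E1 & E2 & D1 & D2).
  destruct (diff_on_S_elim _ _ Hg) as (E1' & E2' & D1' & D2').
  apply diff_on_S_intro with (fun x y => partial1 f x y + partial1 g x y) (fun x y => partial2 f x y + partial2 g x y); auto.
  + intros x y Hxy; apply continuity_2d_pt_plus; [now apply (diff_on_cont _ _ Hf)|now apply (diff_on_cont _ _ Hg)].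
  + intros x y Hxy; apply (is_derive_plus (fun z => f z y) (fun z => g z y)); auto.
  + intros x y Hxy; apply (is_derive_plus (fun z => f x z) (fun z => g x z)); auto.
Qed.

Lemma diff_on_mult n f g : diff_on n f -> diff_on n g ->
  diff_on n (fun x y => f x y * g x y).
Proof.
revert f g; induction n as [|n IH]; intros f g Hf Hg.
- intros x y Hxy; split; [|exact I].
  apply continuity_2d_pt_mult; [now apply (diff_on_cont _ _ Hf)|now apply (diff_on_cont _ _ Hg)].
- destruct (diff_on_S_elim _ _ Hf) as (E1 & E2 & D1 & D2).
  destruct (diff_on_S_elim _ _ Hg) as (E1' & E2' & D1' & D2').
  assert (Hf' := diff_on_pred _ _ Hf); assert (Hg' := diff_on_pred _ _ Hg).
  apply diff_on_S_intro with (fun x y => partial1 f x y * g x y + f x y * partial1 g x y) (fun x y => partial2 f x y * g x y + f x y * partial2 g x y).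
  + intros x y Hxy; apply continuity_2d_pt_mult; [now apply (diff_on_cont _ _ Hf)|now apply (diff_on_cont _ _ Hg)].
  + intros x y Hxy; apply (is_derive_mult (fun z => f z y) (fun z => g z y)); auto.
    intros; apply Rmult_comm.
  + intros x y Hxy; apply (is_derive_mult (fun z => f x z) (fun z => g x z)); auto.
    intros; apply Rmult_comm.
  + apply (diff_on_plus n (fun x y => partial1 f x y * g x y) (fun x y => f x y * partial1 g x y)); apply IH; auto.
  + apply (diff_on_plus n (fun x y => partial2 f x y * g x y) (fun x y => f x y * partial2 g x y)); apply IH; auto.
Qed.

Lemma diff_on_const n c : diff_on n (fun _ _ => c).
Proof.
revert c; induction n as [|n IH]; intros c.
- intros x y _; split; [|exact I]; apply continuity_2d_pt_const.
- apply diff_on_S_intro with (fun _ _ => 0) (fun _ _ => 0); auto.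
  + intros x y _; apply continuity_2d_pt_const.
  + intros x y _; apply (is_derive_const c x).
  + intros x y _; apply (is_derive_const c y).
Qed.

(** The derivative is written as a product with two factors [/ f], so the induction hypothesis for
    the same [f] closes the step. *)
Lemma diff_on_inv n f : (forall x y, U x y -> f x y <> 0) -> diff_on n f ->
  diff_on n (fun x y => / f x y).
Proof.
intros Hn; induction n as [|n IH]; intros Hf.
- intros x y Hxy; split; [|exact I].
  apply continuity_2d_pt_inv; [now apply (diff_on_cont _ _ Hf)|auto].
- destruct (diff_on_S_elim _ _ Hf) as (E1 & E2 & D1 & D2).
  assert (Hi := IH (diff_on_pred _ _ Hf)).
  assert (Hg : forall g, diff_on n g -> diff_on n (fun x y => -1 * (g x y * (/ f x y * / f x y)))).
  { intros g Dg.
    apply (diff_on_mult n (fun _ _ => -1) (fun x y => g x y * (/ f x y * / f x y))); [apply diff_on_const|].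
    apply (diff_on_mult n g (fun x y => / f x y * / f x y)); [exact Dg|].
    now apply (diff_on_mult n (fun x y => / f x y) (fun x y => / f x y)). }
  apply diff_on_S_intro with (fun x y => -1 * (partial1 f x y * (/ f x y * / f x y)))
    (fun x y => -1 * (partial2 f x y * (/ f x y * / f x y))); auto.
  + intros x y Hxy; apply continuity_2d_pt_inv; [now apply (diff_on_cont _ _ Hf)|auto].
  + intros x y Hxy.
    replace (_ * _) with (- partial1 f x y / f x y ^ 2) by (field; auto).
    apply (is_derive_inv (fun z => f z y)); auto.
  + intros x y Hxy.
    replace (_ * _) with (- partial2 f x y / f x y ^ 2) by (field; auto).
    apply (is_derive_inv (fun z => f x z)); auto.
Qed.

Lemma diff_on_sqrt n f : (forall x y, U x y -> 0 < f x y) -> diff_on n f ->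
  diff_on n (fun x y => sqrt (f x y)).
Proof.
intros Hp.
assert (Hc : forall k x y, diff_on k f -> U x y -> continuity_2d_pt (fun x y => sqrt (f x y)) x y).
{ intros k x y Hf Hxy; apply continuity_1d_2d_pt_comp; [|now apply (diff_on_cont _ _ Hf)].
  apply continuity_pt_sqrt; apply Rlt_le; auto. }
induction n as [|n IH]; intros Hf.
- intros x y Hxy; split; [now apply (Hc 0%nat)|exact I].
- destruct (diff_on_S_elim _ _ Hf) as (E1 & E2 & D1 & D2).
  assert (Hi := IH (diff_on_pred _ _ Hf)).
  assert (Hs : forall x y, U x y -> 2 * sqrt (f x y) <> 0).
  { intros x y Hxy; apply Rgt_not_eq, Rmult_lt_0_compat; [lra|]; apply sqrt_lt_R0; auto. }
  assert (Hg : diff_on n (fun x y => / (2 * sqrt (f x y)))).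
  { apply (diff_on_inv n (fun x y => 2 * sqrt (f x y))); [exact Hs|].
    apply (diff_on_mult n (fun _ _ => 2) (fun x y => sqrt (f x y))); [apply diff_on_const|exact Hi]. }
  apply diff_on_S_intro with (fun x y => partial1 f x y * / (2 * sqrt (f x y)))
    (fun x y => partial2 f x y * / (2 * sqrt (f x y))).
  + intros x y; now apply (Hc (S n)).
  + intros x y Hxy; apply (is_derive_sqrt (fun z => f z y)); auto.
  + intros x y Hxy; apply (is_derive_sqrt (fun z => f x z)); auto.
  + now apply (diff_on_mult n (partial1 f) (fun x y => / (2 * sqrt (f x y)))).
  + now apply (diff_on_mult n (partial2 f) (fun x y => / (2 * sqrt (f x y)))).
Qed.

Lemma smooth_on_diff f : smooth_on U f <-> forall n, diff_on n f.
Proof. split; [intros H n x y Hxy; exact (H x y Hxy n)|intros H x y Hxy n; exact (H n x y Hxy)]. Qed.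

Lemma smooth_plus f g : smooth_on U f -> smooth_on U g -> smooth_on U (fun x y => f x y + g x y).
Proof. rewrite !smooth_on_diff; intros; apply diff_on_plus; auto. Qed.

Lemma smooth_mult f g : smooth_on U f -> smooth_on U g -> smooth_on U (fun x y => f x y * g x y).
Proof. rewrite !smooth_on_diff; intros; apply diff_on_mult; auto. Qed.

Lemma smooth_const c : smooth_on U (fun _ _ => c).
Proof. rewrite smooth_on_diff; intros; apply diff_on_const. Qed.

Lemma smooth_inv f : (forall x y, U x y -> f x y <> 0) -> smooth_on U f -> smooth_on U (fun x y => / f x y).
Proof. rewrite !smooth_on_diff; intros; apply diff_on_inv; auto. Qed.

Lemma smooth_sqrt f : (forall x y, U x y -> 0 < f x y) -> smooth_on U f -> smooth_on U (fun x y => sqrt (f x y)).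
Proof. rewrite !smooth_on_diff; intros; apply diff_on_sqrt; auto. Qed.

Lemma smooth_ext f g : (forall x y, f x y = g x y) -> smooth_on U f -> smooth_on U g.
Proof.
intros E H x y Hxy n; apply ex_diff_n_ext_loc with f; [|exact (H x y Hxy n)].
now apply locally_2d_forall.
Qed.

Lemma smooth_opp f : smooth_on U f -> smooth_on U (fun x y => - f x y).
Proof.
intros H; apply smooth_ext with (fun x y => -1 * f x y); [intros; ring|].
apply (smooth_mult (fun _ _ => -1) f); auto using smooth_const.
Qed.

Lemma smooth_minus f g : smooth_on U f -> smooth_on U g -> smooth_on U (fun x y => f x y - g x y).
Proof. intros; apply (smooth_plus f (fun x y => - g x y)); auto using smooth_opp. Qed.

Lemma smooth_partial1 f : smooth_on U f -> smooth_on U (partial1 f).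
Proof. rewrite !smooth_on_diff; intros H n; apply (diff_on_S_elim n f), H. Qed.

Lemma smooth_partial2 f : smooth_on U f -> smooth_on U (partial2 f).
Proof. rewrite !smooth_on_diff; intros H n; apply (diff_on_S_elim n f), H. Qed.

Lemma smooth_cont f x y : smooth_on U f -> U x y -> continuity_2d_pt f x y.
Proof. intros H Hxy; exact (proj1 (H x y Hxy 0%nat)). Qed.

Lemma smooth_ex1 f x y : smooth_on U f -> U x y -> ex_derive (fun z => f z y) x.
Proof. intros H Hxy; exact (proj1 (proj2 (H x y Hxy 1%nat))). Qed.

Lemma smooth_ex2 f x y : smooth_on U f -> U x y -> ex_derive (fun z => f x z) y.
Proof. intros H Hxy; exact (proj1 (proj2 (proj2 (H x y Hxy 1%nat)))). Qed.

Lemma partial_comm f x y : smooth_on U f -> U x y -> partial1 (partial2 f) x y = partial2 (partial1 f) x y.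
Proof.
intros H Hxy; apply (Schwarz f x y).
- apply locally_2d_impl with (2 := HU x y Hxy); apply locally_2d_forall; intros u v Huv.
  repeat split.
  + now apply smooth_ex1.
  + now apply smooth_ex2.
  + apply (smooth_ex1 (partial2 f)); auto using smooth_partial2.
  + apply (smooth_ex2 (partial1 f)); auto using smooth_partial1.
- apply (smooth_cont (partial1 (partial2 f))); auto using smooth_partial1, smooth_partial2.
- apply (smooth_cont (partial2 (partial1 f))); auto using smooth_partial1, smooth_partial2.
Qed.

End RealSmooth.

(** * Directional derivatives *)

(* [rdd], [dd], [dd2]: derivative along the constant vector [(a, b)] of real-, [C]- and
   [C2]-valued functions; the relations [is_rdd], [is_dd], [is_dd2] also assert that the
   partial derivatives exist, which [Derive] alone does not. *)
Definition rdd (a b : R) (f : R -> R -> R) x y : R := a * partial1 f x y + b * partial2 f x y.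

Definition is_rdd (a b : R) (f : R -> R -> R) (x y l : R) : Prop :=
  ex_derive (fun z => f z y) x /\ ex_derive (fun z => f x z) y /\ rdd a b f x y = l.

Lemma is_rdd_intro a b f x y f1 f2 l :
  is_derive (fun z => f z y) x f1 -> is_derive (fun z => f x z) y f2 ->
  a * f1 + b * f2 = l -> is_rdd a b f x y l.
Proof.
intros H1 H2 <-; split; [now exists f1|split; [now exists f2|]].
unfold rdd; f_equal; f_equal; now apply is_derive_unique.
Qed.

Lemma is_rdd_elim a b f x y l : is_rdd a b f x y l ->
  is_derive (fun z => f z y) x (partial1 f x y) /\ is_derive (fun z => f x z) y (partial2 f x y) /\
  a * partial1 f x y + b * partial2 f x y = l.
Proof. intros (H1 & H2 & H); split; [|split]; auto; now apply Derive_correct. Qed.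

Lemma is_rdd_unique a b f x y l : is_rdd a b f x y l -> rdd a b f x y = l.
Proof. now intros (_ & _ & H). Qed.

Lemma is_rdd_eq a b f x y l l' : is_rdd a b f x y l -> l = l' -> is_rdd a b f x y l'.
Proof. now intros H <-. Qed.

Lemma is_rdd_ext a b f g x y l : locally_2d (fun u v => f u v = g u v) x y ->
  is_rdd a b f x y l -> is_rdd a b g x y l.
Proof.
intros E H; destruct (is_rdd_elim _ _ _ _ _ _ H) as (H1 & H2 & H3).
apply is_rdd_intro with (partial1 f x y) (partial2 f x y); auto.
- apply is_derive_ext_loc with (2 := H1); exact (locally_2d_1d_const_y _ _ _ E).
- apply is_derive_ext_loc with (2 := H2); exact (locally_2d_1d_const_x _ _ _ E).
Qed.

Lemma is_rdd_const a b c x y : is_rdd a b (fun _ _ => c) x y 0.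
Proof.
apply is_rdd_intro with 0 0; [apply (is_derive_const c x)|apply (is_derive_const c y)|ring].
Qed.

Lemma is_rdd_plus a b f g x y l m : is_rdd a b f x y l -> is_rdd a b g x y m ->
  is_rdd a b (fun x y => f x y + g x y) x y (l + m).
Proof.
intros H H'; destruct (is_rdd_elim _ _ _ _ _ _ H) as (H1 & H2 & <-).
destruct (is_rdd_elim _ _ _ _ _ _ H') as (H1' & H2' & <-).
apply is_rdd_intro with (partial1 f x y + partial1 g x y) (partial2 f x y + partial2 g x y); [| |ring].
- exact (is_derive_plus _ _ _ _ _ H1 H1').
- exact (is_derive_plus _ _ _ _ _ H2 H2').
Qed.

Lemma is_rdd_mult a b f g x y l m : is_rdd a b f x y l -> is_rdd a b g x y m ->
  is_rdd a b (fun x y => f x y * g x y) x y (l * g x y + f x y * m).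
Proof.
intros H H'; destruct (is_rdd_elim _ _ _ _ _ _ H) as (H1 & H2 & <-).
destruct (is_rdd_elim _ _ _ _ _ _ H') as (H1' & H2' & <-).
apply is_rdd_intro with (partial1 f x y * g x y + f x y * partial1 g x y) (partial2 f x y * g x y + f x y * partial2 g x y); [| |ring].
- exact (is_derive_mult _ _ _ _ _ H1 H1' Rmult_comm).
- exact (is_derive_mult _ _ _ _ _ H2 H2' Rmult_comm).
Qed.

Lemma is_rdd_opp a b f x y l : is_rdd a b f x y l -> is_rdd a b (fun x y => - f x y) x y (- l).
Proof.
intros H; apply is_rdd_ext with (fun x y => -1 * f x y).
- apply locally_2d_forall; intros; ring.
- eapply is_rdd_eq; [apply (is_rdd_mult a b (fun _ _ => -1) f); [apply is_rdd_const|exact H]|ring].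
Qed.

Lemma is_rdd_minus a b f g x y l m : is_rdd a b f x y l -> is_rdd a b g x y m ->
  is_rdd a b (fun x y => f x y - g x y) x y (l - m).
Proof. intros; apply (is_rdd_plus a b f (fun x y => - g x y)); auto using is_rdd_opp. Qed.

Lemma is_rdd_comp a b h f x y l dh : is_derive h (f x y) dh -> is_rdd a b f x y l ->
  is_rdd a b (fun x y => h (f x y)) x y (dh * l).
Proof.
intros Hh H; destruct (is_rdd_elim _ _ _ _ _ _ H) as (H1 & H2 & <-).
apply is_rdd_intro with (partial1 f x y * dh) (partial2 f x y * dh); [| |ring].
- exact (is_derive_comp h (fun z => f z y) _ _ _ Hh H1).
- exact (is_derive_comp h (fun z => f x z) _ _ _ Hh H2).
Qed.

Lemma is_rdd_smooth U a b f x y : smooth_on U f -> U x y -> is_rdd a b f x y (rdd a b f x y).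
Proof.
intros Hf Hxy; split; [|split]; [now apply (smooth_ex1 U)|now apply (smooth_ex2 U)|reflexivity].
Qed.

Lemma smooth_rdd U a b f : open2 U -> smooth_on U a -> smooth_on U b -> smooth_on U f ->
  smooth_on U (fun x y => rdd (a x y) (b x y) f x y).
Proof.
intros HU Ha Hb Hf; apply (smooth_plus U HU (fun x y => a x y * partial1 f x y)).
- apply smooth_mult; auto using smooth_partial1.
- apply smooth_mult; auto using smooth_partial2.
Qed.

(** The right side differentiates along the Lie bracket of the two fields: the second derivatives of
    [f] cancel by [partial_comm] and only derivatives of the coefficients survive. *)
Lemma rdd_commutator U a1 b1 a2 b2 f x y : open2 U ->
  smooth_on U a1 -> smooth_on U b1 -> smooth_on U a2 -> smooth_on U b2 ->
  smooth_on U f -> U x y ->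
  rdd (a1 x y) (b1 x y) (fun x y => rdd (a2 x y) (b2 x y) f x y) x y
  - rdd (a2 x y) (b2 x y) (fun x y => rdd (a1 x y) (b1 x y) f x y) x y
  = rdd (rdd (a1 x y) (b1 x y) a2 x y - rdd (a2 x y) (b2 x y) a1 x y)
        (rdd (a1 x y) (b1 x y) b2 x y - rdd (a2 x y) (b2 x y) b1 x y) f x y.
Proof.
intros HU Ha1 Hb1 Ha2 Hb2 Hf Hxy.
assert (H : forall a b c d, smooth_on U c -> smooth_on U d ->
  rdd a b (fun x y => rdd (c x y) (d x y) f x y) x y =
  rdd a b c x y * partial1 f x y + c x y * rdd a b (partial1 f) x y
  + (rdd a b d x y * partial2 f x y + d x y * rdd a b (partial2 f) x y)).
{ intros a b c d Hc Hd; apply is_rdd_unique.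
  apply (is_rdd_plus a b (fun x y => c x y * partial1 f x y) (fun x y => d x y * partial2 f x y));
  apply is_rdd_mult; apply (is_rdd_smooth U); auto using smooth_partial1, smooth_partial2. }
rewrite !H by assumption.
unfold rdd; rewrite (partial_comm U HU f x y Hf Hxy); ring.
Qed.

(** * Complex-valued functions *)

Definition csmooth (U : R -> R -> Prop) (f : R -> R -> C) : Prop :=
  smooth_on U (fun x y => Re (f x y)) /\ smooth_on U (fun x y => Im (f x y)).

Definition dd (a b : R) (f : R -> R -> C) x y : C :=
  (rdd a b (fun x y => Re (f x y)) x y, rdd a b (fun x y => Im (f x y)) x y).

Definition is_dd (a b : R) (f : R -> R -> C) (x y : R) (l : C) : Prop :=
  is_rdd a b (fun x y => Re (f x y)) x y (Re l) /\
  is_rdd a b (fun x y => Im (f x y)) x y (Im l).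

Lemma is_dd_unique a b f x y l : is_dd a b f x y l -> dd a b f x y = l.
Proof.
intros [H1 H2]; unfold dd; rewrite (is_rdd_unique _ _ _ _ _ _ H1), (is_rdd_unique _ _ _ _ _ _ H2).
now destruct l.
Qed.

Lemma is_dd_eq a b f x y l l' : is_dd a b f x y l -> l = l' -> is_dd a b f x y l'.
Proof. now intros H <-. Qed.

Lemma is_dd_ext a b f g x y l : locally_2d (fun u v => f u v = g u v) x y ->
  is_dd a b f x y l -> is_dd a b g x y l.
Proof.
intros E [H1 H2]; split; [apply is_rdd_ext with (2 := H1)|apply is_rdd_ext with (2 := H2)];
apply locally_2d_impl with (2 := E), locally_2d_forall; now intros u v ->.
Qed.

Lemma is_dd_const a b c x y : is_dd a b (fun _ _ => c) x y 0%C.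
Proof. split; apply is_rdd_const. Qed.

Lemma is_dd_RtoC a b f x y l : is_rdd a b f x y l -> is_dd a b (fun x y => RtoC (f x y)) x y (RtoC l).
Proof. intros H; split; [exact H|exact (is_rdd_const a b 0 x y)]. Qed.

Lemma is_dd_plus a b f g x y l m : is_dd a b f x y l -> is_dd a b g x y m ->
  is_dd a b (fun x y => (f x y + g x y)%C) x y (l + m)%C.
Proof.
intros [H1 H2] [H1' H2']; split.
- exact (is_rdd_plus _ _ _ _ _ _ _ _ H1 H1').
- exact (is_rdd_plus _ _ _ _ _ _ _ _ H2 H2').
Qed.

Lemma is_dd_opp a b f x y l : is_dd a b f x y l -> is_dd a b (fun x y => (- f x y)%C) x y (- l)%C.
Proof.
intros [H1 H2]; split; [exact (is_rdd_opp _ _ _ _ _ _ H1)|exact (is_rdd_opp _ _ _ _ _ _ H2)].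
Qed.

Lemma is_dd_minus a b f g x y l m : is_dd a b f x y l -> is_dd a b g x y m ->
  is_dd a b (fun x y => (f x y - g x y)%C) x y (l - m)%C.
Proof. intros; apply (is_dd_plus a b f (fun x y => (- g x y)%C)); auto using is_dd_opp. Qed.

Lemma is_dd_conj a b f x y l : is_dd a b f x y l -> is_dd a b (fun x y => Cconj (f x y)) x y (Cconj l).
Proof. intros [H1 H2]; split; [exact H1|exact (is_rdd_opp _ _ _ _ _ _ H2)]. Qed.

Lemma is_dd_mult a b f g x y l m : is_dd a b f x y l -> is_dd a b g x y m ->
  is_dd a b (fun x y => (f x y * g x y)%C) x y (l * g x y + f x y * m)%C.
Proof.
intros [H1 H2] [H1' H2']; split; eapply is_rdd_eq.
- apply (is_rdd_minus _ _ _ _ _ _ _ _ (is_rdd_mult _ _ _ _ _ _ _ _ H1 H1') (is_rdd_mult _ _ _ _ _ _ _ _ H2 H2')).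
- simpl; unfold Re, Im; ring.
- apply (is_rdd_plus _ _ _ _ _ _ _ _ (is_rdd_mult _ _ _ _ _ _ _ _ H1 H2') (is_rdd_mult _ _ _ _ _ _ _ _ H2 H1')).
- simpl; unfold Re, Im; ring.
Qed.

Lemma is_dd_cis a b u x y l : is_rdd a b u x y l ->
  is_dd a b (fun x y => cis (u x y)) x y (Ci * RtoC l * cis (u x y))%C.
Proof.
intros H; split; eapply is_rdd_eq.
- apply (is_rdd_comp a b cos u); [apply is_derive_cos|exact H].
- simpl; unfold Re, Im; simpl; ring.
- apply (is_rdd_comp a b sin u); [apply is_derive_sin|exact H].
- simpl; unfold Re, Im; simpl; ring.
Qed.

Lemma is_dd_exp a b u x y l : is_rdd a b u x y l ->
  is_dd a b (fun x y => RtoC (exp (u x y))) x y (RtoC l * RtoC (exp (u x y)))%C.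
Proof.
intros H; eapply is_dd_eq.
- apply is_dd_RtoC, (is_rdd_comp a b exp u); [apply is_derive_exp|exact H].
- rewrite RtoC_mult; ring.
Qed.

Lemma is_dd_csmooth U a b f x y : csmooth U f -> U x y -> is_dd a b f x y (dd a b f x y).
Proof. intros [H1 H2] Hxy; split; now apply (is_rdd_smooth U). Qed.

Section ComplexSmooth.

Variable U : R -> R -> Prop.
Hypothesis HU : open2 U.

Lemma csmooth_const c : csmooth U (fun _ _ => c).
Proof. split; [exact (smooth_const U HU (Re c))|exact (smooth_const U HU (Im c))]. Qed.

Lemma csmooth_RtoC f : smooth_on U f -> csmooth U (fun x y => RtoC (f x y)).
Proof. intros H; split; [exact H|exact (smooth_const U HU 0)]. Qed.

Lemma csmooth_plus f g : csmooth U f -> csmooth U g -> csmooth U (fun x y => (f x y + g x y)%C).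
Proof.
intros [H1 H2] [H1' H2']; split; [exact (smooth_plus U HU _ _ H1 H1')|exact (smooth_plus U HU _ _ H2 H2')].
Qed.

Lemma csmooth_opp f : csmooth U f -> csmooth U (fun x y => (- f x y)%C).
Proof.
intros [H1 H2]; split; [exact (smooth_opp U HU _ H1)|exact (smooth_opp U HU _ H2)].
Qed.

Lemma csmooth_conj f : csmooth U f -> csmooth U (fun x y => Cconj (f x y)).
Proof. intros [H1 H2]; split; [exact H1|exact (smooth_opp U HU _ H2)]. Qed.

Lemma csmooth_mult f g : csmooth U f -> csmooth U g -> csmooth U (fun x y => (f x y * g x y)%C).
Proof.
intros [H1 H2] [H1' H2']; split.
- exact (smooth_minus U HU _ _ (smooth_mult U HU _ _ H1 H1') (smooth_mult U HU _ _ H2 H2')).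
- exact (smooth_plus U HU _ _ (smooth_mult U HU _ _ H1 H2') (smooth_mult U HU _ _ H2 H1')).
Qed.

Lemma csmooth_dd a b f : smooth_on U a -> smooth_on U b -> csmooth U f ->
  csmooth U (fun x y => dd (a x y) (b x y) f x y).
Proof. intros Ha Hb [H1 H2]; split; now apply (smooth_rdd U). Qed.

Lemma dd_commutator a1 b1 a2 b2 f x y :
  smooth_on U a1 -> smooth_on U b1 -> smooth_on U a2 -> smooth_on U b2 ->
  csmooth U f -> U x y ->
  (dd (a1 x y) (b1 x y) (fun x y => dd (a2 x y) (b2 x y) f x y) x y
  - dd (a2 x y) (b2 x y) (fun x y => dd (a1 x y) (b1 x y) f x y) x y)%C
  = dd (rdd (a1 x y) (b1 x y) a2 x y - rdd (a2 x y) (b2 x y) a1 x y)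
        (rdd (a1 x y) (b1 x y) b2 x y - rdd (a2 x y) (b2 x y) b1 x y) f x y.
Proof.
intros Ha1 Hb1 Ha2 Hb2 [H1 H2] Hxy.
assert (E1 := rdd_commutator U a1 b1 a2 b2 _ x y HU Ha1 Hb1 Ha2 Hb2 H1 Hxy).
assert (E2 := rdd_commutator U a1 b1 a2 b2 _ x y HU Ha1 Hb1 Ha2 Hb2 H2 Hxy).
unfold dd at 5; rewrite <- E1, <- E2; reflexivity.
Qed.

End ComplexSmooth.

Lemma dd_comb c1 c2 a1 b1 a2 b2 f x y :
  dd (c1 * a1 + c2 * a2) (c1 * b1 + c2 * b2) f x y =
  (RtoC c1 * dd a1 b1 f x y + RtoC c2 * dd a2 b2 f x y)%C.
Proof. unfold dd, rdd; apply injective_projections; simpl; ring. Qed.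

(** * Functions with vanishing derivatives on a square *)

Definition box (x0 y0 d : R) : R -> R -> Prop :=
  fun x y => Rabs (x - x0) < d /\ Rabs (y - y0) < d.

Lemma box_open x0 y0 d : open2 (box x0 y0 d).
Proof.
intros x y [Hx Hy].
assert (He : 0 < Rmin (d - Rabs (x - x0)) (d - Rabs (y - y0))) by (apply Rmin_pos; lra).
exists (mkposreal _ He); simpl; intros u v Hu Hv.
assert (H1 := Rmin_l (d - Rabs (x - x0)) (d - Rabs (y - y0))).
assert (H2 := Rmin_r (d - Rabs (x - x0)) (d - Rabs (y - y0))).
split.
- replace (u - x0) with ((u - x) + (x - x0)) by ring.
  apply Rle_lt_trans with (1 := Rabs_triang _ _); lra.
- replace (v - y0) with ((v - y) + (y - y0)) by ring.
  apply Rle_lt_trans with (1 := Rabs_triang _ _); lra.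
Qed.

Lemma const_1d (f : R -> R) a b : (forall t, Rmin a b <= t <= Rmax a b -> is_derive f t 0) -> f a = f b.
Proof.
intros H; destruct (MVT_gen f a b (fun _ => 0)) as (c & _ & E).
- intros t Ht; apply H; lra.
- intros t Ht; apply derivable_continuous_pt; exists 0; apply is_derive_Reals, H, Ht.
- lra.
Qed.

Lemma abs_between x0 d x t : Rabs (x - x0) < d -> Rmin x x0 <= t <= Rmax x x0 -> Rabs (t - x0) < d.
Proof.
intros Hx [H1 H2]; apply Rabs_def2 in Hx; apply Rabs_def1;
unfold Rmin, Rmax in *; destruct (Rle_dec x x0); lra.
Qed.

Lemma box_rconst x0 y0 d f :
  (forall x y, box x0 y0 d x y -> is_rdd 1 0 f x y 0 /\ is_rdd 0 1 f x y 0) ->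
  forall x y, box x0 y0 d x y -> f x y = f x0 y0.
Proof.
intros H x y [Hx Hy].
assert (Hd : 0 < d) by (apply Rle_lt_trans with (2 := Hx), Rabs_pos).
transitivity (f x0 y).
- apply (const_1d (fun z => f z y)); intros t Ht.
  destruct (H t y) as [H1 _]; [split; [now apply abs_between with x|exact Hy]|].
  destruct (is_rdd_elim _ _ _ _ _ _ H1) as (D & _ & E).
  now replace 0 with (partial1 f t y) by lra.
- apply (const_1d (fun z => f x0 z)); intros t Ht.
  destruct (H x0 t) as [_ H2].
  { split; [now rewrite Rminus_diag, Rabs_R0|now apply abs_between with y]. }
  destruct (is_rdd_elim _ _ _ _ _ _ H2) as (_ & D & E).
  now replace 0 with (partial2 f x0 t) by lra.
Qed.

(** Cramer's rule: the direction [(a, b)] is resolved along the two given ones. Existence of the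
    partials is already part of [is_rdd], so only the value has to be computed. *)
Lemma is_rdd_dir a1 b1 a2 b2 f x y l1 l2 a b : a1 * b2 - a2 * b1 <> 0 ->
  is_rdd a1 b1 f x y l1 -> is_rdd a2 b2 f x y l2 ->
  is_rdd a b f x y (((a * b2 - b * a2) * l1 + (b * a1 - a * b1) * l2) / (a1 * b2 - a2 * b1)).
Proof.
intros Hd (H1 & H2 & <-) (_ & _ & <-); split; [|split]; auto; unfold rdd; field; exact Hd.
Qed.

Lemma box_const x0 y0 d a1 b1 a2 b2 f :
  (forall x y, box x0 y0 d x y -> a1 x y * b2 x y - a2 x y * b1 x y <> 0) ->
  (forall x y, box x0 y0 d x y -> is_dd (a1 x y) (b1 x y) f x y 0%C) ->
  (forall x y, box x0 y0 d x y -> is_dd (a2 x y) (b2 x y) f x y 0%C) ->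
  forall x y, box x0 y0 d x y -> f x y = f x0 y0.
Proof.
intros Hd H1 H2 x y Hxy.
apply injective_projections.
- apply (box_rconst x0 y0 d (fun x y => fst (f x y))); [|exact Hxy].
  intros u v Huv; destruct (H1 u v Huv) as [D1 _]; destruct (H2 u v Huv) as [D2 _].
  split; (eapply is_rdd_eq; [apply (is_rdd_dir _ _ _ _ _ _ _ _ _ _ _ (Hd u v Huv) D1 D2)|]);
  simpl; unfold Rdiv; ring.
- apply (box_rconst x0 y0 d (fun x y => snd (f x y))); [|exact Hxy].
  intros u v Huv; destruct (H1 u v Huv) as [_ D1]; destruct (H2 u v Huv) as [_ D2].
  split; (eapply is_rdd_eq; [apply (is_rdd_dir _ _ _ _ _ _ _ _ _ _ _ (Hd u v Huv) D1 D2)|]);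
  simpl; unfold Rdiv; ring.
Qed.

(** * The Hermitian form and null pairs *)

(** Its real part is [metric z w] and its imaginary part is [metric z (J w)], so one complex number
    holds a tangential and a normal component. *)
Definition herm (z w : C2) : C := (- (fst z * Cconj (fst w)) + snd z * Cconj (snd w))%C.

Definition comb (p q : C) (z w : C2) : C2 := add2 (cscal p z) (cscal q w).

Lemma combE p q z w : comb p q z w =
  ((p * fst z + q * fst w)%C, (p * snd z + q * snd w)%C).
Proof. reflexivity. Qed.

Lemma add2E z w : add2 z w = ((fst z + fst w)%C, (snd z + snd w)%C).
Proof. reflexivity. Qed.

Lemma sub2E z w : sub2 z w = ((fst z - fst w)%C, (snd z - snd w)%C).
Proof. reflexivity. Qed.

Lemma cscalE c z : cscal c z = ((c * fst z)%C, (c * snd z)%C).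
Proof. reflexivity. Qed.

Lemma rscalE c z : rscal c z = cscal (RtoC c) z.
Proof.
destruct z as [[a b] [a' b']]; rewrite cscalE; unfold rscal.
apply injective_projections; apply injective_projections; simpl; unfold scal; simpl; unfold mult; simpl; ring.
Qed.

Lemma Cconj_RtoC r : Cconj (RtoC r) = RtoC r.
Proof. apply injective_projections; simpl; ring. Qed.

Lemma Cconj_Ci : Cconj Ci = (- Ci)%C.
Proof. apply injective_projections; simpl; ring. Qed.

Lemma Ci2 : (Ci * Ci = - (1))%C.
Proof. apply injective_projections; simpl; ring. Qed.

Lemma herm_conj z w : herm w z = Cconj (herm z w).
Proof. unfold herm; rewrite Cplus_conj, Copp_conj, !Cmult_conj, !Cconj_conj; ring. Qed.

Lemma metric_herm z w : metric z w = Re (herm z w).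
Proof. reflexivity. Qed.

Lemma herm_comb_l p q z w v : herm (comb p q z w) v = (p * herm z v + q * herm w v)%C.
Proof. rewrite combE; unfold herm; simpl; ring. Qed.

Lemma herm_comb_r p q z w v : herm v (comb p q z w) = (Cconj p * herm v z + Cconj q * herm v w)%C.
Proof. rewrite combE; unfold herm; simpl; rewrite !Cplus_conj, !Cmult_conj; ring. Qed.

(** For [k <> 0] such a pair is a complex basis of [C2]. The product [k] is complex because the
    moving frame has product 1 while the models have imaginary products. *)
Definition null_pair (z w : C2) (k : C) : Prop :=
  herm z z = 0%C /\ herm w w = 0%C /\ herm z w = k.


Lemma null_pair_sym z w k : null_pair z w k -> herm w z = Cconj k.
Proof. intros (_ & _ & <-); apply herm_conj. Qed.

Lemma Cconj_neq_0 (k : C) : k <> 0%C -> Cconj k <> 0%C.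
Proof. intros Hk E; apply Hk; rewrite <- (Cconj_conj k), E; apply Cconj_RtoC. Qed.

Lemma Cmult_reg_r (a b d : C) : d <> 0%C -> (a * d = b * d)%C -> a = b.
Proof.
intros Hd E; replace a with (a * d / d)%C by now field.
rewrite E; now field.
Qed.

(** Pairing with [z] and [w] is a linear system of determinant [D], and [k * Cconj k] equals
    [herm z z * herm w w] minus a multiple of [D]. Since [z] and [w] are null, [D = 0] would force
    [k = 0]. *)
Lemma null_pair_ext z w (k : C) u v : k <> 0%C -> null_pair z w k ->
  herm u z = herm v z -> herm u w = herm v w -> u = v.
Proof.
intros Hk H Ez Ew.
assert (Hwz := null_pair_sym _ _ _ H); destruct H as (Hz & Hw & Hzw).
unfold herm in *.
destruct u as [u1 u2], v as [v1 v2], z as [z1 z2], w as [w1 w2]; simpl in *.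
set (z1' := Cconj z1) in *; set (z2' := Cconj z2) in *;
set (w1' := Cconj w1) in *; set (w2' := Cconj w2) in *.
set (D := (z2' * w1' - z1' * w2')%C).
assert (K : D <> 0%C).
{ intros K; apply (Cmult_neq_0 k (Cconj k)); auto using Cconj_neq_0.
  rewrite <- Hwz, <- Hzw.
  transitivity ((- (z1 * z1') + z2 * z2') * (- (w1 * w1') + w2 * w2') - (z1 * w2 - z2 * w1) * D)%C; [unfold D; ring|].
  rewrite Hz, K; ring. }
apply injective_projections; apply Cmult_reg_r with D; auto; simpl.
- transitivity (- (z2' * (- (u1 * w1') + u2 * w2') - w2' * (- (u1 * z1') + u2 * z2')))%C; [unfold D; ring|].
  rewrite Ez, Ew; unfold D; ring.
- transitivity (- (z1' * (- (u1 * w1') + u2 * w2') - w1' * (- (u1 * z1') + u2 * z2')))%C; [unfold D; ring|].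
  rewrite Ez, Ew; unfold D; ring.
Qed.

Lemma null_pair_decomp z w (k : C) v : k <> 0%C -> null_pair z w k ->
  v = comb (herm v w / k) (herm v z / Cconj k) z w.
Proof.
intros Hk H; assert (Hwz := null_pair_sym _ _ _ H).
apply (null_pair_ext z w k); auto; rewrite herm_comb_l; destruct H as (Hz & Hw & Hzw).
- rewrite Hz, Hwz; field; split; auto using Cconj_neq_0.
- rewrite Hw, Hzw; field; split; auto using Cconj_neq_0.
Qed.

Lemma null_pair_decomp1 z w v : null_pair z w 1%C -> v = comb (herm v w) (herm v z) z w.
Proof.
intros H; rewrite (null_pair_decomp z w 1%C v) at 1; auto using C1_nz.
rewrite Cconj_RtoC; f_equal; field; exact C1_nz.
Qed.

Lemma null_pair_coef z w p q p' q' : null_pair z w 1%C ->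
  comb p q z w = comb p' q' z w -> p = p' /\ q = q'.
Proof.
intros H E; assert (Hwz := null_pair_sym _ _ _ H); destruct H as (Hz & Hw & Hzw).
split.
- apply (f_equal (fun v => herm v w)) in E; rewrite !herm_comb_l, Hzw, Hw in E.
  transitivity (p * 1 + q * 0)%C; [ring|]; rewrite E; ring.
- apply (f_equal (fun v => herm v z)) in E; rewrite !herm_comb_l, Hz, Hwz, Cconj_RtoC in E.
  transitivity (p * 0 + q * 1)%C; [ring|]; rewrite E; ring.
Qed.

(** * Derivatives of maps into [C2] *)

Definition dd2 (a b : R) (F : R -> R -> C2) x y : C2 :=
  (dd a b (fun x y => fst (F x y)) x y, dd a b (fun x y => snd (F x y)) x y).

Definition is_dd2 (a b : R) (F : R -> R -> C2) x y (l : C2) : Prop :=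
  is_dd a b (fun x y => fst (F x y)) x y (fst l) /\
  is_dd a b (fun x y => snd (F x y)) x y (snd l).

Definition csmooth2 (U : R -> R -> Prop) (F : R -> R -> C2) : Prop :=
  csmooth U (fun x y => fst (F x y)) /\ csmooth U (fun x y => snd (F x y)).

Lemma is_dd2_unique a b F x y l : is_dd2 a b F x y l -> dd2 a b F x y = l.
Proof.
intros [H1 H2]; unfold dd2; rewrite (is_dd_unique _ _ _ _ _ _ H1), (is_dd_unique _ _ _ _ _ _ H2).
now destruct l.
Qed.

Lemma is_dd2_eq a b F x y l l' : is_dd2 a b F x y l -> l = l' -> is_dd2 a b F x y l'.
Proof. now intros H <-. Qed.

Lemma is_dd2_ext a b F G x y l : locally_2d (fun u v => F u v = G u v) x y ->
  is_dd2 a b F x y l -> is_dd2 a b G x y l.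
Proof.
intros E [H1 H2]; split; [apply is_dd_ext with (2 := H1)|apply is_dd_ext with (2 := H2)];
apply locally_2d_impl with (2 := E), locally_2d_forall; now intros u v ->.
Qed.

Lemma is_dd2_csmooth U a b F x y : csmooth2 U F -> U x y -> is_dd2 a b F x y (dd2 a b F x y).
Proof. intros [H1 H2] Hxy; split; now apply (is_dd_csmooth U). Qed.

Lemma csmooth2_dd2 U a b F : open2 U -> smooth_on U a -> smooth_on U b -> csmooth2 U F ->
  csmooth2 U (fun x y => dd2 (a x y) (b x y) F x y).
Proof.
intros HU Ha Hb [H1 H2]; split.
- now apply (csmooth_dd U HU a b (fun x y => fst (F x y))).
- now apply (csmooth_dd U HU a b (fun x y => snd (F x y))).
Qed.

Lemma is_dd2_add2 a b F G x y l m : is_dd2 a b F x y l -> is_dd2 a b G x y m ->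
  is_dd2 a b (fun x y => add2 (F x y) (G x y)) x y (add2 l m).
Proof.
intros [H1 H2] [H1' H2']; split; [exact (is_dd_plus _ _ _ _ _ _ _ _ H1 H1')|exact (is_dd_plus _ _ _ _ _ _ _ _ H2 H2')].
Qed.

Lemma is_dd2_sub2 a b F G x y l m : is_dd2 a b F x y l -> is_dd2 a b G x y m ->
  is_dd2 a b (fun x y => sub2 (F x y) (G x y)) x y (sub2 l m).
Proof.
intros [H1 H2] [H1' H2']; split; [exact (is_dd_minus _ _ _ _ _ _ _ _ H1 H1')|exact (is_dd_minus _ _ _ _ _ _ _ _ H2 H2')].
Qed.

Lemma is_dd2_cscal a b f F x y l m : is_dd a b f x y l -> is_dd2 a b F x y m ->
  is_dd2 a b (fun x y => cscal (f x y) (F x y)) x y (comb l (f x y) (F x y) m).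
Proof.
intros H [H1 H2]; split; [exact (is_dd_mult _ _ _ _ _ _ _ _ H H1)|exact (is_dd_mult _ _ _ _ _ _ _ _ H H2)].
Qed.

Lemma is_dd2_comb a b f g F G x y f' g' F' G' : is_dd a b f x y f' -> is_dd a b g x y g' ->
  is_dd2 a b F x y F' -> is_dd2 a b G x y G' ->
  is_dd2 a b (fun x y => comb (f x y) (g x y) (F x y) (G x y)) x y
    (add2 (comb f' g' (F x y) (G x y)) (comb (f x y) (g x y) F' G')).
Proof.
intros Hf Hg HF HG; eapply is_dd2_eq.
- apply is_dd2_add2; apply is_dd2_cscal; eauto.
- rewrite !combE, !add2E; simpl; apply injective_projections; simpl; ring.
Qed.

Lemma is_dd_herm a b F G x y F' G' : is_dd2 a b F x y F' -> is_dd2 a b G x y G' ->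
  is_dd a b (fun x y => herm (F x y) (G x y)) x y (herm F' (G x y) + herm (F x y) G')%C.
Proof.
intros [H1 H2] [H1' H2']; eapply is_dd_eq.
- apply (is_dd_plus a b (fun x y => (- (fst (F x y) * Cconj (fst (G x y))))%C)
    (fun x y => (snd (F x y) * Cconj (snd (G x y)))%C)).
  + apply is_dd_opp, (is_dd_mult a b (fun x y => fst (F x y)) (fun x y => Cconj (fst (G x y)))); [eassumption|apply is_dd_conj; eassumption].
  + apply (is_dd_mult a b (fun x y => snd (F x y)) (fun x y => Cconj (snd (G x y)))); [eassumption|apply is_dd_conj; eassumption].
- unfold herm; ring.
Qed.

Lemma csmooth_herm U F G : open2 U -> csmooth2 U F -> csmooth2 U G ->
  csmooth U (fun x y => herm (F x y) (G x y)).
Proof.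
intros HU [H1 H2] [H1' H2'].
apply (csmooth_plus U HU (fun x y => (- (fst (F x y) * Cconj (fst (G x y))))%C)
    (fun x y => (snd (F x y) * Cconj (snd (G x y)))%C)).
- apply (csmooth_opp U HU (fun x y => fst (F x y) * Cconj (fst (G x y)))%C).
  apply (csmooth_mult U HU (fun x y => fst (F x y)) (fun x y => Cconj (fst (G x y)))); auto.
  now apply csmooth_conj.
- apply (csmooth_mult U HU (fun x y => snd (F x y)) (fun x y => Cconj (snd (G x y)))); auto.
  now apply csmooth_conj.
Qed.

Lemma dd2_combination c1 c2 a1 b1 a2 b2 F x y :
  dd2 (c1 * a1 + c2 * a2) (c1 * b1 + c2 * b2) F x y =
  comb (RtoC c1) (RtoC c2) (dd2 a1 b1 F x y) (dd2 a2 b2 F x y).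
Proof. unfold dd2; rewrite !dd_comb; reflexivity. Qed.

Lemma dd2_commutator U a1 b1 a2 b2 F x y : open2 U ->
  smooth_on U a1 -> smooth_on U b1 -> smooth_on U a2 -> smooth_on U b2 ->
  csmooth2 U F -> U x y ->
  sub2 (dd2 (a1 x y) (b1 x y) (fun x y => dd2 (a2 x y) (b2 x y) F x y) x y)
   (dd2 (a2 x y) (b2 x y) (fun x y => dd2 (a1 x y) (b1 x y) F x y) x y)
  = dd2 (rdd (a1 x y) (b1 x y) a2 x y - rdd (a2 x y) (b2 x y) a1 x y)
        (rdd (a1 x y) (b1 x y) b2 x y - rdd (a2 x y) (b2 x y) b1 x y) F x y.
Proof.
intros HU Ha1 Hb1 Ha2 Hb2 [H1 H2] Hxy; rewrite sub2E; apply injective_projections.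
- exact (dd_commutator U HU _ _ _ _ _ _ _ Ha1 Hb1 Ha2 Hb2 H1 Hxy).
- exact (dd_commutator U HU _ _ _ _ _ _ _ Ha1 Hb1 Ha2 Hb2 H2 Hxy).
Qed.

(** * Structure equations of a normalised null frame *)

Lemma Ceq_intro (z w : C) : Re z = Re w -> Im z = Im w -> z = w.
Proof. apply injective_projections. Qed.

Lemma is_dd_pair a b f g x y l m : is_rdd a b f x y l -> is_rdd a b g x y m ->
  is_dd a b (fun x y => (f x y, g x y)) x y (l, m).
Proof. now split. Qed.

Lemma comb_comb p q a b c d z w :
  comb p q (comb a b z w) (comb c d z w) = comb (p * a + q * c)%C (p * b + q * d)%C z w.
Proof. rewrite !combE; simpl; apply injective_projections; simpl; ring. Qed.

Lemma add2_comb p q p' q' z w :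
  add2 (comb p q z w) (comb p' q' z w) = comb (p + p')%C (q + q')%C z w.
Proof. rewrite !combE, add2E; simpl; apply injective_projections; simpl; ring. Qed.

Lemma sub2_comb p q p' q' z w :
  sub2 (comb p q z w) (comb p' q' z w) = comb (p - p')%C (q - q')%C z w.
Proof. rewrite !combE, sub2E; simpl; apply injective_projections; simpl; ring. Qed.

(* On a Lagrangian plane [herm] is real, so [Im (herm v t)] with [t] tangent sees only the
   normal part of [v]: the last three fields are Type 2 along both null directions and
   [h(N1, N1) = J N1]. *)
Record null_frame (U : R -> R -> Prop) (F : R -> R -> C2) (a1 b1 a2 b2 : R -> R -> R) : Prop := {
  nf_open : open2 U;
  nf_smooth : csmooth2 U F;
  nf_a1 : smooth_on U a1;
  nf_b1 : smooth_on U b1;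
  nf_a2 : smooth_on U a2;
  nf_b2 : smooth_on U b2;
  nf_det : forall x y, U x y -> a1 x y * b2 x y - a2 x y * b1 x y <> 0;
  nf_null : forall x y, U x y ->
    null_pair (dd2 (a1 x y) (b1 x y) F x y) (dd2 (a2 x y) (b2 x y) F x y) 1%C;
  nf_type1 : forall x y, U x y ->
    Im (herm (dd2 (a1 x y) (b1 x y) (fun x y => dd2 (a1 x y) (b1 x y) F x y) x y)
      (dd2 (a1 x y) (b1 x y) F x y)) = 0;
  nf_type2 : forall x y, U x y ->
    Im (herm (dd2 (a2 x y) (b2 x y) (fun x y => dd2 (a2 x y) (b2 x y) F x y) x y)
      (dd2 (a2 x y) (b2 x y) F x y)) = 0;
  nf_norm : forall x y, U x y ->
    Im (herm (dd2 (a1 x y) (b1 x y) (fun x y => dd2 (a1 x y) (b1 x y) F x y) x y)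
      (dd2 (a2 x y) (b2 x y) F x y)) = 1
}.

Section Structure.

Variables (U : R -> R -> Prop) (F : R -> R -> C2) (a1 b1 a2 b2 : R -> R -> R).
Hypothesis NF : null_frame U F a1 b1 a2 b2.

Let N1 (f : R -> R -> R) x y := rdd (a1 x y) (b1 x y) f x y.
Let N2 (f : R -> R -> R) x y := rdd (a2 x y) (b2 x y) f x y.
Let V1 (f : R -> R -> C2) x y := dd2 (a1 x y) (b1 x y) f x y.
Let V2 (f : R -> R -> C2) x y := dd2 (a2 x y) (b2 x y) f x y.
Let Z := V1 F.
Let W := V2 F.
(** [fd] and [fl] will be the [om] and [la] of the overview. [fa], the real part of the coefficient
    of [Z] in [N1 Z], is a further connection coefficient that turns out to vanish. *)
Let fa x y := Re (herm (V1 Z x y) (W x y)).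
Let fd x y := Re (herm (V2 W x y) (Z x y)).
Let fl x y := Im (herm (V2 W x y) (Z x y)).

Let HU : open2 U := nf_open _ _ _ _ _ _ NF.
Let HF : csmooth2 U F := nf_smooth _ _ _ _ _ _ NF.

Let sZ : csmooth2 U Z.
Proof. apply csmooth2_dd2; try apply NF. Qed.
Let sW : csmooth2 U W.
Proof. apply csmooth2_dd2; try apply NF. Qed.
Let sV1 f : csmooth2 U f -> csmooth2 U (V1 f).
Proof. intros; apply csmooth2_dd2; try apply NF; auto. Qed.
Let sV2 f : csmooth2 U f -> csmooth2 U (V2 f).
Proof. intros; apply csmooth2_dd2; try apply NF; auto. Qed.
Let sa : smooth_on U fa.
Proof. apply (csmooth_herm U (V1 Z) W HU); auto. Qed.
Let sd : smooth_on U fd.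
Proof. apply (csmooth_herm U (V2 W) Z HU); auto. Qed.
Let sl : smooth_on U fl.
Proof. apply (csmooth_herm U (V2 W) Z HU); auto. Qed.

Let near x y : U x y -> locally_2d U x y := HU x y.

Let dherm a b f g x y : csmooth2 U f -> csmooth2 U g -> U x y -> forall c,
  (forall x y, U x y -> herm (f x y) (g x y) = c) ->
  (herm (dd2 a b f x y) (g x y) + herm (f x y) (dd2 a b g x y))%C = 0%C.
Proof.
intros Hf Hg Hxy c Hc.
transitivity (dd a b (fun x y => herm (f x y) (g x y)) x y).
- symmetry; apply is_dd_unique, is_dd_herm; now apply (is_dd2_csmooth U).
- apply is_dd_unique, is_dd_ext with (fun _ _ => c); [|apply is_dd_const].
  apply locally_2d_impl with (2 := near x y Hxy), locally_2d_forall; intros u v Huv; symmetry; auto.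
Qed.

(** Differentiating the constant products of [Z] and [W] relates the coefficients in pairs, and the
    cubic conditions of the frame fix some imaginary parts. Besides [fa], [fd], [fl] this leaves [c]
    and [k], the mixed components of [h]. *)
Let struct0 x y : U x y ->
  exists c k : R,
  V1 Z x y = comb (fa x y, 1) 0%C (Z x y) (W x y) /\
  V1 W x y = comb (0, c) (- fa x y, 1) (Z x y) (W x y) /\
  V2 Z x y = comb (- fd x y, fl x y) (0, k) (Z x y) (W x y) /\
  V2 W x y = comb 0%C (fd x y, fl x y) (Z x y) (W x y).
Proof.
intros Hxy.
assert (HN := nf_null _ _ _ _ _ _ NF).
assert (HP := HN x y Hxy); fold (V1 F x y) in HP; fold (V2 F x y) in HP; fold Z W in HP.
assert (Hzz : forall x y, U x y -> herm (Z x y) (Z x y) = 0%C) by (intros; now apply HN).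
assert (Hww : forall x y, U x y -> herm (W x y) (W x y) = 0%C) by (intros; now apply HN).
assert (Hzw : forall x y, U x y -> herm (Z x y) (W x y) = 1%C) by (intros; now apply HN).
assert (T1 := nf_type1 _ _ _ _ _ _ NF x y Hxy).
assert (T2 := nf_type2 _ _ _ _ _ _ NF x y Hxy).
assert (T3 := nf_norm _ _ _ _ _ _ NF x y Hxy).
change (Im (herm (V1 Z x y) (Z x y)) = 0) in T1.
change (Im (herm (V2 W x y) (W x y)) = 0) in T2.
change (Im (herm (V1 Z x y) (W x y)) = 1) in T3.
assert (E1 := dherm (a1 x y) (b1 x y) Z Z x y sZ sZ Hxy _ Hzz).
assert (E2 := dherm (a2 x y) (b2 x y) Z Z x y sZ sZ Hxy _ Hzz).
assert (E3 := dherm (a1 x y) (b1 x y) W W x y sW sW Hxy _ Hww).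
assert (E4 := dherm (a2 x y) (b2 x y) W W x y sW sW Hxy _ Hww).
assert (E5 := dherm (a1 x y) (b1 x y) Z W x y sZ sW Hxy _ Hzw).
assert (E6 := dherm (a2 x y) (b2 x y) Z W x y sZ sW Hxy _ Hzw).
fold (V1 Z x y) in E1, E5; fold (V1 W x y) in E3, E5.
fold (V2 Z x y) in E2, E6; fold (V2 W x y) in E4, E6.
rewrite (herm_conj (V1 Z x y) (Z x y)) in E1.
rewrite (herm_conj (V2 Z x y) (Z x y)) in E2.
rewrite (herm_conj (V1 W x y) (W x y)) in E3.
rewrite (herm_conj (V2 W x y) (W x y)) in E4.
rewrite (herm_conj (V1 W x y) (Z x y)) in E5.
rewrite (herm_conj (V2 W x y) (Z x y)) in E6.
assert (Q : forall v p q, herm v (W x y) = p -> herm v (Z x y) = q -> v = comb p q (Z x y) (W x y)).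
{ intros v p q <- <-; exact (null_pair_decomp1 _ _ v HP). }
exists (Im (herm (V1 W x y) (W x y))), (Im (herm (V2 Z x y) (Z x y))).
(* Abstracting the eight coefficients reduces the four vector identities to equations between
   numbers, linear in real and imaginary parts. *)
enough (K : forall p1 p2 p3 p4 q1 q2 q3 q4,
  (herm (V1 Z x y) (W x y) = p1 /\ herm (V1 Z x y) (Z x y) = q1) /\
  (herm (V1 W x y) (W x y) = p2 /\ herm (V1 W x y) (Z x y) = q2) /\
  (herm (V2 Z x y) (W x y) = p3 /\ herm (V2 Z x y) (Z x y) = q3) /\
  (herm (V2 W x y) (W x y) = p4 /\ herm (V2 W x y) (Z x y) = q4) ->
  V1 Z x y = comb p1 q1 (Z x y) (W x y) /\ V1 W x y = comb p2 q2 (Z x y) (W x y) /\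
  V2 Z x y = comb p3 q3 (Z x y) (W x y) /\ V2 W x y = comb p4 q4 (Z x y) (W x y)).
2: { intros p1 p2 p3 p4 q1 q2 q3 q4 ((?&?)&(?&?)&(?&?)&?&?); auto. }
apply K; clear K Q.
unfold fa, fd, fl.
destruct (herm (V1 Z x y) (Z x y)) as [r1 i1], (herm (V2 Z x y) (Z x y)) as [r2 i2],
  (herm (V1 W x y) (W x y)) as [r3 i3], (herm (V2 W x y) (W x y)) as [r4 i4],
  (herm (V1 Z x y) (W x y)) as [r5 i5], (herm (V1 W x y) (Z x y)) as [r6 i6],
  (herm (V2 Z x y) (W x y)) as [r7 i7], (herm (V2 W x y) (Z x y)) as [r8 i8].
simpl in *; unfold Re, Im in *; simpl in *.
assert (G1 := f_equal fst E1); assert (G2 := f_equal fst E2); assert (G3 := f_equal fst E3);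
assert (G4 := f_equal fst E4); assert (G5 := f_equal fst E5); assert (G6 := f_equal fst E6);
assert (G7 := f_equal snd E5); assert (G8 := f_equal snd E6); simpl in *.
repeat split; apply Ceq_intro; simpl; unfold Re, Im; simpl; lra.
Qed.

(** [N1 W - N2 Z] is the derivative of [F] along [[N1, N2]], hence a real combination of [Z] and
    [W]. Its imaginary parts, the symmetry of [h], give [c = fl] and [k = 1]; its real parts give
    [[N1, N2] = fd N1 - fa N2]. *)
Let struct1 x y : U x y ->
  (V1 Z x y = comb (fa x y, 1) 0%C (Z x y) (W x y) /\
   V1 W x y = comb (0, fl x y) (- fa x y, 1) (Z x y) (W x y) /\
   V2 Z x y = comb (- fd x y, fl x y) (0, 1) (Z x y) (W x y) /\
   V2 W x y = comb 0%C (fd x y, fl x y) (Z x y) (W x y)) /\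
  rdd (a1 x y) (b1 x y) a2 x y - rdd (a2 x y) (b2 x y) a1 x y = fd x y * a1 x y - fa x y * a2 x y /\
  rdd (a1 x y) (b1 x y) b2 x y - rdd (a2 x y) (b2 x y) b1 x y = fd x y * b1 x y - fa x y * b2 x y.
Proof.
intros Hxy; destruct (struct0 x y Hxy) as (c & k & E1 & E2 & E3 & E4).
assert (HP := nf_null _ _ _ _ _ _ NF x y Hxy); fold (V1 F x y) in HP; fold (V2 F x y) in HP; fold Z W in HP.
assert (Hd := nf_det _ _ _ _ _ _ NF x y Hxy).
assert (T := dd2_commutator U a1 b1 a2 b2 F x y HU (nf_a1 _ _ _ _ _ _ NF) (nf_b1 _ _ _ _ _ _ NF)
  (nf_a2 _ _ _ _ _ _ NF) (nf_b2 _ _ _ _ _ _ NF) HF Hxy).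
change (sub2 (V1 W x y) (V2 Z x y) = dd2 (N1 a2 x y - N2 a1 x y) (N1 b2 x y - N2 b1 x y) F x y) in T.
change ((V1 Z x y = comb (fa x y, 1) 0%C (Z x y) (W x y) /\
   V1 W x y = comb (0, fl x y) (- fa x y, 1) (Z x y) (W x y) /\
   V2 Z x y = comb (- fd x y, fl x y) (0, 1) (Z x y) (W x y) /\
   V2 W x y = comb 0%C (fd x y, fl x y) (Z x y) (W x y)) /\
  N1 a2 x y - N2 a1 x y = fd x y * a1 x y - fa x y * a2 x y /\
  N1 b2 x y - N2 b1 x y = fd x y * b1 x y - fa x y * b2 x y).
set (A := N1 a2 x y - N2 a1 x y) in *; set (B := N1 b2 x y - N2 b1 x y) in *.
set (D := a1 x y * b2 x y - a2 x y * b1 x y) in *.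
set (k1 := (A * b2 x y - B * a2 x y) / D); set (k2 := (B * a1 x y - A * b1 x y) / D).
assert (EA : A = k1 * a1 x y + k2 * a2 x y) by (unfold k1, k2, D; field; exact Hd).
assert (EB : B = k1 * b1 x y + k2 * b2 x y) by (unfold k1, k2, D; field; exact Hd).
rewrite EA, EB, dd2_combination in T.
fold (V1 F x y) in T; fold (V2 F x y) in T; fold Z W in T.
rewrite E2, E3 in T.
assert (T' : comb (fd x y, c - fl x y) (- fa x y, 1 - k) (Z x y) (W x y) = comb k1 k2 (Z x y) (W x y)).
{ rewrite <- T, !combE, sub2E; simpl; apply injective_projections; apply Ceq_intro; simpl; unfold Re, Im; simpl; ring. }
apply null_pair_coef in T'; [|exact HP]; destruct T' as [T1 T2].
assert (G1 := f_equal fst T1); assert (G2 := f_equal snd T1).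
assert (G3 := f_equal fst T2); assert (G4 := f_equal snd T2); simpl in G1, G2, G3, G4.
replace c with (fl x y) in E2 by lra; replace k with 1 in E3 by lra.
repeat split; auto.
- rewrite EA, <- G1, <- G3; ring.
- rewrite EB, <- G1, <- G3; ring.
Qed.

Let comm f x y : smooth_on U f -> U x y ->
  N1 (N2 f) x y - N2 (N1 f) x y = fd x y * N1 f x y - fa x y * N2 f x y.
Proof.
intros Hf Hxy; destruct (struct1 x y Hxy) as (_ & EA & EB).
unfold N1 at 1, N2 at 2.
transitivity (rdd (rdd (a1 x y) (b1 x y) a2 x y - rdd (a2 x y) (b2 x y) a1 x y)
        (rdd (a1 x y) (b1 x y) b2 x y - rdd (a2 x y) (b2 x y) b1 x y) f x y).
- apply (rdd_commutator U); auto; apply NF.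
- rewrite EA, EB; unfold N1, N2, rdd; ring.
Qed.

Let comm2 f x y : csmooth2 U f -> U x y ->
  sub2 (V1 (V2 f) x y) (V2 (V1 f) x y) = comb (RtoC (fd x y)) (RtoC (- fa x y)) (V1 f x y) (V2 f x y).
Proof.
intros Hf Hxy; destruct (struct1 x y Hxy) as (_ & EA & EB).
unfold V1 at 3, V2 at 3; rewrite <- dd2_combination.
unfold V1 at 1, V2 at 2.
transitivity (dd2 (rdd (a1 x y) (b1 x y) a2 x y - rdd (a2 x y) (b2 x y) a1 x y)
        (rdd (a1 x y) (b1 x y) b2 x y - rdd (a2 x y) (b2 x y) b1 x y) f x y).
- apply (dd2_commutator U); auto; apply NF.
- rewrite EA, EB; f_equal; ring.
Qed.

Let dcomb a b G p1 p2 q1 q2 x y : U x y -> smooth_on U p1 -> smooth_on U p2 -> smooth_on U q1 -> smooth_on U q2 ->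
  (forall x y, U x y -> G x y = comb (p1 x y, p2 x y) (q1 x y, q2 x y) (Z x y) (W x y)) ->
  dd2 a b G x y =
    add2 (comb (rdd a b p1 x y, rdd a b p2 x y) (rdd a b q1 x y, rdd a b q2 x y) (Z x y) (W x y))
      (comb (p1 x y, p2 x y) (q1 x y, q2 x y) (dd2 a b Z x y) (dd2 a b W x y)).
Proof.
intros Hxy S1 S2 S3 S4 E; apply is_dd2_unique.
apply is_dd2_ext with (fun x y => comb (p1 x y, p2 x y) (q1 x y, q2 x y) (Z x y) (W x y)).
- apply locally_2d_impl with (2 := near x y Hxy), locally_2d_forall; intros u v Huv; symmetry; auto.
- apply (is_dd2_comb a b (fun x y => (p1 x y, p2 x y)) (fun x y => (q1 x y, q2 x y)));
  try apply is_dd_pair; try (apply (is_rdd_smooth U); auto); apply (is_dd2_csmooth U); auto.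
Qed.

Let sc c : smooth_on U (fun _ _ => c).
Proof. apply smooth_const; exact HU. Qed.
Let so f : smooth_on U f -> smooth_on U (fun x y => - f x y).
Proof. apply smooth_opp; exact HU. Qed.

Let rdc a b c x y : rdd a b (fun _ _ => c) x y = 0.
Proof. exact (is_rdd_unique _ _ _ _ _ _ (is_rdd_const a b c x y)). Qed.
Let rdo a b f x y : smooth_on U f -> U x y -> rdd a b (fun x y => - f x y) x y = - rdd a b f x y.
Proof. intros; apply is_rdd_unique, is_rdd_opp; now apply (is_rdd_smooth U). Qed.

(** The ambient space is flat, so the two mixed derivatives of [Z] along the frame differ only by
    the bracket term. Comparing the coefficients of [Z] and [W] gives Gauss and Codazzi
    equations. *)
Let codazzi1 x y : U x y -> fa x y = 0 /\ N1 fd x y = - fl x y /\ N1 fl x y = fd x y.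
Proof.
intros Hxy.
(* The [W] component of the compatibility condition gives [fa = 0] at each point. Once this is known
   on all of [U], the term [N2 fa] disappears from the [Z] component. *)
assert (K : forall x y, U x y -> fa x y = 0 /\ N1 fd x y + rdd (a2 x y) (b2 x y) fa x y = - fl x y /\ N1 fl x y = fd x y).
2: { destruct (K x y Hxy) as (K1 & K2 & K3); split; [exact K1|split; [|exact K3]].
  rewrite <- K2.
  replace (rdd (a2 x y) (b2 x y) fa x y) with 0; [ring|].
  symmetry; apply is_rdd_unique, is_rdd_ext with (fun _ _ => 0); [|apply is_rdd_const].
  apply locally_2d_impl with (2 := near x y Hxy), locally_2d_forall; intros u v Huv; symmetry; now apply K. }
clear x y Hxy; intros x y Hxy.
assert (HP := nf_null _ _ _ _ _ _ NF x y Hxy); fold (V1 F x y) in HP; fold (V2 F x y) in HP; fold Z W in HP.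
assert (T := comm2 Z x y sZ Hxy).
assert (E1 := dcomb (a1 x y) (b1 x y) (V2 Z) (fun x y => - fd x y) fl (fun _ _ => 0) (fun _ _ => 1) x y Hxy
  (so _ sd) sl (sc 0) (sc 1) (fun x y H => proj1 (proj2 (proj2 (proj1 (struct1 x y H)))))).
assert (E2 := dcomb (a2 x y) (b2 x y) (V1 Z) fa (fun _ _ => 1) (fun _ _ => 0) (fun _ _ => 0) x y Hxy
  sa (sc 1) (sc 0) (sc 0) (fun x y H => proj1 (proj1 (struct1 x y H)))).
rewrite !rdc in E1, E2; rewrite (rdo _ _ _ _ _ sd Hxy) in E1.
fold (V1 Z x y) in E1; fold (V1 W x y) in E1; fold (V2 Z x y) in E2; fold (V2 W x y) in E2.
change (dd2 (a1 x y) (b1 x y) (V2 Z) x y) with (V1 (V2 Z) x y) in E1.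
change (dd2 (a2 x y) (b2 x y) (V1 Z) x y) with (V2 (V1 Z) x y) in E2.
rewrite E1, E2 in T.
destruct (struct1 x y Hxy) as ((EZ1 & EW1 & EZ2 & EW2) & _).
rewrite EZ1, EW1, EZ2, EW2, !comb_comb, !add2_comb, !sub2_comb in T.
apply null_pair_coef in T; [|exact HP]; destruct T as [T1 T2].
assert (G1 := f_equal fst T1); assert (G2 := f_equal snd T1);
assert (G3 := f_equal fst T2); assert (G4 := f_equal snd T2).
clear - G1 G2 G3 G4; fold (N1 fd x y) in *; fold (N1 fl x y) in *.
set (ra := rdd _ _ fa x y) in *; clearbody ra.
set (n1d := N1 fd x y) in *; clearbody n1d; set (n1l := N1 fl x y) in *; clearbody n1l.
set (a := fa x y) in *; clearbody a; set (d := fd x y) in *; clearbody d;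
set (l := fl x y) in *; clearbody l.
simpl in *; assert (a = 0) by lra; subst a.
split; [reflexivity|]; split; lra.
Qed.

(** The same compatibility for [W]; its new content is the imaginary part of the [Z] component. *)
Let codazzi2 x y : U x y -> N2 fl x y = fl x y * fd x y.
Proof.
intros Hxy.
assert (HP := nf_null _ _ _ _ _ _ NF x y Hxy); fold (V1 F x y) in HP; fold (V2 F x y) in HP; fold Z W in HP.
assert (T := comm2 W x y sW Hxy).
assert (E1 := dcomb (a1 x y) (b1 x y) (V2 W) (fun _ _ => 0) (fun _ _ => 0) fd fl x y Hxy
  (sc 0) (sc 0) sd sl (fun x y H => proj2 (proj2 (proj2 (proj1 (struct1 x y H)))))).
assert (E2 := dcomb (a2 x y) (b2 x y) (V1 W) (fun _ _ => 0) fl (fun x y => - fa x y) (fun _ _ => 1) x y Hxy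
  (sc 0) sl (so _ sa) (sc 1) (fun x y H => proj1 (proj2 (proj1 (struct1 x y H))))).
rewrite !rdc in E1, E2; rewrite (rdo _ _ _ _ _ sa Hxy) in E2.
fold (V1 Z x y) in E1; fold (V1 W x y) in E1; fold (V2 Z x y) in E2; fold (V2 W x y) in E2.
change (dd2 (a1 x y) (b1 x y) (V2 W) x y) with (V1 (V2 W) x y) in E1.
change (dd2 (a2 x y) (b2 x y) (V1 W) x y) with (V2 (V1 W) x y) in E2.
rewrite E1, E2 in T.
destruct (struct1 x y Hxy) as ((EZ1 & EW1 & EZ2 & EW2) & _).
rewrite EZ1, EW1, EZ2, EW2, !comb_comb, !add2_comb, !sub2_comb in T.
apply null_pair_coef in T; [|exact HP]; destruct T as [T1 T2].
destruct (codazzi1 x y Hxy) as (G1 & _ & _).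
assert (G2 := f_equal snd T1).
clear - G1 G2; fold (N2 fl x y) in *.
set (n2l := N2 fl x y) in *; clearbody n2l.
set (a := fa x y) in *; clearbody a; set (d := fd x y) in *; clearbody d;
set (l := fl x y) in *; clearbody l.
simpl in *; subst a; lra.
Qed.

(** The bracket is applied to [fl], whose derivatives along both fields are already known. As
    [N1 fl = fd], this yields the missing derivative of [fd]. *)
Let codazzi3 x y : U x y -> N2 fd x y = - (fl x y * fl x y).
Proof.
intros Hxy.
assert (C := comm fl x y sl Hxy).
destruct (codazzi1 x y Hxy) as (Ea & E1 & E2).
assert (D1 : N1 (N2 fl) x y = N1 fl x y * fd x y + fl x y * N1 fd x y).
{ apply is_rdd_unique, is_rdd_ext with (fun x y => fl x y * fd x y).
  - apply locally_2d_impl with (2 := near x y Hxy), locally_2d_forall; intros u v Huv; symmetry; now apply codazzi2.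
  - apply is_rdd_mult; now apply (is_rdd_smooth U). }
assert (D2 : N2 (N1 fl) x y = N2 fd x y).
{ apply is_rdd_unique, is_rdd_ext with fd.
  - apply locally_2d_impl with (2 := near x y Hxy), locally_2d_forall; intros u v Huv; symmetry; now apply codazzi1.
  - now apply (is_rdd_smooth U). }
rewrite D1, D2, Ea, E1, E2 in C; lra.
Qed.

Lemma structure_equations : exists d l : R -> R -> R, smooth_on U d /\ smooth_on U l /\
  forall x y, U x y ->
    (V1 Z x y = comb Ci 0%C (Z x y) (W x y) /\
     V1 W x y = comb (Ci * l x y)%C Ci (Z x y) (W x y) /\
     V2 Z x y = comb (- RtoC (d x y) + Ci * l x y)%C Ci (Z x y) (W x y) /\
     V2 W x y = comb 0%C (RtoC (d x y) + Ci * l x y)%C (Z x y) (W x y)) /\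
    N1 d x y = - l x y /\ N1 l x y = d x y /\
    N2 d x y = - (l x y * l x y) /\ N2 l x y = l x y * d x y.
Proof.
exists fd, fl; split; [exact sd|split; [exact sl|]]; intros x y Hxy.
destruct (codazzi1 x y Hxy) as (Ea & E1 & E2).
destruct (struct1 x y Hxy) as ((EZ1 & EW1 & EZ2 & EW2) & _).
rewrite Ea in *; split; [|repeat split; auto].
rewrite EZ1, EW1, EZ2, EW2.
repeat split; f_equal; apply Ceq_intro; simpl; unfold Re, Im; simpl; ring.
Qed.

End Structure.

(** * Affine unitary maps *)

Definition matL (c1 c2 c3 c4 : C) (z : C2) : C2 :=
  ((c1 * fst z + c2 * snd z)%C, (c3 * fst z + c4 * snd z)%C).

Local Notation C2N := (prod_NormedModule C_AbsRing C_NormedModule C_NormedModule).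

Lemma is_linear_row (c1 c2 : C) :
  is_linear (U := C2N) (V := C_NormedModule) (fun z : C2N => (c1 * fst z + c2 * snd z)%C).
Proof.
apply (is_linear_comp (U := C2N) (V := C2N) (W := C_NormedModule)
  (fun z : C2N => (scal c1 (fst z), scal c2 (snd z)) : C2N) (fun z : C2N => plus (fst z) (snd z))).
- apply (is_linear_prod (T := C2N) (fun z : C2N => scal c1 (fst z)) (fun z : C2N => scal c2 (snd z))).
  + apply (is_linear_comp (fun z : C2N => fst z) (fun z : C_NormedModule => scal c1 z : C_NormedModule)); [apply is_linear_fst|].
    exact (is_linear_scal_r (K := C_AbsRing) (V := C_NormedModule) c1 Cmult_comm).
  + apply (is_linear_comp (fun z : C2N => snd z) (fun z : C_NormedModule => scal c2 z : C_NormedModule)); [apply is_linear_snd|].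
    exact (is_linear_scal_r (K := C_AbsRing) (V := C_NormedModule) c2 Cmult_comm).
- apply is_linear_plus.
Qed.

Lemma is_linear_matL c1 c2 c3 c4 : is_linear (U := C2N) (V := C2N) (matL c1 c2 c3 c4).
Proof.
apply (is_linear_prod (T := C2N) (fun z : C2N => (c1 * fst z + c2 * snd z)%C)
  (fun z : C2N => (c3 * fst z + c4 * snd z)%C)); apply is_linear_row.
Qed.

Lemma filterdiff_matL c1 c2 c3 c4 (p z : C2) :
  @filterdiff C_AbsRing C2N C2N (fun w => matL c1 c2 c3 c4 (sub2 w p)) (locally z) (matL c1 c2 c3 c4).
Proof.
set (L := matL c1 c2 c3 c4).
split; [apply is_linear_matL|].
intros x _ eps; apply filter_forall; intros y.
assert (E : forall x y : C2, minus (minus (L (sub2 y p)) (L (sub2 x p))) (L (minus y x)) = (zero : C2N)).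
{ clear; intros x y.
  transitivity (sub2 (sub2 (L (sub2 y p)) (L (sub2 x p))) (L (sub2 y x))); [reflexivity|].
  rewrite !sub2E; unfold L, matL; simpl; apply injective_projections; simpl; ring_simplify; reflexivity. }
apply Rle_trans with 0.
- right; transitivity (norm (zero : C2N)).
  + exact (f_equal (fun v : C2N => norm v) (E x y)).
  + exact (norm_zero (K := C_AbsRing) (V := C2N)).
- apply Rmult_le_pos; [apply Rlt_le, eps|].
  exact (norm_ge_0 (K := C_AbsRing) (V := C2N) (minus y x)).
Qed.

Lemma herm_comb_null a b c d z w k : null_pair z w k ->
  herm (comb a b z w) (comb c d z w) = (a * Cconj d * k + b * Cconj c * Cconj k)%C.
Proof.
intros H; assert (Hwz := null_pair_sym _ _ _ H); destruct H as (Hz & Hw & Hzw).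
rewrite herm_comb_l, !herm_comb_r, Hz, Hw, Hzw, Hwz; ring.
Qed.

(** The coefficients are those of [null_pair_decomp], so for a null pair with [k <> 0] this is the
    complex-linear map carrying [z1], [z2] to [w1], [w2]. *)
Definition null_map (z1 z2 w1 w2 : C2) (k : C) (v : C2) : C2 :=
  comb (herm v z2 / k) (herm v z1 / Cconj k) w1 w2.

Lemma null_map_comb z1 z2 w1 w2 (k a b : C) : k <> 0%C -> null_pair z1 z2 k ->
  null_map z1 z2 w1 w2 k (comb a b z1 z2) = comb a b w1 w2.
Proof.
intros Hk H; assert (Hwz := null_pair_sym _ _ _ H); destruct H as (Hz & Hw & Hzw).
unfold null_map; rewrite !herm_comb_l, Hz, Hw, Hzw, Hwz; f_equal; field; auto using Cconj_neq_0.
Qed.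

Lemma null_map_inv z1 z2 w1 w2 (k : C) v : k <> 0%C -> null_pair z1 z2 k -> null_pair w1 w2 k ->
  null_map z1 z2 w1 w2 k (null_map w1 w2 z1 z2 k v) = v.
Proof.
intros Hk H H'; unfold null_map at 2; rewrite null_map_comb; auto.
symmetry; now apply null_pair_decomp.
Qed.

Lemma null_map_matL z1 z2 w1 w2 k : exists c1 c2 c3 c4, forall v,
  null_map z1 z2 w1 w2 k v = matL c1 c2 c3 c4 v.
Proof.
exists (- Cconj (fst z2) / k * fst w1 - Cconj (fst z1) / Cconj k * fst w2)%C,
  (Cconj (snd z2) / k * fst w1 + Cconj (snd z1) / Cconj k * fst w2)%C,
  (- Cconj (fst z2) / k * snd w1 - Cconj (fst z1) / Cconj k * snd w2)%C,
  (Cconj (snd z2) / k * snd w1 + Cconj (snd z1) / Cconj k * snd w2)%C.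
intros v; unfold null_map, matL, herm; rewrite combE; apply injective_projections; simpl; unfold Cdiv; ring.
Qed.

(** The coefficients are kept, and equal products [k] make this preserve [herm], hence its real
    part. The constant of integration [p] is moved to the origin because the models have no constant
    term. *)
Lemma congruence_of_null_pairs p z1 z2 w1 w2 (k : C) : k <> 0%C ->
  null_pair z1 z2 k -> null_pair w1 w2 k ->
  exists Phi, holomorphic_isometry Phi /\ forall a b, Phi (add2 p (comb a b z1 z2)) = comb a b w1 w2.
Proof.
intros Hk H1 H2.
set (L := null_map z1 z2 w1 w2 k).
assert (S : forall v, sub2 (add2 p v) p = v).
{ intros v; rewrite add2E, sub2E; simpl; apply injective_projections; simpl; ring. }
assert (A : forall v, add2 p (sub2 v p) = v).
{ intros v; rewrite sub2E, add2E; simpl; apply injective_projections; simpl; ring. }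
exists (fun z => L (sub2 z p)); split; [split|].
- exists (fun z => add2 p (null_map w1 w2 z1 z2 k z)); split; intros z.
  + unfold L; rewrite null_map_inv; auto.
  + rewrite S; unfold L; rewrite null_map_inv; auto.
- exists (fun _ => L); split.
  + intros z; destruct (null_map_matL z1 z2 w1 w2 k) as (c1 & c2 & c3 & c4 & E).
    replace L with (matL c1 c2 c3 c4); [apply filterdiff_matL|].
    apply FunctionalExtensionality.functional_extensionality; intros v; symmetry; apply E.
  + intros _ v w; rewrite !metric_herm; f_equal.
    rewrite (null_pair_decomp z1 z2 k v), (null_pair_decomp z1 z2 k w) by auto.
    unfold L; rewrite !null_map_comb by auto.
    now rewrite (herm_comb_null _ _ _ _ w1 w2 k), (herm_comb_null _ _ _ _ z1 z2 k).
- intros a b; rewrite S; now apply null_map_comb.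
Qed.

(** * Integration of the structure equations *)

Lemma box_incl x0 y0 d d' x y : d' <= d -> box x0 y0 d' x y -> box x0 y0 d x y.
Proof. intros H [H1 H2]; split; lra. Qed.

Lemma box_center x0 y0 d : 0 < d -> box x0 y0 d x0 y0.
Proof. intros H; split; now rewrite Rminus_diag, Rabs_R0. Qed.

Lemma box_shrink x0 y0 d (P : R -> R -> Prop) : 0 < d -> locally_2d P x0 y0 ->
  exists d', 0 < d' <= d /\ forall x y, box x0 y0 d' x y -> P x y.
Proof.
intros Hd [e He]; exists (Rmin d e); split; [split|].
- apply Rmin_pos; [exact Hd|apply e].
- apply Rmin_l.
- intros x y [H1 H2]; apply He; [apply Rlt_le_trans with (1 := H1)|apply Rlt_le_trans with (1 := H2)]; apply Rmin_r.
Qed.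

Lemma continuity_2d_pt_pos f x y : continuity_2d_pt f x y -> 0 < f x y ->
  locally_2d (fun u v => 0 < f u v) x y.
Proof.
intros Hc Hp; specialize (Hc (mkposreal _ Hp)); simpl in Hc.
apply locally_2d_impl with (2 := Hc), locally_2d_forall; intros u v H; apply Rabs_def2 in H; lra.
Qed.

(** A branch of the argument with value [u0] at [c0]. Multiplying by [Cconj c0] moves the base value
    to the positive axis, and the arctangent of the slope is a valid angle while [Re (c * Cconj c0)]
    is positive. *)
Definition arg_near (c0 : C) (u0 : R) (c : C) : R :=
  u0 + atan (Im (c * Cconj c0) / Re (c * Cconj c0)).

Lemma arg_near_center c0 u0 : arg_near c0 u0 c0 = u0.
Proof.
unfold arg_near; replace (Im (c0 * Cconj c0)) with 0.
- unfold Rdiv; rewrite Rmult_0_l, atan_0; ring.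
- unfold Im; simpl; ring.
Qed.

(** A derivative of the form [i l c] leaves the modulus fixed and turns the argument at rate [l]. *)
Lemma is_rdd_arg_near a b c c0 u0 x y l : 0 < Re (c x y * Cconj c0)%C ->
  is_dd a b c x y (Ci * RtoC l * c x y)%C ->
  is_rdd a b (fun x y => arg_near c0 u0 (c x y)) x y l.
Proof.
intros Hp H.
assert (G : is_dd a b (fun x y => c x y * Cconj c0)%C x y (Ci * RtoC l * (c x y * Cconj c0))%C).
{ eapply is_dd_eq; [apply is_dd_mult; [exact H|apply is_dd_const]|cbv beta; ring]. }
set (g := fun x y => (c x y * Cconj c0)%C) in *.
change (0 < Re (g x y)) in Hp.
change (is_dd a b g x y (Ci * RtoC l * g x y)%C) in G.
unfold arg_near; change (is_rdd a b (fun x y => u0 + atan (Im (g x y) / Re (g x y))) x y l).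
destruct G as [G1 G2].
replace (Re (Ci * RtoC l * g x y)%C) with (- l * Im (g x y)) in G1 by (unfold Re, Im; simpl; ring).
replace (Im (Ci * RtoC l * g x y)%C) with (l * Re (g x y)) in G2 by (unfold Re, Im; simpl; ring).
eapply is_rdd_eq.
- apply (is_rdd_plus a b (fun _ _ => u0)); [apply is_rdd_const|].
  apply (is_rdd_comp a b atan (fun x y => Im (g x y) / Re (g x y))); [apply is_derive_atan|].
  apply (is_rdd_mult a b (fun x y => Im (g x y)) (fun x y => / Re (g x y))); [exact G2|].
  apply (is_rdd_comp a b Rinv (fun x y => Re (g x y))); [|exact G1].
  apply (is_derive_inv (fun z => z) _ 1); [exact (is_derive_id (K := R_AbsRing) _)|cbv beta; lra].
- cbv beta; unfold Rsqr; set (p := Re (g x y)) in *; set (q := Im (g x y)); clearbody p q; clear - Hp.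
  field; split; [|nra]; lra.
Qed.

Lemma cis_mult_opp u : (cis u * cis (- u) = 1)%C.
Proof.
unfold cis; rewrite cos_neg, sin_neg; assert (H := sin2_cos2 u); unfold Rsqr in H.
apply Ceq_intro; simpl; unfold Re, Im; simpl; lra.
Qed.

Lemma cis_conj u : Cconj (cis u) = cis (- u).
Proof. unfold cis; rewrite cos_neg, sin_neg; reflexivity. Qed.

(** [acos] determines the angle up to sign, and the sign of [q] decides. *)
Lemma polar p q r : 0 < r -> p * p + q * q = r * r -> exists u, (p, q) = (r * cis u)%C.
Proof.
intros Hr H.
assert (Hx : -1 <= p / r <= 1).
{ split; apply Rmult_le_reg_r with r; auto; unfold Rdiv; rewrite Rmult_assoc, Rinv_l by lra; nra. }
assert (Hc : cos (acos (p / r)) = p / r) by now apply cos_acos.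
assert (Hs : r * sin (acos (p / r)) = Rabs q).
{ rewrite sin_acos by exact Hx.
  replace (1 - (p / r)²) with ((Rabs q / r)²).
  - rewrite sqrt_Rsqr; [field; lra|].
    apply Rmult_le_pos; [apply Rabs_pos|apply Rlt_le, Rinv_0_lt_compat, Hr].
  - rewrite Rsqr_div', <- Rsqr_abs; unfold Rsqr.
    replace (q * q) with (r * r - p * p) by lra; field; lra. }
destruct (Rle_dec 0 q) as [Hq|Hq].
- exists (acos (p / r)); unfold cis; apply Ceq_intro; simpl; unfold Re, Im; simpl.
  + rewrite Hc; field; lra.
  + rewrite Rabs_pos_eq in Hs by exact Hq; lra.
- exists (- acos (p / r)); unfold cis; rewrite cos_neg, sin_neg; apply Ceq_intro; simpl; unfold Re, Im; simpl.
  + rewrite Hc; field; lra.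
  + rewrite Rabs_left in Hs by lra; lra.
Qed.

Lemma box_const2 x0 y0 d a1 b1 a2 b2 F :
  (forall x y, box x0 y0 d x y -> a1 x y * b2 x y - a2 x y * b1 x y <> 0) ->
  (forall x y, box x0 y0 d x y -> is_dd2 (a1 x y) (b1 x y) F x y (RtoC 0, RtoC 0)) ->
  (forall x y, box x0 y0 d x y -> is_dd2 (a2 x y) (b2 x y) F x y (RtoC 0, RtoC 0)) ->
  forall x y, box x0 y0 d x y -> F x y = F x0 y0.
Proof.
intros Hd H1 H2 x y Hxy; apply injective_projections.
- exact (box_const x0 y0 d a1 b1 a2 b2 (fun x y => fst (F x y)) Hd
    (fun x y H => proj1 (H1 x y H)) (fun x y H => proj1 (H2 x y H)) x y Hxy).
- exact (box_const x0 y0 d a1 b1 a2 b2 (fun x y => snd (F x y)) Hd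
    (fun x y H => proj2 (H1 x y H)) (fun x y H => proj2 (H2 x y H)) x y Hxy).
Qed.

Lemma model1_comb : exists A1 A2, null_pair A1 A2 (- Ci)%C /\
  forall u v, model1 u v = comb (cis u * v)%C (cis u) A1 A2.
Proof.
exists (RtoC (sqrt 2 / 2), RtoC (sqrt 2 / 2)),
  ((- (RtoC (sqrt 2 / 2) * Ci))%C, (RtoC (sqrt 2 / 2) * Ci)%C).
assert (H : sqrt 2 * sqrt 2 = 2) by (apply sqrt_sqrt; lra).
split; [|intros; unfold model1; rewrite rscalE, add2E, !cscalE, combE; cbn [fst snd];
  apply injective_projections; cbn [fst snd]; ring].
assert (H' : sqrt 2 / 2 * (sqrt 2 / 2) = / 2) by lra.
set (t := sqrt 2 / 2) in *; clearbody t; clear H.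
unfold null_pair, herm; split; [|split]; apply Ceq_intro; simpl; unfold Re, Im; simpl; lra.
Qed.

(** Sorting the model by its exponentials instead of by its phases exposes two constant null
    vectors, with the coefficients [cis u + 1] and [cis u - 1] that [curved_normal_form]
    produces. *)
Lemma model2_comb r : 0 < r -> exists A1 A2, null_pair A1 A2 (Ci * RtoC (/ (2 * r)))%C /\
  forall u v, model2 r u v =
    comb (RtoC (exp (r * v)) * (cis u + 1))%C (RtoC (exp (- (r * v))) * (cis u - 1))%C A1 A2.
Proof.
intros Hr.
exists (RtoC (- (sqrt 2 / (4 * r))), RtoC (sqrt 2 / (4 * r))),
  (((1 - 2 * Ci * RtoC r) / RtoC (2 * sqrt 2 * r))%C,
     ((- (1) - 2 * Ci * RtoC r) / RtoC (2 * sqrt 2 * r))%C).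
assert (H : sqrt 2 * sqrt 2 = 2) by (apply sqrt_sqrt; lra).
assert (H0 : 0 < sqrt 2) by (apply sqrt_lt_R0; lra).
split.
2: { intros; unfold model2; rewrite !rscalE, !add2E, !sub2E, !cscalE, combE; cbn [fst snd];
  apply injective_projections; cbn [fst snd]; ring. }
set (s := sqrt 2) in *; clearbody s.
assert (E : forall z, (z / RtoC (2 * s * r) = z * RtoC (/ (2 * s * r)))%C).
{ intros z; unfold Cdiv; rewrite RtoC_inv; [reflexivity|].
  apply Rgt_not_eq; repeat apply Rmult_lt_0_compat; lra. }
rewrite !E.
(* The square root cancels in the one mixed product of [A1] and [A2]; with it the null-pair
   identities become polynomial in [a], [b] and [r]. *)
assert (H1 : s / (4 * r) * / (2 * s * r) = / (8 * r * r)) by (field; lra).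
assert (H3 : / (2 * r) = 4 * r * / (8 * r * r)) by (field; lra).
rewrite H3.
set (a := s / (4 * r)) in *; set (b := / (2 * s * r)) in *; set (c := / (8 * r * r)) in *.
clearbody a b c; clear H3 E.
unfold null_pair, herm; split; [|split]; apply Ceq_intro; simpl; unfold Re, Im; simpl.
all: try rewrite <- H1; ring.
Qed.

Lemma csmooth2_comb U f g F G : open2 U -> csmooth U f -> csmooth U g -> csmooth2 U F -> csmooth2 U G ->
  csmooth2 U (fun x y => comb (f x y) (g x y) (F x y) (G x y)).
Proof.
intros HU Hf Hg [F1 F2] [G1 G2]; split.
- exact (csmooth_plus U HU _ _ (csmooth_mult U HU _ _ Hf F1) (csmooth_mult U HU _ _ Hg G1)).
- exact (csmooth_plus U HU _ _ (csmooth_mult U HU _ _ Hf F2) (csmooth_mult U HU _ _ Hg G2)).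
Qed.

Lemma is_dd2_comb_const a b p q F G x y F' G' : is_dd2 a b F x y F' -> is_dd2 a b G x y G' ->
  is_dd2 a b (fun x y => comb p q (F x y) (G x y)) x y (comb p q F' G').
Proof.
intros HF HG; eapply is_dd2_eq.
- apply (is_dd2_comb a b (fun _ _ => p) (fun _ _ => q)); [apply is_dd_const|apply is_dd_const|exact HF|exact HG].
- cbv beta; rewrite add2E, !combE; apply injective_projections; cbn [fst snd]; ring.
Qed.

Lemma RtoC_m1 : RtoC (-1) = (- (1))%C.
Proof. apply Ceq_intro; simpl; ring. Qed.

Lemma is_dd2_const a b (B : C2) x y : is_dd2 a b (fun _ _ => B) x y (RtoC 0, RtoC 0).
Proof. split; [exact (is_dd_const a b (fst B) x y)|exact (is_dd_const a b (snd B) x y)]. Qed.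

(** A component that is nonzero on a given vector turns a vector equation into a scalar one. From
    such a component both flat parameters and the curved [v] are built. *)
Definition coordinate (pi : C2 -> C) : Prop := pi = fst \/ pi = snd.

Lemma null_pair_coordinate z w (k : C) : k <> 0%C -> null_pair z w k ->
  exists pi, coordinate pi /\ pi z <> 0%C.
Proof.
intros Hk H.
destruct (Ceq_dec (fst z) 0%C) as [e1|]; [|exists fst; split; [now left|assumption]].
destruct (Ceq_dec (snd z) 0%C) as [e2|]; [|exists snd; split; [now right|assumption]].
exfalso; apply Hk; destruct H as (_ & _ & <-); unfold herm; rewrite e1, e2; ring.
Qed.

Lemma coordinate_comb pi p q z w : coordinate pi -> pi (comb p q z w) = (p * pi z + q * pi w)%C.
Proof. intros [-> | ->]; reflexivity. Qed.

Lemma coordinate_cscal pi p z : coordinate pi -> pi (cscal p z) = (p * pi z)%C.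
Proof. intros [-> | ->]; reflexivity. Qed.

Lemma coordinate_dd pi a b G x y l : coordinate pi -> is_dd2 a b G x y l ->
  is_dd a b (fun x y => pi (G x y)) x y (pi l).
Proof. intros [-> | ->] [H1 H2]; assumption. Qed.

Lemma coordinate_csmooth pi U G : coordinate pi -> csmooth2 U G -> csmooth U (fun x y => pi (G x y)).
Proof. intros [-> | ->] [H1 H2]; assumption. Qed.

Lemma null_pair_swap z w k : null_pair z w k -> null_pair w z (Cconj k).
Proof. intros H; split; [apply H|split; [apply H|]]; now apply null_pair_sym. Qed.

Lemma comb_zero z w : comb 0%C 0%C z w = (RtoC 0, RtoC 0).
Proof. rewrite combE; apply injective_projections; cbn [fst snd]; ring. Qed.

Lemma arg_near_domain U c x0 y0 : csmooth U c -> open2 U -> U x0 y0 -> c x0 y0 <> 0%C ->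
  locally_2d (fun x y => 0 < Re (c x y * Cconj (c x0 y0))) x0 y0.
Proof.
intros Hc HU H0 Hnz; set (c0 := c x0 y0) in *.
apply continuity_2d_pt_pos.
- assert (S : csmooth U (fun x y => (c x y * Cconj c0)%C)).
  { apply csmooth_mult; [exact HU|exact Hc|now apply csmooth_const]. }
  exact (smooth_cont U _ x0 y0 (proj1 S) H0).
- fold c0; unfold Re; simpl.
  destruct (Req_dec (fst c0) 0) as [e1|n1]; [|assert (0 < fst c0 * fst c0) by nra; nra].
  destruct (Req_dec (snd c0) 0) as [e2|n2]; [|assert (0 < snd c0 * snd c0) by nra; nra].
  exfalso; apply Hnz; now apply injective_projections.
Qed.

Section Integration.

Variables (x0 y0 d : R) (F : R -> R -> C2) (a1 b1 a2 b2 om la : R -> R -> R).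
Hypothesis Hd : 0 < d.

Let U := box x0 y0 d.
Let Z x y := dd2 (a1 x y) (b1 x y) F x y.
Let W x y := dd2 (a2 x y) (b2 x y) F x y.

Hypothesis NF : null_frame U F a1 b1 a2 b2.

Hypothesis E1 : forall x y, U x y -> dd2 (a1 x y) (b1 x y) Z x y = comb Ci 0%C (Z x y) (W x y).
Hypothesis E2 : forall x y, U x y ->
  dd2 (a1 x y) (b1 x y) W x y = comb (Ci * RtoC (la x y))%C Ci (Z x y) (W x y).
Hypothesis E3 : forall x y, U x y ->
  dd2 (a2 x y) (b2 x y) Z x y = comb (- RtoC (om x y) + Ci * RtoC (la x y))%C Ci (Z x y) (W x y).
Hypothesis E4 : forall x y, U x y ->
  dd2 (a2 x y) (b2 x y) W x y = comb 0%C (RtoC (om x y) + Ci * RtoC (la x y))%C (Z x y) (W x y).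

Let sZ : csmooth2 U Z.
Proof. apply csmooth2_dd2; apply NF. Qed.
Let sW : csmooth2 U W.
Proof. apply csmooth2_dd2; apply NF. Qed.

Let F1 x y : U x y -> is_dd2 (a1 x y) (b1 x y) F x y (Z x y).
Proof. intros; apply (is_dd2_csmooth U); [apply NF|assumption]. Qed.
Let F2 x y : U x y -> is_dd2 (a2 x y) (b2 x y) F x y (W x y).
Proof. intros; apply (is_dd2_csmooth U); [apply NF|assumption]. Qed.
Let Z1 x y : U x y -> is_dd2 (a1 x y) (b1 x y) Z x y (comb Ci 0%C (Z x y) (W x y)).
Proof. intros H; rewrite <- E1 by exact H; now apply (is_dd2_csmooth U). Qed.
Let W1 x y : U x y -> is_dd2 (a1 x y) (b1 x y) W x y (comb (Ci * RtoC (la x y))%C Ci (Z x y) (W x y)).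
Proof. intros H; rewrite <- E2 by exact H; now apply (is_dd2_csmooth U). Qed.
Let Z2 x y : U x y ->
  is_dd2 (a2 x y) (b2 x y) Z x y (comb (- RtoC (om x y) + Ci * RtoC (la x y))%C Ci (Z x y) (W x y)).
Proof. intros H; rewrite <- E3 by exact H; now apply (is_dd2_csmooth U). Qed.
Let W2 x y : U x y ->
  is_dd2 (a2 x y) (b2 x y) W x y (comb 0%C (RtoC (om x y) + Ci * RtoC (la x y))%C (Z x y) (W x y)).
Proof. intros H; rewrite <- E4 by exact H; now apply (is_dd2_csmooth U). Qed.

Let HN : null_pair (Z x0 y0) (W x0 y0) 1%C.
Proof. exact (nf_null _ _ _ _ _ _ NF x0 y0 (box_center _ _ _ Hd)). Qed.

Let const2 d' G : d' <= d ->
  (forall x y, box x0 y0 d' x y -> is_dd2 (a1 x y) (b1 x y) G x y (RtoC 0, RtoC 0)) ->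
  (forall x y, box x0 y0 d' x y -> is_dd2 (a2 x y) (b2 x y) G x y (RtoC 0, RtoC 0)) ->
  forall x y, box x0 y0 d' x y -> G x y = G x0 y0.
Proof.
intros Hd'; apply box_const2; intros x y H; apply (nf_det _ _ _ _ _ _ NF); now apply box_incl with d'.
Qed.

Lemma flat_normal_form : (forall x y, U x y -> om x y = 0 /\ la x y = 0) ->
  exists d' (u v : R -> R -> R) z1 z2 p, 0 < d' <= d /\ null_pair z1 z2 (- Ci)%C /\
  forall x y, box x0 y0 d' x y ->
    F x y = add2 p (comb (cis (u x y) * RtoC (v x y))%C (cis (u x y)) z1 z2) /\
    is_rdd (a1 x y) (b1 x y) u x y 1 /\ is_rdd (a2 x y) (b2 x y) u x y 0 /\
    is_rdd (a1 x y) (b1 x y) v x y 0 /\ is_rdd (a2 x y) (b2 x y) v x y (-1).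
Proof.
intros H0.
assert (U0 : U x0 y0) by now apply box_center.
destruct (null_pair_coordinate _ _ _ (Cconj_neq_0 _ C1_nz) (null_pair_swap _ _ _ HN)) as (pi & Hpi & Hnz).
assert (Sc := coordinate_csmooth pi U W Hpi sW).
destruct (box_shrink x0 y0 d _ Hd (arg_near_domain U _ x0 y0 Sc (box_open _ _ _) U0 Hnz)) as (d' & Hd' & Hpos).
(* With [om = la = 0] the vector [W] only rotates, at rate 1 along [N1] and 0 along [N2]. Its phase,
   read from a component nonzero at the base point, is [u]. *)
set (u := fun x y => arg_near (pi (W x0 y0)) 0 (pi (W x y))).
assert (HU' : forall x y, box x0 y0 d' x y -> U x y) by (intros x y; apply box_incl; lra).
assert (u1 : forall x y, box x0 y0 d' x y -> is_rdd (a1 x y) (b1 x y) u x y 1).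
{ intros x y H; apply is_rdd_arg_near; [now apply Hpos|].
  eapply is_dd_eq; [apply coordinate_dd; [exact Hpi|apply W1; auto]|].
  destruct (H0 x y) as [_ ->]; auto; rewrite coordinate_comb by exact Hpi; ring. }
assert (u2 : forall x y, box x0 y0 d' x y -> is_rdd (a2 x y) (b2 x y) u x y 0).
{ intros x y H; apply is_rdd_arg_near; [now apply Hpos|].
  eapply is_dd_eq; [apply coordinate_dd; [exact Hpi|apply W2; auto]|].
  destruct (H0 x y) as [-> ->]; auto; rewrite coordinate_comb by exact Hpi; ring. }
assert (u0 : u x0 y0 = 0) by apply arg_near_center.
set (e := fun x y => cis (- u x y)).
assert (e1 : forall x y, box x0 y0 d' x y -> is_dd (a1 x y) (b1 x y) e x y (- Ci * e x y)%C).
{ intros x y H; eapply is_dd_eq; [apply (is_dd_cis _ _ (fun x y => - u x y)), is_rdd_opp, u1, H|].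
  unfold e; rewrite RtoC_opp; ring. }
assert (e2 : forall x y, box x0 y0 d' x y -> is_dd (a2 x y) (b2 x y) e x y 0%C).
{ intros x y H; eapply is_dd_eq; [apply (is_dd_cis _ _ (fun x y => - u x y)), is_rdd_opp, u2, H|].
  rewrite Ropp_0; ring. }
assert (ce : forall x y z, z = cscal (cis (u x y)) (cscal (e x y) z)).
{ intros x y z; unfold e; rewrite !cscalE; cbn [fst snd]; rewrite !Cmult_assoc, cis_mult_opp.
  apply injective_projections; cbn [fst snd]; ring. }
set (B := cscal (e x0 y0) (W x0 y0)).
assert (HB : forall x y, box x0 y0 d' x y -> cscal (e x y) (W x y) = B).
{ apply const2; [lra| |]; intros x y H; destruct (H0 x y) as [o0 l0]; auto.
  - eapply is_dd2_eq; [apply is_dd2_cscal; [apply e1, H|apply W1; auto]|].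
    rewrite l0, !combE; apply injective_projections; cbn [fst snd]; ring.
  - eapply is_dd2_eq; [apply is_dd2_cscal; [apply e2, H|apply W2; auto]|].
    rewrite o0, l0, !combE; apply injective_projections; cbn [fst snd]; ring. }
assert (HBnz : pi B <> 0%C).
{ unfold B; rewrite coordinate_cscal by exact Hpi; apply Cmult_neq_0; [|exact Hnz].
  intros K; assert (Q := cis_mult_opp (u x0 y0)); fold (e x0 y0) in Q; rewrite K in Q.
  apply C1_nz; rewrite <- Q; ring. }
set (V := fun x y => cscal (e x y) (Z x y)).
assert (V1 : forall x y, box x0 y0 d' x y -> is_dd2 (a1 x y) (b1 x y) V x y (RtoC 0, RtoC 0)).
{ intros x y H; eapply is_dd2_eq; [apply is_dd2_cscal; [apply e1, H|apply Z1; auto]|].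
  rewrite !combE; apply injective_projections; cbn [fst snd]; ring. }
assert (V2 : forall x y, box x0 y0 d' x y -> is_dd2 (a2 x y) (b2 x y) V x y (cscal Ci B)).
{ intros x y H; destruct (H0 x y) as [o0 l0]; auto.
  eapply is_dd2_eq; [apply is_dd2_cscal; [apply e2, H|apply Z2; auto]|].
  rewrite <- (HB x y H), o0, l0, !combE, !cscalE; apply injective_projections; cbn [fst snd]; ring. }
(* [V] changes only along [N2], with constant velocity [i B]. The factor [i / pi B] makes this
   velocity -1, so taking the real part loses only a constant. The sign of [v] is dictated by the
   product [- i] of the model's null pair. *)
set (v := fun x y => Re (pi (V x y) * (Ci / pi B))%C).
assert (v1 : forall x y, box x0 y0 d' x y -> is_rdd (a1 x y) (b1 x y) v x y 0).
{ intros x y H.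
  assert (K : is_dd (a1 x y) (b1 x y) (fun x y => pi (V x y) * (Ci / pi B))%C x y 0%C).
  { eapply is_dd_eq; [apply is_dd_mult; [apply coordinate_dd; [exact Hpi|apply V1, H]|apply is_dd_const]|].
    cbv beta; destruct Hpi as [-> | ->]; cbn [fst snd]; ring. }
  apply K. }
assert (v2 : forall x y, box x0 y0 d' x y -> is_rdd (a2 x y) (b2 x y) v x y (-1)).
{ intros x y H.
  assert (K : is_dd (a2 x y) (b2 x y) (fun x y => pi (V x y) * (Ci / pi B))%C x y (RtoC (-1))).
  { eapply is_dd_eq; [apply is_dd_mult; [apply coordinate_dd; [exact Hpi|apply V2, H]|apply is_dd_const]|].
    cbv beta; rewrite coordinate_cscal by exact Hpi.
    transitivity (Ci * Ci)%C; [field; exact HBnz|rewrite Ci2; apply Ceq_intro; simpl; unfold Re, Im; simpl; ring]. }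
  apply K. }
set (A := add2 (V x0 y0) (cscal (Ci * RtoC (v x0 y0)) B)).
assert (HA : forall x y, box x0 y0 d' x y -> add2 (V x y) (cscal (Ci * RtoC (v x y)) B) = A).
{ apply const2; [lra| |]; intros x y H.
  - eapply is_dd2_eq; [apply is_dd2_add2; [apply V1, H|apply (is_dd2_cscal _ _ (fun x y => (Ci * RtoC (v x y))%C) (fun _ _ => B))]|].
    + apply is_dd_mult; [apply is_dd_const|apply is_dd_RtoC, v1, H].
    + apply is_dd2_const.
    + rewrite add2E, combE; apply injective_projections; cbn [fst snd]; ring.
  - eapply is_dd2_eq; [apply is_dd2_add2; [apply V2, H|apply (is_dd2_cscal _ _ (fun x y => (Ci * RtoC (v x y))%C) (fun _ _ => B))]|].
    + apply is_dd_mult; [apply is_dd_const|apply is_dd_RtoC, v2, H].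
    + apply is_dd2_const.
    + rewrite add2E, combE, cscalE, RtoC_m1; apply injective_projections; cbn [fst snd]; ring. }
set (p := add2 (F x0 y0) (cscal Ci (Z x0 y0))).
assert (Hp : forall x y, box x0 y0 d' x y -> add2 (F x y) (cscal Ci (Z x y)) = p).
{ apply const2; [lra| |]; intros x y H; destruct (H0 x y) as [o0 l0]; auto.
  - eapply is_dd2_eq; [apply is_dd2_add2; [apply F1; auto|apply (is_dd2_cscal _ _ (fun _ _ => Ci)); [apply is_dd_const|apply Z1; auto]]|].
    rewrite add2E, !combE; apply injective_projections; cbn [fst snd]; rewrite ?Cmult_plus_distr_l, ?Cmult_assoc, ?Ci2; ring [Ci2].
  - eapply is_dd2_eq; [apply is_dd2_add2; [apply F2; auto|apply (is_dd2_cscal _ _ (fun _ _ => Ci)); [apply is_dd_const|apply Z2; auto]]|].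
    rewrite o0, l0, add2E, !combE; apply injective_projections; cbn [fst snd]; ring [Ci2]. }
(* From [F = p - i Z] and [Z = e^{iu} (A - i v B)]: up to the phase the coefficient of [v] is [- B]
   and the constant term is [- i A]. *)
exists d', u, v, (cscal (- (1))%C B), (cscal (- Ci)%C A), p.
split; [exact Hd'|]; split; [|intros x y H; split; [|auto]].
- destruct HN as (HZ & HW & HZW); assert (HWZ := null_pair_sym _ _ _ HN).
  assert (H1 : (e x0 y0 * Cconj (e x0 y0) = 1)%C).
  { unfold e; rewrite u0, Ropp_0; unfold cis; rewrite cos_0, sin_0; apply Ceq_intro; simpl; unfold Re, Im; simpl; ring. }
  assert (HA' : A = comb (e x0 y0) (Ci * RtoC (v x0 y0) * e x0 y0)%C (Z x0 y0) (W x0 y0)).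
  { unfold A, V, B; rewrite add2E, !cscalE, combE; apply injective_projections; cbn [fst snd]; ring. }
  assert (HB' : forall c, cscal c B = comb 0%C (c * e x0 y0)%C (Z x0 y0) (W x0 y0)).
  { intros c; unfold B; rewrite !cscalE, combE; apply injective_projections; cbn [fst snd]; ring. }
  assert (HA'' : cscal (- Ci)%C A = comb (- Ci * e x0 y0)%C (RtoC (v x0 y0) * e x0 y0)%C (Z x0 y0) (W x0 y0)).
  { rewrite HA', cscalE, !combE; apply injective_projections; cbn [fst snd]; ring [Ci2]. }
  rewrite HB', HA''; unfold null_pair.
  rewrite !(herm_comb_null _ _ _ _ _ _ 1%C HN), !Cmult_conj, !Copp_conj, !Cconj_RtoC, !Cconj_Ci.
  set (e0 := e x0 y0) in *; set (e0' := Cconj e0) in *; set (v0 := RtoC (v x0 y0)).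
  split; [|split].
  + ring.
  + ring.
  + transitivity (- Ci * (e0 * e0'))%C; [ring|rewrite H1; ring].
- transitivity (add2 p (cscal (- Ci)%C (Z x y))).
  { rewrite <- (Hp x y H), !add2E, !cscalE; apply injective_projections; cbn [fst snd]; ring. }
  f_equal; rewrite (ce x y (Z x y)); fold (V x y); rewrite <- (HA x y H).
  rewrite combE, add2E, !cscalE; apply injective_projections; cbn [fst snd]; ring [Ci2].
Qed.

Hypothesis Som : smooth_on U om.
Hypothesis Sla : smooth_on U la.
Hypothesis D1 : forall x y, U x y -> rdd (a1 x y) (b1 x y) om x y = - la x y.
Hypothesis D2 : forall x y, U x y -> rdd (a1 x y) (b1 x y) la x y = om x y.
Hypothesis D3 : forall x y, U x y -> rdd (a2 x y) (b2 x y) om x y = - (la x y * la x y).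
Hypothesis D4 : forall x y, U x y -> rdd (a2 x y) (b2 x y) la x y = la x y * om x y.

Let om1 x y : U x y -> is_rdd (a1 x y) (b1 x y) om x y (- la x y).
Proof. intros H; rewrite <- D1 by exact H; now apply (is_rdd_smooth U). Qed.
Let la1 x y : U x y -> is_rdd (a1 x y) (b1 x y) la x y (om x y).
Proof. intros H; rewrite <- D2 by exact H; now apply (is_rdd_smooth U). Qed.
Let om2 x y : U x y -> is_rdd (a2 x y) (b2 x y) om x y (- (la x y * la x y)).
Proof. intros H; rewrite <- D3 by exact H; now apply (is_rdd_smooth U). Qed.
Let la2 x y : U x y -> is_rdd (a2 x y) (b2 x y) la x y (la x y * om x y).
Proof. intros H; rewrite <- D4 by exact H; now apply (is_rdd_smooth U). Qed.

Lemma first_integral x y : U x y ->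
  om x y * om x y + la x y * la x y = om x0 y0 * om x0 y0 + la x0 y0 * la x0 y0.
Proof.
intros Hxy.
enough (K : RtoC (om x y * om x y + la x y * la x y) =
  RtoC (om x0 y0 * om x0 y0 + la x0 y0 * la x0 y0)) by now apply RtoC_inj.
apply (box_const x0 y0 d a1 b1 a2 b2 (fun x y => RtoC (om x y * om x y + la x y * la x y))); auto.
- intros u v H; now apply (nf_det _ _ _ _ _ _ NF).
- intros u v H; apply is_dd_RtoC; eapply is_rdd_eq.
  + exact (is_rdd_plus _ _ _ _ _ _ _ _ (is_rdd_mult _ _ _ _ _ _ _ _ (om1 u v H) (om1 u v H))
      (is_rdd_mult _ _ _ _ _ _ _ _ (la1 u v H) (la1 u v H))).
  + ring.
- intros u v H; apply is_dd_RtoC; eapply is_rdd_eq.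
  + exact (is_rdd_plus _ _ _ _ _ _ _ _ (is_rdd_mult _ _ _ _ _ _ _ _ (om2 u v H) (om2 u v H))
      (is_rdd_mult _ _ _ _ _ _ _ _ (la2 u v H) (la2 u v H))).
  + ring.
Qed.

Lemma curved_normal_form r : 0 < r -> om x0 y0 * om x0 y0 + la x0 y0 * la x0 y0 = r * r ->
  exists d' (u v : R -> R -> R) z1 z2 p, 0 < d' <= d /\ null_pair z1 z2 (Ci * RtoC (/ (2 * r)))%C /\
  forall x y, box x0 y0 d' x y ->
    F x y = add2 p (comb (RtoC (exp (r * v x y)) * (cis (u x y) + 1))%C
      (RtoC (exp (- (r * v x y))) * (cis (u x y) - 1))%C z1 z2) /\
    is_rdd (a1 x y) (b1 x y) u x y 1 /\ is_rdd (a2 x y) (b2 x y) u x y (la x y) /\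
    is_rdd (a1 x y) (b1 x y) v x y 0 /\ is_rdd (a2 x y) (b2 x y) v x y 1.
Proof.
intros Hr Hr0.
assert (U0 : U x0 y0) by now apply box_center.
set (c := fun x y => (om x y, la x y) : C).
assert (Sc : csmooth U c) by (split; assumption).
assert (Hnz : c x0 y0 <> 0%C).
{ unfold c; intros K; assert (K1 := f_equal fst K); assert (K2 := f_equal snd K); simpl in K1, K2.
  rewrite K1, K2 in Hr0; nra. }
destruct (polar _ _ _ Hr Hr0) as (u0 & Hu0).
destruct (box_shrink x0 y0 d _ Hd (arg_near_domain U c x0 y0 Sc (box_open _ _ _) U0 Hnz)) as (d1 & Hd1 & Hpos).
set (u := fun x y => arg_near (c x0 y0) u0 (c x y)).
assert (HU1 : forall x y, box x0 y0 d1 x y -> U x y) by (intros x y; apply box_incl; lra).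
assert (c1 : forall x y, U x y -> is_dd (a1 x y) (b1 x y) c x y (Ci * RtoC 1 * c x y)%C).
{ intros x y H; eapply is_dd_eq; [apply is_dd_pair; [now apply om1|now apply la1]|].
  unfold c; apply Ceq_intro; simpl; unfold Re, Im; simpl; ring. }
assert (c2 : forall x y, U x y -> is_dd (a2 x y) (b2 x y) c x y (Ci * RtoC (la x y) * c x y)%C).
{ intros x y H; eapply is_dd_eq; [apply is_dd_pair; [now apply om2|now apply la2]|].
  unfold c; apply Ceq_intro; simpl; unfold Re, Im; simpl; ring. }
assert (u1 : forall x y, box x0 y0 d1 x y -> is_rdd (a1 x y) (b1 x y) u x y 1).
{ intros x y H; apply is_rdd_arg_near; [now apply Hpos|apply c1; auto]. }
assert (u2 : forall x y, box x0 y0 d1 x y -> is_rdd (a2 x y) (b2 x y) u x y (la x y)).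
{ intros x y H; apply is_rdd_arg_near; [now apply Hpos|apply c2; auto]. }
assert (uu0 : u x0 y0 = u0) by apply arg_near_center.
set (ri := RtoC (/ r)).
assert (Hri : (ri * RtoC r = 1)%C).
{ unfold ri; rewrite <- RtoC_mult, Rinv_l by lra; reflexivity. }
(* This equals [cis (- u)], as [ce] verifies where the branch [u] is valid. Written with the
   conjugate of [om + i la] it is smooth on all of [U]. *)
set (e := fun x y => (Cconj (c x y) * ri)%C).
assert (e1 : forall x y, U x y -> is_dd (a1 x y) (b1 x y) e x y (- Ci * e x y)%C).
{ intros x y H; eapply is_dd_eq; [apply is_dd_mult; [apply is_dd_conj, c1, H|apply is_dd_const]|].
  unfold e; rewrite !Cmult_conj, Cconj_Ci, Cconj_RtoC; ring. }
assert (e2 : forall x y, U x y ->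
  is_dd (a2 x y) (b2 x y) e x y (- Ci * RtoC (la x y) * e x y)%C).
{ intros x y H; eapply is_dd_eq; [apply is_dd_mult; [apply is_dd_conj, c2, H|apply is_dd_const]|].
  unfold e; rewrite !Cmult_conj, Cconj_Ci, Cconj_RtoC; ring. }
assert (Se : csmooth U e).
{ apply csmooth_mult; [apply NF|now apply csmooth_conj; [apply NF|]|apply csmooth_const, NF]. }
assert (ce : forall x y, box x0 y0 d1 x y -> (cis (u x y) * e x y = 1)%C).
{ intros x y H; transitivity (cis (u x0 y0) * e x0 y0)%C.
  - apply (box_const x0 y0 d1 a1 b1 a2 b2 (fun x y => cis (u x y) * e x y)%C); auto; intros x' y' H'.
    + apply (nf_det _ _ _ _ _ _ NF); apply HU1, H'.
    + eapply is_dd_eq; [apply is_dd_mult; [apply is_dd_cis, u1, H'|apply e1; auto]|cbv beta; ring].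
    + eapply is_dd_eq; [apply is_dd_mult; [apply is_dd_cis, u2, H'|apply e2; auto]|cbv beta; ring].
  - unfold e; rewrite uu0; unfold c; rewrite Hu0, Cmult_conj, Cconj_RtoC, cis_conj.
    assert (K := cis_mult_opp u0); ring [K Hri]. }
assert (Q2 : forall x y, U x y ->
  (RtoC (om x y) * RtoC (om x y) + RtoC (la x y) * RtoC (la x y) = RtoC r * RtoC r)%C).
{ intros x y H; rewrite <- !RtoC_mult, <- RtoC_plus, first_integral, Hr0 by exact H; reflexivity. }
(* [S], [T] are the sum and the difference of the two exponential solutions *)
set (S := fun x y => comb (- Ci * e x y)%C 0%C (Z x y) (W x y)).
set (T := fun x y => comb (ri * e x y * (Ci * RtoC (om x y)))%C (ri * e x y)%C (Z x y) (W x y)).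
assert (S1 : forall x y, U x y -> is_dd2 (a1 x y) (b1 x y) S x y (RtoC 0, RtoC 0)).
{ intros x y H; eapply is_dd2_eq; [apply (is_dd2_comb _ _ (fun x y => (- Ci * e x y)%C) (fun _ _ => 0%C))|].
  - apply is_dd_mult; [apply is_dd_const|apply e1, H].
  - apply is_dd_const.
  - apply Z1; auto.
  - apply W1; auto.
  - cbv beta; rewrite comb_comb, add2_comb, combE; apply injective_projections; cbn [fst snd]; ring [Ci2]. }
assert (S2 : forall x y, U x y -> is_dd2 (a2 x y) (b2 x y) S x y (cscal (RtoC r) (T x y))).
{ intros x y H; eapply is_dd2_eq; [apply (is_dd2_comb _ _ (fun x y => (- Ci * e x y)%C) (fun _ _ => 0%C))|].
  - apply is_dd_mult; [apply is_dd_const|apply e2, H].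
  - apply is_dd_const.
  - apply Z2; auto.
  - apply W2; auto.
  - cbv beta; rewrite comb_comb, add2_comb; unfold T; rewrite cscalE, !combE; cbn [fst snd].
    apply injective_projections; cbn [fst snd]; ring [Ci2 Hri]. }
assert (T1 : forall x y, U x y -> is_dd2 (a1 x y) (b1 x y) T x y (RtoC 0, RtoC 0)).
{ intros x y H; eapply is_dd2_eq;
  [apply (is_dd2_comb _ _ (fun x y => (ri * e x y * (Ci * RtoC (om x y)))%C) (fun x y => (ri * e x y)%C))|].
  - apply (is_dd_mult _ _ (fun x y => (ri * e x y)%C) (fun x y => (Ci * RtoC (om x y))%C)); apply is_dd_mult.
    + apply is_dd_const.
    + apply e1, H.
    + apply is_dd_const.
    + apply is_dd_RtoC, om1, H.
  - apply is_dd_mult; [apply is_dd_const|apply e1, H].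
  - apply Z1; auto.
  - apply W1; auto.
  - cbv beta; rewrite comb_comb, add2_comb, combE, RtoC_opp; apply injective_projections; cbn [fst snd]; ring [Ci2]. }
assert (T2 : forall x y, U x y -> is_dd2 (a2 x y) (b2 x y) T x y (cscal (RtoC r) (S x y))).
{ intros x y H; eapply is_dd2_eq;
  [apply (is_dd2_comb _ _ (fun x y => (ri * e x y * (Ci * RtoC (om x y)))%C) (fun x y => (ri * e x y)%C))|].
  - apply (is_dd_mult _ _ (fun x y => (ri * e x y)%C) (fun x y => (Ci * RtoC (om x y))%C)); apply is_dd_mult.
    + apply is_dd_const.
    + apply e2, H.
    + apply is_dd_const.
    + apply is_dd_RtoC, om2, H.
  - apply is_dd_mult; [apply is_dd_const|apply e2, H].
  - apply Z2; auto.
  - apply W2; auto.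
  - cbv beta; rewrite comb_comb, add2_comb; unfold S; rewrite RtoC_opp, RtoC_mult.
    rewrite cscalE, !combE; cbn [fst snd].
    assert (K := Q2 x y H).
    (* The first integral enters here: [(om^2 + la^2) / r = r] turns the [Z] coefficient of [N2 T]
       into that of [r S]. *)
    assert (K' : (ri * (RtoC (om x y) * RtoC (om x y) + RtoC (la x y) * RtoC (la x y)) = RtoC r)%C).
    { rewrite K; ring [Hri]. }
    rewrite <- K'; apply injective_projections; cbn [fst snd]; ring [Ci2]. }
assert (HUo : open2 U) by apply NF.
assert (SS : csmooth2 U S).
{ apply (csmooth2_comb U (fun x y => - Ci * e x y)%C (fun _ _ => 0%C) Z W HUo);
  [|now apply csmooth_const|exact sZ|exact sW].
  apply (csmooth_mult U HUo (fun _ _ => - Ci)%C e); [now apply csmooth_const|exact Se]. }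
assert (ST : csmooth2 U T).
{ apply (csmooth2_comb U (fun x y => ri * e x y * (Ci * RtoC (om x y)))%C (fun x y => ri * e x y)%C Z W HUo);
  [| |exact sZ|exact sW].
  - apply (csmooth_mult U HUo (fun x y => ri * e x y)%C (fun x y => Ci * RtoC (om x y))%C).
    + apply (csmooth_mult U HUo (fun _ _ => ri) e); [now apply csmooth_const|exact Se].
    + apply (csmooth_mult U HUo (fun _ _ => Ci) (fun x y => RtoC (om x y))); [now apply csmooth_const|].
      now apply csmooth_RtoC.
  - apply (csmooth_mult U HUo (fun _ _ => ri) e); [now apply csmooth_const|exact Se]. }
(* [P] and [Q] are the eigenvectors of [N2] on the span of [S] and [T], for [r] and [- r]. The
   factor 1/2 gives [S = P + Q], [T = P - Q] and the product [i / (2 r)] of the model. *)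
set (P := fun x y => comb (RtoC (/ 2)) (RtoC (/ 2)) (S x y) (T x y)).
set (Q := fun x y => comb (RtoC (/ 2)) (- RtoC (/ 2))%C (S x y) (T x y)).
assert (SP : csmooth2 U P).
{ apply (csmooth2_comb U (fun _ _ => RtoC (/ 2)) (fun _ _ => RtoC (/ 2)) S T HUo); auto; now apply csmooth_const. }
assert (P1 : forall x y, U x y -> is_dd2 (a1 x y) (b1 x y) P x y (RtoC 0, RtoC 0)).
{ intros x y H; eapply is_dd2_eq; [exact (is_dd2_comb_const _ _ _ _ S T _ _ _ _ (S1 x y H) (T1 x y H))|].
  rewrite combE; apply injective_projections; cbn [fst snd]; ring. }
assert (P2 : forall x y, U x y -> is_dd2 (a2 x y) (b2 x y) P x y (cscal (RtoC r) (P x y))).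
{ intros x y H; eapply is_dd2_eq; [exact (is_dd2_comb_const _ _ _ _ S T _ _ _ _ (S2 x y H) (T2 x y H))|].
  unfold P; rewrite !combE, !cscalE; apply injective_projections; cbn [fst snd]; ring. }
assert (Q1 : forall x y, U x y -> is_dd2 (a1 x y) (b1 x y) Q x y (RtoC 0, RtoC 0)).
{ intros x y H; eapply is_dd2_eq; [exact (is_dd2_comb_const _ _ _ _ S T _ _ _ _ (S1 x y H) (T1 x y H))|].
  rewrite combE; apply injective_projections; cbn [fst snd]; ring. }
assert (Q2' : forall x y, U x y -> is_dd2 (a2 x y) (b2 x y) Q x y (cscal (- RtoC r)%C (Q x y))).
{ intros x y H; eapply is_dd2_eq; [exact (is_dd2_comb_const _ _ _ _ S T _ _ _ _ (S2 x y H) (T2 x y H))|].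
  unfold Q; rewrite !combE, !cscalE; apply injective_projections; cbn [fst snd]; ring. }
assert (HPQ : null_pair (P x0 y0) (Q x0 y0) (Ci * RtoC (/ (2 * r)))%C).
{ set (h := RtoC (/ 2)).
  assert (EP : P x0 y0 = comb (h * (- Ci * e x0 y0 + ri * e x0 y0 * (Ci * RtoC (om x0 y0))))%C
    (h * (ri * e x0 y0))%C (Z x0 y0) (W x0 y0)).
  { unfold P, S, T; rewrite comb_comb; fold h; f_equal; ring. }
  assert (EQ : Q x0 y0 = comb (h * (- Ci * e x0 y0 - ri * e x0 y0 * (Ci * RtoC (om x0 y0))))%C
    (- h * (ri * e x0 y0))%C (Z x0 y0) (W x0 y0)).
  { unfold Q, S, T; rewrite comb_comb; fold h; f_equal; ring. }
  assert (Hk : (Ci * RtoC (/ (2 * r)) = Ci * (h * ri))%C).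
  { unfold h, ri; rewrite <- RtoC_mult, Rinv_mult; reflexivity. }
  assert (He : (e x0 y0 * Cconj (e x0 y0) = 1)%C).
  { unfold e, c, ri; rewrite Cmult_conj, Cconj_conj, Cconj_RtoC; fold ri.
    transitivity (ri * ri * ((om x0 y0, (- la x0 y0)%R) * (om x0 y0, la x0 y0)))%C; [change (Cconj (om x0 y0, la x0 y0)) with ((om x0 y0, (- la x0 y0)%R) : C); ring|].
    replace ((om x0 y0, (- la x0 y0)%R) * (om x0 y0, la x0 y0))%C with (RtoC r * RtoC r)%C; [ring [Hri]|].
    rewrite <- RtoC_mult, <- Hr0; apply Ceq_intro; simpl; unfold Re, Im; simpl; ring. }
  assert (Hh : (h + h = 1)%C) by (unfold h; rewrite <- RtoC_plus; f_equal; lra).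
  rewrite EP, EQ, Hk; unfold null_pair.
  rewrite !(herm_comb_null _ _ _ _ _ _ 1%C HN), !Cmult_conj, !Cplus_conj, !Cminus_conj, !Cmult_conj, !Copp_conj, !Cconj_Ci.
  unfold h, ri; rewrite !Cconj_RtoC; fold h ri.
  set (e0 := e x0 y0) in *; set (e0' := Cconj e0) in *; clearbody h ri e0 e0'.
  split; [|split]; [ring|ring|].
  transitivity (Ci * (h * ri) * ((h + h) * (e0 * e0')))%C; [ring|rewrite Hh, He; ring]. }
assert (Hk : (Ci * RtoC (/ (2 * r)))%C <> 0%C).
{ intros K; apply (f_equal Im) in K; unfold Im in K; simpl in K.
  assert (0 < / (2 * r)) by (apply Rinv_0_lt_compat; lra); lra. }
destruct (null_pair_coordinate _ _ _ Hk HPQ) as (pi & Hpi & Hpnz).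
(* [v] must be real, while [pi (P x y)] is complex. Its real and imaginary parts both satisfy the
   equations expected of [exp (r v)], and one of them is nonzero at the base point. *)
assert (HG : exists g : R -> R -> R, smooth_on U g /\ g x0 y0 <> 0 /\
  forall x y, U x y -> is_rdd (a1 x y) (b1 x y) g x y 0 /\ is_rdd (a2 x y) (b2 x y) g x y (r * g x y)).
{ assert (Sp := coordinate_csmooth pi U P Hpi SP).
  assert (G : forall x y, U x y -> is_dd (a1 x y) (b1 x y) (fun x y => pi (P x y)) x y 0%C /\
    is_dd (a2 x y) (b2 x y) (fun x y => pi (P x y)) x y (RtoC r * pi (P x y))%C).
  { intros x y H; split; (eapply is_dd_eq; [apply coordinate_dd; [exact Hpi|]|]).
    - now apply P1.
    - destruct Hpi as [-> | ->]; reflexivity.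
    - now apply P2.
    - now apply coordinate_cscal. }
  destruct (Req_dec (Re (pi (P x0 y0))) 0) as [K1|K1].
  - exists (fun x y => Im (pi (P x y))); split; [apply Sp|split].
    + intros K2; apply Hpnz; now apply Ceq_intro.
    + intros x y H; destruct (G x y H) as [[_ G1] [_ G2]]; split; [exact G1|].
      eapply is_rdd_eq; [exact G2|unfold Im; simpl; ring].
  - exists (fun x y => Re (pi (P x y))); split; [apply Sp|split; [exact K1|]].
    intros x y H; destruct (G x y H) as [[G1 _] [G2 _]]; split; [exact G1|].
    eapply is_rdd_eq; [exact G2|unfold Re; simpl; ring]. }
destruct HG as (g & Sg & Hg0 & Hg).
set (g0 := g x0 y0) in *.
assert (Hloc : locally_2d (fun x y => 0 < g x y / g0) x0 y0).
{ apply continuity_2d_pt_pos.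
  - apply (smooth_cont U (fun x y => g x y / g0)); [|exact U0].
    apply (smooth_mult U HUo g (fun _ _ => / g0)); [exact Sg|now apply smooth_const].
  - fold g0; unfold Rdiv; rewrite Rinv_r by exact Hg0; lra. }
destruct (box_shrink x0 y0 d1 _ (proj1 Hd1) Hloc) as (d2 & Hd2 & Hpos2).
assert (HU2 : forall x y, box x0 y0 d2 x y -> U x y) by (intros x y; apply box_incl; lra).
(* Division by [g0] makes the argument of the logarithm positive near the base point and gives [v]
   the value 0 there, so the base values of [P] and [Q] form the null pair of the normal form. *)
set (v := fun x y => ln (g x y / g0) * / r).
assert (vdd : forall x y a b l, box x0 y0 d2 x y -> is_rdd a b g x y (l * r * g x y) -> is_rdd a b v x y l).
{ intros x y a b l H K; assert (Hp := Hpos2 x y H); eapply is_rdd_eq.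
  - apply (is_rdd_mult _ _ (fun x y => ln (g x y / g0)) (fun _ _ => / r)); [|apply is_rdd_const].
    apply (is_rdd_comp _ _ ln (fun x y => g x y / g0)); [apply is_derive_ln; exact Hp|].
    apply (is_rdd_mult _ _ g (fun _ _ => / g0)); [exact K|apply is_rdd_const].
  - assert (Hgn : g x y <> 0) by (intros K'; rewrite K' in Hp; unfold Rdiv in Hp; lra).
    assert (Hrn : r <> 0) by lra; cbv beta; field; auto. }
assert (v1 : forall x y, box x0 y0 d2 x y -> is_rdd (a1 x y) (b1 x y) v x y 0).
{ intros x y H; apply vdd; [exact H|]; destruct (Hg x y (HU2 x y H)) as [G1 _].
  eapply is_rdd_eq; [exact G1|ring]. }
assert (v2 : forall x y, box x0 y0 d2 x y -> is_rdd (a2 x y) (b2 x y) v x y 1).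
{ intros x y H; apply vdd; [exact H|]; destruct (Hg x y (HU2 x y H)) as [_ G2].
  eapply is_rdd_eq; [exact G2|ring]. }
assert (vv0 : v x0 y0 = 0).
{ unfold v; fold g0; unfold Rdiv; rewrite Rinv_r, ln_1 by exact Hg0; ring. }
assert (Hexp : forall s G, (forall x y, U x y -> is_dd2 (a1 x y) (b1 x y) G x y (RtoC 0, RtoC 0)) ->
  (forall x y, U x y -> is_dd2 (a2 x y) (b2 x y) G x y (cscal (RtoC s) (G x y))) ->
  forall x y, box x0 y0 d2 x y -> G x y = cscal (RtoC (exp (s * v x y))) (G x0 y0)).
{ intros s G G1 G2.
  assert (K : forall x y, box x0 y0 d2 x y ->
    cscal (RtoC (exp (- s * v x y))) (G x y) = cscal (RtoC (exp (- s * v x0 y0))) (G x0 y0)).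
  { apply const2; [lra| |]; intros x y H.
    - eapply is_dd2_eq; [apply is_dd2_cscal; [apply (is_dd_exp _ _ (fun x y => - s * v x y)), (is_rdd_mult _ _ (fun _ _ => - s)); [apply is_rdd_const|apply v1, H]|apply G1; auto]|].
      rewrite combE, Rmult_0_l, Rmult_0_r, Rplus_0_l; apply injective_projections; cbn [fst snd]; ring.
    - eapply is_dd2_eq; [apply is_dd2_cscal; [apply (is_dd_exp _ _ (fun x y => - s * v x y)), (is_rdd_mult _ _ (fun _ _ => - s)); [apply is_rdd_const|apply v2, H]|apply G2; auto]|].
      rewrite combE, Rmult_0_l, Rmult_1_r, Rplus_0_l, RtoC_opp, cscalE; apply injective_projections; cbn [fst snd]; ring. }
  intros x y H; specialize (K x y H); rewrite vv0, Rmult_0_r, exp_0 in K.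
  transitivity (cscal (RtoC (exp (s * v x y))) (cscal (RtoC (exp (- s * v x y))) (G x y))).
  - rewrite !cscalE; cbn [fst snd]; rewrite !Cmult_assoc, <- RtoC_mult, <- exp_plus.
    replace (s * v x y + - s * v x y) with 0 by ring; rewrite exp_0.
    apply injective_projections; cbn [fst snd]; ring.
  - rewrite K, !cscalE; apply injective_projections; cbn [fst snd]; ring. }
set (p := sub2 (F x0 y0) (comb (cis (u x0 y0)) 1%C (S x0 y0) (T x0 y0))).
assert (Hp : forall x y, box x0 y0 d2 x y -> sub2 (F x y) (comb (cis (u x y)) 1%C (S x y) (T x y)) = p).
{ apply const2; [lra| |]; intros x y H; assert (H1 : box x0 y0 d1 x y) by (apply box_incl with (2 := H); lra);
  assert (K := ce x y H1); assert (HUxy : U x y) by auto.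
  - eapply is_dd2_eq; [apply is_dd2_sub2; [apply F1; auto|apply (is_dd2_comb _ _ (fun x y => cis (u x y)) (fun _ _ => 1%C));
      [apply is_dd_cis, u1, H1|apply is_dd_const|apply S1; auto|apply T1; auto]]|].
    unfold S, T; rewrite sub2E, add2E, !combE; apply injective_projections; cbn [fst snd]; ring [Ci2 K].
  - eapply is_dd2_eq; [apply is_dd2_sub2; [apply F2; auto|apply (is_dd2_comb _ _ (fun x y => cis (u x y)) (fun _ _ => 1%C));
      [apply is_dd_cis, u2, H1|apply is_dd_const|apply S2; auto|apply T2; auto]]|].
    (* [r e] is the conjugate of [om + i la]; this cancels the [Z] component of the derivative of
       [e^{iu} S + T] and leaves [W]. *)
    assert (Kc : (RtoC r * e x y = RtoC (om x y) - Ci * RtoC (la x y))%C).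
    { unfold e; transitivity (Cconj (c x y) * (ri * RtoC r))%C; [ring|].
      rewrite Hri; unfold c; apply Ceq_intro; simpl; unfold Re, Im; simpl; ring. }
    unfold S, T; rewrite sub2E, add2E, !cscalE, !combE; apply injective_projections; cbn [fst snd];
    ring [Ci2 K Kc Hri]. }
exists d2, u, v, (P x0 y0), (Q x0 y0), p; split; [lra|]; split; [exact HPQ|].
intros x y H; assert (H1 : box x0 y0 d1 x y) by (apply box_incl with (2 := H); lra).
split; [|auto].
assert (KP := Hexp r P P1 P2 x y H).
assert (KQ := Hexp (- r) Q Q1 (fun x y H => eq_ind_r (fun s => is_dd2 (a2 x y) (b2 x y) Q x y (cscal s (Q x y))) (Q2' x y H) (RtoC_opp r)) x y H).
replace (- r * v x y) with (- (r * v x y)) in KQ by ring.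
assert (Hh : (RtoC (/ 2) + RtoC (/ 2) = 1)%C) by (rewrite <- RtoC_plus; f_equal; lra).
assert (EST : comb (cis (u x y)) 1%C (S x y) (T x y) = comb (cis (u x y) + 1)%C (cis (u x y) - 1)%C (P x y) (Q x y)).
{ unfold P, Q; rewrite comb_comb; f_equal.
  - transitivity (cis (u x y) * (RtoC (/ 2) + RtoC (/ 2)))%C; [rewrite Hh|]; ring.
  - transitivity (RtoC (/ 2) + RtoC (/ 2))%C; [rewrite Hh|]; ring. }
transitivity (add2 p (comb (cis (u x y)) 1%C (S x y) (T x y))).
- rewrite <- (Hp x y H), add2E, sub2E; apply injective_projections; cbn [fst snd]; ring.
- rewrite EST, KP, KQ; f_equal; rewrite !combE, !cscalE; apply injective_projections; cbn [fst snd]; ring.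
Qed.

End Integration.

(** * Local surjectivity *)

(** The increments are dominated by a geometric series, and their partial sums telescope. *)
Lemma geometric_limit (a : nat -> R) c : (forall n, Rabs (a (S n) - a n) <= c * (/ 2) ^ n) ->
  exists l : R, is_lim_seq a l.
Proof.
intros H.
assert (Hs : ex_series (fun n => a (S n) - a n)).
{ apply (ex_series_le (K := R_AbsRing) (V := R_CompleteNormedModule) _ (fun n => c * (/ 2) ^ n)).
  - exact H.
  - apply (ex_series_scal (K := R_AbsRing) (V := R_NormedModule) c (fun n => (/ 2) ^ n)).
    apply ex_series_geom; rewrite Rabs_pos_eq; lra. }
destruct Hs as [l Hl]; exists (l + a 0%nat).
apply is_lim_seq_incr_1.
apply is_lim_seq_ext with (fun n => sum_n (fun n => a (S n) - a n) n + a 0%nat).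
- intros n; induction n as [|n IH].
  + rewrite sum_O; ring.
  + rewrite sum_Sn; unfold plus; simpl; lra.
- apply is_lim_seq_plus'; [exact Hl|apply is_lim_seq_const].
Qed.

(** In the sum norm the map contracts by 1/2 and the first step is at most [d / 4]. The iterates
    stay within [d / 2] of the centre, and so does the limit, which therefore lies in the open
    square. *)
Lemma contraction_fixpoint (f g : R -> R -> R) x0 y0 d : 0 < d ->
  (forall x y x' y', box x0 y0 d x y -> box x0 y0 d x' y' ->
    Rabs (f x y - f x' y') <= / 4 * (Rabs (x - x') + Rabs (y - y')) /\
    Rabs (g x y - g x' y') <= / 4 * (Rabs (x - x') + Rabs (y - y'))) ->
  Rabs (f x0 y0 - x0) <= d / 8 -> Rabs (g x0 y0 - y0) <= d / 8 ->
  exists x y, box x0 y0 d x y /\ f x y = x /\ g x y = y.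
Proof.
intros Hd HL Hf0 Hg0.
set (p := fix p (n : nat) : R * R := match n with O => (x0, y0)
  | S n => (f (fst (p n)) (snd (p n)), g (fst (p n)) (snd (p n))) end).
set (a := fun n => fst (p n)); set (b := fun n => snd (p n)).
assert (aS : forall n, a (S n) = f (a n) (b n)) by reflexivity.
assert (bS : forall n, b (S n) = g (a n) (b n)) by reflexivity.
assert (a0 : a 0%nat = x0) by reflexivity.
assert (b0 : b 0%nat = y0) by reflexivity.
clearbody a b; clear p.
assert (Hq : forall n, 0 < (/ 2) ^ n) by (intros; apply pow_lt; lra).
assert (HI : forall n, Rabs (a n - x0) + Rabs (b n - y0) <= d / 2 * (1 - (/ 2) ^ n) /\
  Rabs (a (S n) - a n) + Rabs (b (S n) - b n) <= d / 4 * (/ 2) ^ n).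
{ induction n as [|n [IH1 IH2]].
  - rewrite aS, bS, a0, b0, !Rminus_diag, Rabs_R0; simpl; lra.
  - assert (Q := Hq n).
    assert (N1 : Rabs (a (S n) - x0) + Rabs (b (S n) - y0) <= d / 2 * (1 - (/ 2) ^ S n)).
    { replace (a (S n) - x0) with ((a (S n) - a n) + (a n - x0)) by ring.
      replace (b (S n) - y0) with ((b (S n) - b n) + (b n - y0)) by ring.
      assert (T1 := Rabs_triang (a (S n) - a n) (a n - x0)).
      assert (T2 := Rabs_triang (b (S n) - b n) (b n - y0)); simpl; lra. }
    split; [exact N1|].
    assert (B1 : box x0 y0 d (a n) (b n)).
    { split; assert (P1 := Rabs_pos (a n - x0)); assert (P2 := Rabs_pos (b n - y0)); nra. }
    assert (B2 : box x0 y0 d (a (S n)) (b (S n))).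
    { assert (Q' := Hq (S n)).
      split; assert (P1 := Rabs_pos (a (S n) - x0)); assert (P2 := Rabs_pos (b (S n) - y0)); nra. }
    destruct (HL _ _ _ _ B2 B1) as [L1 L2].
    rewrite <- !aS in L1; rewrite <- !bS in L2; simpl; lra. }
destruct (geometric_limit a (d / 4)) as [x Hx].
{ intros n; destruct (HI n) as [_ H]; assert (P := Rabs_pos (b (S n) - b n)); lra. }
destruct (geometric_limit b (d / 4)) as [y Hy].
{ intros n; destruct (HI n) as [_ H]; assert (P := Rabs_pos (a (S n) - a n)); lra. }
assert (HB : forall n, Rabs (a n - x0) <= d / 2 /\ Rabs (b n - y0) <= d / 2).
{ intros n; destruct (HI n) as [H _]; assert (Q := Hq n).
  assert (P1 := Rabs_pos (a n - x0)); assert (P2 := Rabs_pos (b n - y0)); nra. }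
assert (HBn : forall n, box x0 y0 d (a n) (b n)) by (intros n; destruct (HB n); split; lra).
assert (Hl : forall (s : nat -> R) (l m : R), is_lim_seq s l -> (forall n, Rabs (s n - m) <= d / 2) -> Rabs (l - m) <= d / 2).
{ intros s l m Hs Hb.
  assert (K := is_lim_seq_abs _ _ (is_lim_seq_minus' _ _ _ _ Hs (is_lim_seq_const m))).
  exact (is_lim_seq_le _ _ (Rabs (l - m)) (d / 2) Hb K (is_lim_seq_const _)). }
assert (HBl : box x0 y0 d x y).
{ split.
  - assert (K := Hl a x x0 Hx (fun n => proj1 (HB n))); lra.
  - assert (K := Hl b y y0 Hy (fun n => proj2 (HB n))); lra. }
assert (Hz : is_lim_seq (fun n => / 4 * (Rabs (a n - x) + Rabs (b n - y))) 0).
{ replace (Finite 0) with (Finite (/ 4 * (Rabs (x - x) + Rabs (y - y)))) by (rewrite !Rminus_diag, Rabs_R0; f_equal; ring).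
  apply (is_lim_seq_scal_l _ (/ 4) (Rabs (x - x) + Rabs (y - y))).
  apply is_lim_seq_plus'.
  - exact (is_lim_seq_abs _ _ (is_lim_seq_minus' _ _ _ _ Hx (is_lim_seq_const x))).
  - exact (is_lim_seq_abs _ _ (is_lim_seq_minus' _ _ _ _ Hy (is_lim_seq_const y))). }
assert (Hfix : forall (h : R -> R -> R) (s : nat -> R) (l : R), is_lim_seq s l -> (forall n, s (S n) = h (a n) (b n)) ->
  (forall n, Rabs (h (a n) (b n) - h x y) <= / 4 * (Rabs (a n - x) + Rabs (b n - y))) -> h x y = l).
{ intros h s l Hs HS Hb.
  assert (K1 : is_lim_seq (fun n => Rabs (h (a n) (b n) - h x y)) 0).
  { apply is_lim_seq_le_le with (fun _ => 0) (fun n => / 4 * (Rabs (a n - x) + Rabs (b n - y))).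
    - intros n; split; [apply Rabs_pos|apply Hb].
    - apply is_lim_seq_const.
    - exact Hz. }
  assert (K2 : is_lim_seq (fun n => s (S n)) l) by now apply is_lim_seq_incr_1 in Hs.
  assert (K3 := is_lim_seq_abs _ _ (is_lim_seq_minus' _ _ _ _ K2 (is_lim_seq_const (h x y)))).
  assert (K4 : is_lim_seq (fun n => Rabs (h (a n) (b n) - h x y)) (Rabs (l - h x y))).
  { apply is_lim_seq_ext with (2 := K3); intros n; now rewrite HS. }
  assert (K5 := is_lim_seq_unique _ _ K1); rewrite (is_lim_seq_unique _ _ K4) in K5.
  injection K5 as K5; destruct (Req_dec (l - h x y) 0) as [|K6]; [lra|]; now apply Rabs_no_R0 in K6. }
exists x, y; split; [exact HBl|split].
- apply (Hfix f a x Hx aS); intros n; now apply HL.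
- apply (Hfix g b y Hy bS); intros n; now apply HL.
Qed.

Lemma mvt_bound (f df : R -> R) k a b :
  (forall t, Rmin a b <= t <= Rmax a b -> is_derive f t (df t) /\ Rabs (df t) <= k) ->
  Rabs (f a - f b) <= k * Rabs (a - b).
Proof.
intros H; destruct (MVT_gen f b a df) as (c & Hc & E).
- intros t Ht; apply H; rewrite Rmin_comm, Rmax_comm; lra.
- intros t Ht; apply derivable_continuous_pt; exists (df t); apply is_derive_Reals, H.
  rewrite Rmin_comm, Rmax_comm; exact Ht.
- rewrite E, Rabs_mult; apply Rmult_le_compat_r; [apply Rabs_pos|].
  apply H; rewrite Rmin_comm, Rmax_comm; exact Hc.
Qed.

Lemma box_between x0 d x x' t : Rabs (x - x0) < d -> Rabs (x' - x0) < d ->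
  Rmin x x' <= t <= Rmax x x' -> Rabs (t - x0) < d.
Proof.
intros H1 H2 [H3 H4]; apply Rabs_def2 in H1; apply Rabs_def2 in H2; apply Rabs_def1;
unfold Rmin, Rmax in *; destruct (Rle_dec x x'); lra.
Qed.

Lemma box_lipschitz x0 y0 d (f f1 f2 : R -> R -> R) k :
  (forall x y, box x0 y0 d x y -> is_derive (fun z => f z y) x (f1 x y) /\
     is_derive (fun z => f x z) y (f2 x y) /\ Rabs (f1 x y) <= k /\ Rabs (f2 x y) <= k) ->
  forall x y x' y', box x0 y0 d x y -> box x0 y0 d x' y' ->
  Rabs (f x y - f x' y') <= k * (Rabs (x - x') + Rabs (y - y')).
Proof.
intros H x y x' y' [Hx Hy] [Hx' Hy'].
replace (f x y - f x' y') with ((f x y - f x' y) + (f x' y - f x' y')) by ring.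
apply Rle_trans with (1 := Rabs_triang _ _); rewrite Rmult_plus_distr_l; apply Rplus_le_compat.
- apply (mvt_bound (fun z => f z y) (fun z => f1 z y)); intros t Ht.
  destruct (H t y) as (D1 & _ & B & _); [|now split].
  split; [now apply box_between with x x'|exact Hy].
- apply (mvt_bound (fun z => f x' z) (fun z => f2 x' z)); intros t Ht.
  destruct (H x' t) as (_ & D2 & _ & B); [|now split].
  split; [exact Hx'|now apply box_between with y y'].
Qed.

(* Newton's iteration with the inverse Jacobian frozen at the centre *)
Lemma local_surjectivity x0 y0 d (u v u1 u2 v1 v2 : R -> R -> R) : 0 < d ->
  (forall x y, box x0 y0 d x y ->
     is_derive (fun z => u z y) x (u1 x y) /\ is_derive (fun z => u x z) y (u2 x y) /\
     is_derive (fun z => v z y) x (v1 x y) /\ is_derive (fun z => v x z) y (v2 x y)) ->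
  continuity_2d_pt u1 x0 y0 -> continuity_2d_pt u2 x0 y0 ->
  continuity_2d_pt v1 x0 y0 -> continuity_2d_pt v2 x0 y0 ->
  u1 x0 y0 * v2 x0 y0 - u2 x0 y0 * v1 x0 y0 <> 0 ->
  exists e, 0 < e /\ forall s t, box (u x0 y0) (v x0 y0) e s t ->
    exists x y, box x0 y0 d x y /\ u x y = s /\ v x y = t.
Proof.
intros Hd HD Cu1 Cu2 Cv1 Cv2 Hdet.
set (D := u1 x0 y0 * v2 x0 y0 - u2 x0 y0 * v1 x0 y0) in *.
set (m11 := v2 x0 y0 / D); set (m12 := - u2 x0 y0 / D);
set (m21 := - v1 x0 y0 / D); set (m22 := u1 x0 y0 / D).
assert (I11 : m11 * u1 x0 y0 + m12 * v1 x0 y0 = 1) by (unfold m11, m12, D; field; exact Hdet).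
assert (I12 : m11 * u2 x0 y0 + m12 * v2 x0 y0 = 0) by (unfold m11, m12, D; field; exact Hdet).
assert (I21 : m21 * u1 x0 y0 + m22 * v1 x0 y0 = 0) by (unfold m21, m22, D; field; exact Hdet).
assert (I22 : m21 * u2 x0 y0 + m22 * v2 x0 y0 = 1) by (unfold m21, m22, D; field; exact Hdet).
assert (Inj : forall a b, m11 * a + m12 * b = 0 -> m21 * a + m22 * b = 0 -> a = 0 /\ b = 0).
{ intros a b A B.
  assert (Ha : a = u1 x0 y0 * (m11 * a + m12 * b) + u2 x0 y0 * (m21 * a + m22 * b)).
  { unfold m11, m12, m21, m22, D; field; exact Hdet. }
  assert (Hb : b = v1 x0 y0 * (m11 * a + m12 * b) + v2 x0 y0 * (m21 * a + m22 * b)).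
  { unfold m11, m12, m21, m22, D; field; exact Hdet. }
  rewrite A, B in Ha, Hb; lra. }
clearbody m11 m12 m21 m22.
(* Identity minus frozen inverse times Jacobian is the derivative of the Newton map; it vanishes at
   the centre, so nearby its entries are below the 1/4 that [contraction_fixpoint] asks for. *)
assert (small : forall m n (p q : R -> R -> R) c, continuity_2d_pt p x0 y0 -> continuity_2d_pt q x0 y0 ->
  m * p x0 y0 + n * q x0 y0 = c -> locally_2d (fun x y => Rabs (c - (m * p x y + n * q x y)) <= / 4) x0 y0).
{ intros m n p q c Cp Cq E.
  assert (K : continuity_2d_pt (fun x y => m * p x y + n * q x y) x0 y0).
  { apply (continuity_2d_pt_plus (fun x y => m * p x y) (fun x y => n * q x y));
    apply (continuity_2d_pt_mult (fun _ _ => _)); auto using continuity_2d_pt_const. }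
  assert (H4 : 0 < / 4) by lra; specialize (K (mkposreal _ H4)); simpl in K.
  apply locally_2d_impl with (2 := K), locally_2d_forall; intros x y H.
  rewrite E, Rabs_minus_sym in H; lra. }
destruct (box_shrink x0 y0 d _ Hd
  (locally_2d_and _ _ _ _ (locally_2d_and _ _ _ _ (small _ _ _ _ _ Cu1 Cv1 I11) (small _ _ _ _ _ Cu2 Cv2 I12))
    (locally_2d_and _ _ _ _ (small _ _ _ _ _ Cu1 Cv1 I21) (small _ _ _ _ _ Cu2 Cv2 I22)))) as (d' & Hd' & HB).
(* [k] exceeds both row sums of the inverse Jacobian, so a target within [d' / 8 / k] moves the
   centre by at most [d' / 8] in each coordinate. *)
set (k := 1 + Rabs m11 + Rabs m12 + Rabs m21 + Rabs m22).
assert (P1 := Rabs_pos m11); assert (P2 := Rabs_pos m12); assert (P3 := Rabs_pos m21); assert (P4 := Rabs_pos m22).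
assert (Hk : 0 < k) by (unfold k; lra).
exists (d' / 8 / k); split; [apply Rdiv_lt_0_compat; lra|].
intros s t [Hs Ht].
set (e := d' / 8 / k) in *.
assert (He : e * k = d' / 8) by (unfold e; field; lra).
assert (He0 : 0 < e) by (unfold e; apply Rdiv_lt_0_compat; lra).
destruct (contraction_fixpoint (fun x y => x - (m11 * (u x y - s) + m12 * (v x y - t)))
  (fun x y => y - (m21 * (u x y - s) + m22 * (v x y - t))) x0 y0 d' (proj1 Hd')) as (x & y & Hxy & Ex & Ey).
- assert (Dlin : forall (f p q : R -> R) z df dp dq m n, is_derive f z df -> is_derive p z dp -> is_derive q z dq ->
    is_derive (fun z => f z - (m * (p z - s) + n * (q z - t))) z (df - (m * dp + n * dq))).
  { intros f p q z df dp dq m n Hf Hp Hq; auto_derive.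
    - split; [now exists df|split; [now exists dp|split; [now exists dq|exact I]]].
    - replace (Derive (fun x => f x) z) with df by (symmetry; now apply is_derive_unique).
      replace (Derive (fun x => p x) z) with dp by (symmetry; now apply is_derive_unique).
      replace (Derive (fun x => q x) z) with dq by (symmetry; now apply is_derive_unique).
      ring. }
  intros x y x' y' H H'; split.
  + apply (box_lipschitz x0 y0 d' (fun x y => x - (m11 * (u x y - s) + m12 * (v x y - t))) (fun x y => 1 - (m11 * u1 x y + m12 * v1 x y))
      (fun x y => 0 - (m11 * u2 x y + m12 * v2 x y))); auto.
    clear x y x' y' H H'; intros x y H; destruct (HD x y) as (A1 & A2 & A3 & A4); [now apply box_incl with d'|].
    split; [|split; [|split]]; try apply HB, H.
    * apply Dlin; auto; exact (is_derive_id (K := R_AbsRing) x).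
    * apply (Dlin (fun _ => x)); auto; exact (is_derive_const (K := R_AbsRing) (V := R_NormedModule) x y).
  + apply (box_lipschitz x0 y0 d' (fun x y => y - (m21 * (u x y - s) + m22 * (v x y - t))) (fun x y => 0 - (m21 * u1 x y + m22 * v1 x y))
      (fun x y => 1 - (m21 * u2 x y + m22 * v2 x y))); auto.
    clear x y x' y' H H'; intros x y H; destruct (HD x y) as (A1 & A2 & A3 & A4); [now apply box_incl with d'|].
    split; [|split; [|split]]; try apply HB, H.
    * apply (Dlin (fun _ => y)); auto; exact (is_derive_const (K := R_AbsRing) (V := R_NormedModule) y x).
    * apply Dlin; auto; exact (is_derive_id (K := R_AbsRing) y).
- rewrite Rabs_minus_sym in Hs; rewrite Rabs_minus_sym in Ht.
  replace (x0 - _ - x0) with (- (m11 * (u x0 y0 - s) + m12 * (v x0 y0 - t))) by ring.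
  rewrite Rabs_Ropp; apply Rle_trans with (1 := Rabs_triang _ _); rewrite !Rabs_mult, <- He.
  apply Rle_trans with (Rabs m11 * e + Rabs m12 * e); [|unfold k; nra].
  apply Rplus_le_compat; apply Rmult_le_compat_l; lra.
- rewrite Rabs_minus_sym in Hs; rewrite Rabs_minus_sym in Ht.
  replace (y0 - _ - y0) with (- (m21 * (u x0 y0 - s) + m22 * (v x0 y0 - t))) by ring.
  rewrite Rabs_Ropp; apply Rle_trans with (1 := Rabs_triang _ _); rewrite !Rabs_mult, <- He.
  apply Rle_trans with (Rabs m21 * e + Rabs m22 * e); [|unfold k; nra].
  apply Rplus_le_compat; apply Rmult_le_compat_l; lra.
- exists x, y; split; [now apply box_incl with (2 := Hxy)|].
  destruct (Inj (u x y - s) (v x y - t)); lra.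
Qed.

(** * Existence of a normalised null frame *)

Lemma zero2E : zero2 = (RtoC 0, RtoC 0).
Proof. reflexivity. Qed.

Lemma dd2_dF a b F x y : dd2 a b F x y = dF F (x, y) (a, b).
Proof. reflexivity. Qed.

Lemma ambient_dd2 F x y a b a' b' :
  ambient_deriv F (x, y) (a, b) (a', b') = dd2 a b (fun x y => dd2 a' b' F x y) x y.
Proof. reflexivity. Qed.

(** [J z] is normal, and [metric (J z) w] is [- Im (herm z w)]. *)
Lemma lagrangian_herm F p z w : lagrangian_at F p -> tangent F p z -> tangent F p w -> Im (herm z w) = 0.
Proof.
intros HL Hz Hw; destruct (HL z) as [[H _] _]; specialize (H Hz w Hw).
rewrite metric_herm in H; unfold J in H.
replace (herm (cscal Ci z) w) with (Ci * herm z w)%C in H.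
- unfold Re, Im in *; simpl in H; simpl; lra.
- rewrite cscalE; unfold herm; cbn [fst snd]; ring.
Qed.

Lemma tangent_dd2 F x y a b : tangent F (x, y) (dd2 a b F x y).
Proof. now exists (a, b). Qed.

Lemma dd2_linear F x y a b : dd2 a b F x y = comb (RtoC a) (RtoC b) (dd2 1 0 F x y) (dd2 0 1 F x y).
Proof. rewrite <- dd2_combination; f_equal; ring. Qed.

(** A change of basis multiplies the Gram determinant by the square of its own determinant. This
    yields the sign of [gdet] and the independence of the two null directions. *)
Lemma gram F x y a b c e :
  metric (dd2 a b F x y) (dd2 a b F x y) * metric (dd2 c e F x y) (dd2 c e F x y)
  - metric (dd2 a b F x y) (dd2 c e F x y) * metric (dd2 a b F x y) (dd2 c e F x y)
  = (a * e - c * b) * (a * e - c * b) * gdet F (x, y).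
Proof.
assert (E : forall a b c e, metric (dd2 a b F x y) (dd2 c e F x y) =
  a * c * gE F (x, y) + (a * e + b * c) * gF F (x, y) + b * e * gG F (x, y)).
{ clear; intros a b c e; rewrite !dd2_dF; unfold dF; cbn [fst snd].
  rewrite metric_addl, !metric_scall, !(metricC _ (add2 _ _)), !metric_addl,
    !metric_scall, (metricC (pd2 F _ _) (pd1 F _ _)).
  unfold gE, gF, gG; cbn [fst snd]; ring. }
rewrite !E; unfold gdet; ring.
Qed.

Lemma lorentzian_gdet_neg F x y : lorentzian_at F (x, y) -> gdet F (x, y) < 0.
Proof.
intros (z & w & [[a b] ->] & [[c e] ->] & Hz & Hw & Hzw).
assert (G := gram F x y a b c e); rewrite !dd2_dF, Hz, Hw, Hzw in G.
set (k := a * e - c * b) in G; assert (0 <= k * k) by nra.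
destruct (Rlt_le_dec (gdet F (x, y)) 0); [assumption|nra].
Qed.

(** Pairing the linear relation with the null vector [z] kills the [J z] term, and the coefficient
    [s] of [h] is nonzero because [J z] is. The tangential part does not affect the imaginary
    part. *)
Lemma type2_cubic F x y a b : lagrangian_at F (x, y) -> type2_at F (x, y) ->
  dd2 a b F x y <> zero2 -> herm (dd2 a b F x y) (dd2 a b F x y) = 0%C ->
  Im (herm (ambient_deriv F (x, y) (a, b) (a, b)) (dd2 a b F x y)) = 0.
Proof.
intros HL H2 Hnz H0.
destruct (H2 (a, b)) as (s & t & Hst & E).
{ split; [exact Hnz|]; rewrite metric_herm; change (dF F (x, y) (a, b)) with (dd2 a b F x y); now rewrite H0. }
unfold sff, normal_part in E.
assert (HT := lagrangian_herm F (x, y) _ _ HL (tangential_part_tangent F (x, y) (ambient_deriv F (x, y) (a, b) (a, b))) (tangent_dd2 F x y a b)).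
set (T := tangential_part _ _ _) in *; set (V := ambient_deriv _ _ _ _) in *.
change (dF F (x, y) (a, b)) with (dd2 a b F x y) in E; set (z := dd2 a b F x y) in *.
clearbody T V z; rewrite !rscalE in E; unfold J in E.
destruct (Req_dec s 0) as [Hs|Hs].
- exfalso; subst s; assert (Ht : t <> 0) by (intros ->; now apply Hst).
  apply Hnz; unfold zero2.
  transitivity (cscal (- Ci * RtoC (/ t))%C (add2 (cscal (RtoC 0) (sub2 V T)) (cscal (RtoC t) (cscal Ci z)))).
  + rewrite add2E, !cscalE; cbn [fst snd].
    assert (K : (RtoC (/ t) * RtoC t = 1)%C) by (rewrite <- RtoC_mult, Rinv_l by exact Ht; reflexivity).
    apply injective_projections; cbn [fst snd]; ring [Ci2 K].
  + rewrite E; exact (scal_zero_r (V := prod_ModuleSpace C_Ring C_ModuleSpace C_ModuleSpace) _).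
- apply (f_equal (fun v => Im (herm v z))) in E.
  replace (herm (add2 (cscal (RtoC s) (sub2 V T)) (cscal (RtoC t) (cscal Ci z))) z)
    with (RtoC s * (herm V z - herm T z) + RtoC t * (Ci * herm z z))%C in E.
  + rewrite H0 in E.
    assert (E0 : herm zero2 z = 0%C) by (unfold herm, zero2, zero; simpl; unfold zero; simpl; ring).
    rewrite E0 in E; set (hv := herm V z) in *; set (ht := herm T z) in *; clearbody hv ht.
    clear - E HT Hs; destruct hv, ht; unfold Im in *; simpl in *; subst.
    apply Rmult_eq_reg_l with s; [|exact Hs]; lra.
  + rewrite add2E, !cscalE, sub2E; unfold herm; cbn [fst snd]; ring.
Qed.

Lemma smooth_on_sub U V f : (forall x y, V x y -> U x y) -> smooth_on U f -> smooth_on V f.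
Proof. intros H Hf x y Hxy; apply Hf, H, Hxy. Qed.

Lemma csmooth2_sub U V F : (forall x y, V x y -> U x y) -> csmooth2 U F -> csmooth2 V F.
Proof. intros H [[H1 H2] [H3 H4]]; split; split; apply smooth_on_sub with U; assumption. Qed.

(** By the product rule variable coefficients add only a tangent vector, so they do not change the
    cubic form. *)
Lemma dd2_field U a b c e F x y : open2 U -> smooth_on U c -> smooth_on U e -> csmooth2 U F -> U x y ->
  dd2 a b (fun x y => dd2 (c x y) (e x y) F x y) x y =
  add2 (dd2 (rdd a b c x y) (rdd a b e x y) F x y)
       (dd2 a b (fun x' y' => dd2 (c x y) (e x y) F x' y') x y).
Proof.
intros HU Hc He HF Hxy.
assert (S1 : csmooth2 U (fun x y => dd2 1 0 F x y)).
{ apply (csmooth2_dd2 U (fun _ _ => 1) (fun _ _ => 0)); auto; apply smooth_const; exact HU. }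
assert (S2 : csmooth2 U (fun x y => dd2 0 1 F x y)).
{ apply (csmooth2_dd2 U (fun _ _ => 0) (fun _ _ => 1)); auto; apply smooth_const; exact HU. }
assert (D1 := is_dd2_csmooth U a b _ x y S1 Hxy); assert (D2 := is_dd2_csmooth U a b _ x y S2 Hxy).
set (X1 := dd2 a b (fun x y => dd2 1 0 F x y) x y) in *.
set (X2 := dd2 a b (fun x y => dd2 0 1 F x y) x y) in *.
assert (E1 : dd2 a b (fun x y => dd2 (c x y) (e x y) F x y) x y =
  add2 (comb (RtoC (rdd a b c x y)) (RtoC (rdd a b e x y)) (dd2 1 0 F x y) (dd2 0 1 F x y))
    (comb (RtoC (c x y)) (RtoC (e x y)) X1 X2)).
{ apply is_dd2_unique, is_dd2_ext with (fun x y => comb (RtoC (c x y)) (RtoC (e x y)) (dd2 1 0 F x y) (dd2 0 1 F x y)).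
  - apply locally_2d_forall; intros u v; symmetry; apply dd2_linear.
  - apply (is_dd2_comb a b (fun x y => RtoC (c x y)) (fun x y => RtoC (e x y)) (fun x y => dd2 1 0 F x y) (fun x y => dd2 0 1 F x y)).
    + apply is_dd_RtoC, (is_rdd_smooth U); assumption.
    + apply is_dd_RtoC, (is_rdd_smooth U); assumption.
    + exact D1.
    + exact D2. }
assert (E2 : dd2 a b (fun x' y' => dd2 (c x y) (e x y) F x' y') x y = comb (RtoC (c x y)) (RtoC (e x y)) X1 X2).
{ apply is_dd2_unique, is_dd2_ext with (fun x' y' => comb (RtoC (c x y)) (RtoC (e x y)) (dd2 1 0 F x' y') (dd2 0 1 F x' y')).
  - apply locally_2d_forall; intros u v; symmetry; apply dd2_linear.
  - apply is_dd2_comb_const; assumption. }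
rewrite E1, E2, (dd2_linear F x y (rdd a b c x y)); reflexivity.
Qed.

(* The cubic form [<h(p, q), J r>], read off without projecting to the normal plane. *)
Definition cubic (F : R -> R -> C2) (x y : R) (p q r : R * R) : R :=
  Im (herm (dd2 (fst p) (snd p) (fun x y => dd2 (fst q) (snd q) F x y) x y) (dd2 (fst r) (snd r) F x y)).

Definition lincomb (s t : R) (p q : R * R) : R * R := (s * fst p + t * fst q, s * snd p + t * snd q).

Lemma cubic_lin1 F x y s t p p' q r :
  cubic F x y (lincomb s t p p') q r = s * cubic F x y p q r + t * cubic F x y p' q r.
Proof.
unfold cubic, lincomb; cbn [fst snd]; rewrite dd2_combination, herm_comb_l; unfold Im; simpl; ring.
Qed.

Lemma cubic_lin3 F x y s t p q r r' :
  cubic F x y p q (lincomb s t r r') = s * cubic F x y p q r + t * cubic F x y p q r'.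
Proof.
unfold cubic, lincomb; cbn [fst snd]; rewrite dd2_combination, herm_comb_r, !Cconj_RtoC; unfold Im; simpl; ring.
Qed.

Lemma lincomb_basis p q r : fst p * snd q - fst q * snd p <> 0 -> exists s t, r = lincomb s t p q.
Proof.
intros H; exists ((fst r * snd q - snd r * fst q) / (fst p * snd q - fst q * snd p)),
  ((snd r * fst p - fst r * snd p) / (fst p * snd q - fst q * snd p)).
unfold lincomb; destruct r; cbn [fst snd]; f_equal; field; exact H.
Qed.

Section Cubic.

Variables (U : R -> R -> Prop) (F : R -> R -> C2).
Hypothesis HU : open2 U.
Hypothesis HF : csmooth2 U F.
Hypothesis HL : forall x y, U x y -> lagrangian_at F (x, y).

Let sF a b : csmooth2 U (fun x y => dd2 a b F x y).
Proof. apply (csmooth2_dd2 U (fun _ _ => a) (fun _ _ => b)); auto; apply smooth_const; exact HU. Qed.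

Lemma cubic_sym12 x y p q r : U x y -> cubic F x y p q r = cubic F x y q p r.
Proof.
intros Hxy; unfold cubic; f_equal; f_equal.
assert (T := dd2_commutator U (fun _ _ => fst p) (fun _ _ => snd p) (fun _ _ => fst q) (fun _ _ => snd q) F x y HU
  (smooth_const U HU _) (smooth_const U HU _) (smooth_const U HU _) (smooth_const U HU _) HF Hxy).
cbv beta in T.
assert (Z : forall a b c, rdd a b (fun _ _ => c) x y = 0) by (intros; apply is_rdd_unique, is_rdd_const).
rewrite !Z, Rminus_0_r, (dd2_linear F x y 0 0), comb_zero, sub2E in T.
apply injective_projections; apply Ceq_minus; [exact (f_equal fst T)|exact (f_equal snd T)].
Qed.

(** The Lagrangian condition [Im (herm v w) = 0] for tangent fields is differentiated along [p];
    exchanging the arguments of [herm] conjugates it and supplies the minus sign. *)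
Lemma cubic_sym23 x y p q r : U x y -> cubic F x y p q r = cubic F x y p r q.
Proof.
intros Hxy.
assert (D := is_dd_herm (fst p) (snd p) _ _ x y _ _ (is_dd2_csmooth U (fst p) (snd p) _ x y (sF (fst q) (snd q)) Hxy)
  (is_dd2_csmooth U (fst p) (snd p) _ x y (sF (fst r) (snd r)) Hxy)).
destruct D as [_ D].
assert (D0 := is_rdd_unique _ _ _ _ _ _ D).
assert (D1 : rdd (fst p) (snd p) (fun x y => Im (herm (dd2 (fst q) (snd q) F x y) (dd2 (fst r) (snd r) F x y))) x y = 0).
{ apply is_rdd_unique, is_rdd_ext with (fun _ _ => 0); [|apply is_rdd_const].
  apply locally_2d_impl with (2 := HU x y Hxy), locally_2d_forall; intros u v Huv; symmetry.
  apply (lagrangian_herm F (u, v)); auto using tangent_dd2. }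
rewrite D1, (herm_conj (dd2 (fst p) (snd p) (fun x y => dd2 (fst r) (snd r) F x y) x y)) in D0.
unfold cubic; unfold Im in *; simpl in D0; simpl; lra.
Qed.

(** Total symmetry leaves a cubic form on the plane four values on a basis. For null [p] and [q],
    Type 2 supplies the first and the last. *)
Lemma cubic_zero x y p q : U x y -> fst p * snd q - fst q * snd p <> 0 ->
  cubic F x y p p p = 0 -> cubic F x y p p q = 0 -> cubic F x y p q q = 0 -> cubic F x y q q q = 0 ->
  forall a b c, cubic F x y a b c = 0.
Proof.
intros Hxy Hd H1 H2 H3 H4.
assert (Kpp : forall c, cubic F x y p p c = 0).
{ intros c; destruct (lincomb_basis p q c Hd) as (s & t & ->); rewrite cubic_lin3, H1, H2; ring. }
assert (Kpq : forall c, cubic F x y p q c = 0).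
{ intros c; destruct (lincomb_basis p q c Hd) as (s & t & ->).
  rewrite cubic_lin3, H3, (cubic_sym23 x y p q p Hxy), H2; ring. }
assert (Kqq : forall c, cubic F x y q q c = 0).
{ intros c; destruct (lincomb_basis p q c Hd) as (s & t & ->).
  rewrite cubic_lin3, H4, (cubic_sym23 x y q q p Hxy), (cubic_sym12 x y q p q Hxy), H3; ring. }
assert (Kp : forall b c, cubic F x y p b c = 0).
{ intros b c; rewrite (cubic_sym12 x y p b c Hxy); destruct (lincomb_basis p q b Hd) as (s & t & ->).
  rewrite cubic_lin1, Kpp, (cubic_sym12 x y q p c Hxy), Kpq; ring. }
assert (Kq : forall b c, cubic F x y q b c = 0).
{ intros b c; rewrite (cubic_sym12 x y q b c Hxy); destruct (lincomb_basis p q b Hd) as (s & t & ->).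
  rewrite cubic_lin1, Kpq, Kqq; ring. }
intros a b c; destruct (lincomb_basis p q a Hd) as (s & t & ->); rewrite cubic_lin1, Kp, Kq; ring.
Qed.

(** Against tangent vectors a value of [h] has zero real part of [herm], being normal, and the cubic
    form as imaginary part. If the latter vanishes, [h] is orthogonal to a complex basis, hence
    zero. *)
Lemma cubic_zero_minimal x y p q (k : C) : U x y -> gdet F (x, y) <> 0 -> k <> 0%C ->
  null_pair (dd2 (fst p) (snd p) F x y) (dd2 (fst q) (snd q) F x y) k ->
  (forall a b c, cubic F x y a b c = 0) -> trace_sff F (x, y) = zero2.
Proof.
intros Hxy Hg Hk HP H0.
assert (HS : forall a b, sff F (x, y) a b = zero2).
{ intros a b.
  set (N := sff F (x, y) a b).
  assert (K : forall r, herm N (dd2 (fst r) (snd r) F x y) = herm zero2 (dd2 (fst r) (snd r) F x y)).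
  { intros r.
    assert (HN := normal_part_normal F (x, y) (ambient_deriv F (x, y) a b) Hg _ (tangent_dd2 F x y (fst r) (snd r))).
    fold (sff F (x, y) a b) in HN; fold N in HN; rewrite metric_herm in HN.
    assert (HT := lagrangian_herm F (x, y) _ _ (HL x y Hxy)
      (tangential_part_tangent F (x, y) (ambient_deriv F (x, y) a b)) (tangent_dd2 F x y (fst r) (snd r))).
    assert (HC := H0 a b r); unfold cubic in HC.
    rewrite <- ambient_dd2, <- !surjective_pairing in HC.
    set (z := dd2 (fst r) (snd r) F x y) in *.
    transitivity 0%C; [|unfold herm, zero2, zero; simpl; unfold zero; simpl; ring].
    apply Ceq_intro; [exact HN|].
    unfold N, sff, normal_part.
    replace (herm (sub2 _ _) z) with (herm (ambient_deriv F (x, y) a b) z -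
      herm (tangential_part F (x, y) (ambient_deriv F (x, y) a b)) z)%C by (rewrite sub2E; unfold herm; cbn [fst snd]; ring).
    set (hv := herm (ambient_deriv F (x, y) a b) z) in *; set (ht := herm (tangential_part F (x, y) (ambient_deriv F (x, y) a b)) z) in *; clearbody hv ht.
    clear - HC HT; destruct hv, ht; unfold Im in *; simpl in *; lra. }
  exact (null_pair_ext _ _ k N zero2 Hk HP (K p) (K q)). }
unfold trace_sff; rewrite !HS, !rscalE, !add2E, sub2E, !cscalE, zero2E.
apply injective_projections; cbn [fst snd]; ring.
Qed.

End Cubic.

Lemma herm_add2_l u v w : herm (add2 u v) w = (herm u w + herm v w)%C.
Proof. rewrite add2E; unfold herm; cbn [fst snd]; ring. Qed.

Section Frame.

Variables (U : R -> R -> Prop) (F : R -> R -> C2).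
Hypothesis HU : open2 U.
Hypothesis HF : csmooth2 U F.
Hypothesis HL : forall x y, U x y -> lagrangian_at F (x, y).
Hypothesis HT : forall x y, U x y -> type2_at F (x, y).

Lemma field_cubic c e a b f g x y : smooth_on U c -> smooth_on U e -> U x y ->
  Im (herm (dd2 a b (fun x y => dd2 (c x y) (e x y) F x y) x y) (dd2 f g F x y)) =
  cubic F x y (a, b) (c x y, e x y) (f, g).
Proof.
intros Hc He Hxy; rewrite (dd2_field U a b c e F x y HU Hc He HF Hxy).
assert (K := lagrangian_herm F (x, y) _ _ (HL x y Hxy)
  (tangent_dd2 F x y (rdd a b c x y) (rdd a b e x y)) (tangent_dd2 F x y f g)).
unfold cubic; cbn [fst snd].
rewrite herm_add2_l, im_plus, K; apply Rplus_0_l.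
Qed.

Lemma null_cubic x y p : U x y -> dd2 (fst p) (snd p) F x y <> zero2 ->
  herm (dd2 (fst p) (snd p) F x y) (dd2 (fst p) (snd p) F x y) = 0%C -> cubic F x y p p p = 0.
Proof. intros Hxy H1 H2; exact (type2_cubic F x y (fst p) (snd p) (HL x y Hxy) (HT x y Hxy) H1 H2). Qed.

End Frame.

Lemma herm_zero_l z : herm zero2 z = 0%C.
Proof. rewrite zero2E; unfold herm; cbn [fst snd]; ring. Qed.

Lemma null_pair_nonzero z w (k : C) : k <> 0%C -> null_pair z w k -> z <> zero2.
Proof. intros Hk (_ & _ & H) E; apply Hk; rewrite <- H, E; apply herm_zero_l. Qed.

Section NormalizedFrame.

Variables (U : R -> R -> Prop) (F : R -> R -> C2).
Hypothesis HU : open2 U.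
Hypothesis HF : csmooth2 U F.
Hypothesis HL : forall x y, U x y -> lagrangian_at F (x, y).
Hypothesis HT : forall x y, U x y -> type2_at F (x, y).

Lemma normalized_frame a1 b1 a2 b2 ka x0 y0 :
  smooth_on U a1 -> smooth_on U b1 -> smooth_on U a2 -> smooth_on U b2 -> smooth_on U ka ->
  (forall x y, U x y -> ka x y <> 0) ->
  (forall x y, U x y -> null_pair (dd2 (a1 x y) (b1 x y) F x y) (dd2 (a2 x y) (b2 x y) F x y) (RtoC (ka x y))) ->
  U x0 y0 -> cubic F x0 y0 (a1 x0 y0, b1 x0 y0) (a1 x0 y0, b1 x0 y0) (a2 x0 y0, b2 x0 y0) <> 0 ->
  exists d c1 e1 c2 e2, 0 < d /\ (forall x y, box x0 y0 d x y -> U x y) /\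
    null_frame (box x0 y0 d) F c1 e1 c2 e2.
Proof.
intros S1 S2 S3 S4 Sk Hk HN H0 Hc0.
set (cc := fun x y => Im (herm (dd2 (a1 x y) (b1 x y) (fun x y => dd2 (a1 x y) (b1 x y) F x y) x y)
  (dd2 (a2 x y) (b2 x y) F x y))).
assert (Hcc : forall x y, U x y -> cc x y =
  cubic F x y (a1 x y, b1 x y) (a1 x y, b1 x y) (a2 x y, b2 x y)).
{ intros x y Hxy; now apply (field_cubic U F). }
assert (Scc : smooth_on U cc).
{ apply (csmooth_herm U (fun x y => dd2 (a1 x y) (b1 x y) (fun x y => dd2 (a1 x y) (b1 x y) F x y) x y)
    (fun x y => dd2 (a2 x y) (b2 x y) F x y) HU).
  - apply (csmooth2_dd2 U a1 b1 (fun x y => dd2 (a1 x y) (b1 x y) F x y)); auto; now apply csmooth2_dd2.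
  - now apply csmooth2_dd2. }
assert (Hloc : locally_2d (fun x y => U x y /\ cc x y <> 0) x0 y0).
{ apply locally_2d_and; [now apply HU|apply continuity_2d_pt_neq_0].
  - now apply (smooth_cont U).
  - now rewrite Hcc. }
destruct (box_shrink x0 y0 1 _ Rlt_0_1 Hloc) as (d & Hd & HB).
set (V := box x0 y0 d).
assert (HV : forall x y, V x y -> U x y) by (intros x y H; apply HB, H).
assert (HVo : open2 V) by apply box_open.
assert (sub : forall f, smooth_on U f -> smooth_on V f) by (intros f; now apply smooth_on_sub).
(* [rho] and [sig] solve [rho * sig * ka = 1] and [rho^2 * sig * cc = 1], so both the product of the
   frame and its mixed coefficient become 1. *)
set (rho := fun x y => ka x y * / cc x y).
set (sig := fun x y => cc x y * / (ka x y * ka x y)).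
assert (Srho : smooth_on V rho).
{ apply (smooth_mult V HVo ka (fun x y => / cc x y)); [auto|].
  apply smooth_inv; auto; intros x y H; apply HB, H. }
assert (Ssig : smooth_on V sig).
{ apply (smooth_mult V HVo cc (fun x y => / (ka x y * ka x y))); [auto|].
  apply (smooth_inv V HVo (fun x y => ka x y * ka x y)).
  - intros x y H; apply Rmult_integral_contrapositive; auto.
  - apply smooth_mult; auto. }
assert (sm : forall f g, smooth_on V f -> smooth_on V g -> smooth_on V (fun x y => f x y * g x y)) by (intros; now apply smooth_mult).
exists d, (fun x y => rho x y * a1 x y), (fun x y => rho x y * b1 x y),
  (fun x y => sig x y * a2 x y), (fun x y => sig x y * b2 x y).
split; [apply Hd|split; [exact HV|]].
assert (scal : forall s a b x y, dd2 (s * a) (s * b) F x y = cscal (RtoC s) (dd2 a b F x y)).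
{ intros s a b x y; replace (s * a) with (s * a + 0 * 0) by ring; replace (s * b) with (s * b + 0 * 0) by ring.
  rewrite dd2_combination, combE, cscalE; apply injective_projections; cbn [fst snd]; ring. }
assert (HN' : forall x y, V x y -> null_pair (dd2 (rho x y * a1 x y) (rho x y * b1 x y) F x y)
  (dd2 (sig x y * a2 x y) (sig x y * b2 x y) F x y) 1%C).
{ intros x y H; destruct (HN x y (HV x y H)) as (N1 & N2 & N3); rewrite !scal.
  assert (hs : forall s t z w, herm (cscal (RtoC s) z) (cscal (RtoC t) w) = (RtoC s * RtoC t * herm z w)%C).
  { intros s t z w; rewrite !cscalE; unfold herm; cbn [fst snd]; rewrite !Cmult_conj, !Cconj_RtoC; ring. }
  unfold null_pair; rewrite !hs, N1, N2, N3; split; [ring|split; [ring|]].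
  rewrite <- !RtoC_mult; f_equal; unfold rho, sig; field; split; [apply Hk, HV, H|apply HB, H]. }
assert (S1' := sm _ _ Srho (sub _ S1)); assert (S2' := sm _ _ Srho (sub _ S2)).
assert (S3' := sm _ _ Ssig (sub _ S3)); assert (S4' := sm _ _ Ssig (sub _ S4)).
assert (homog : forall x y s t p q, V x y ->
  cubic F x y (s * fst p, s * snd p) (s * fst p, s * snd p) (t * fst q, t * snd q) = s * s * t * cubic F x y p p q).
{ intros x y s t p q H.
  assert (E : forall s p, (s * fst p, s * snd p) = lincomb s 0 p p).
  { intros; unfold lincomb; f_equal; ring. }
  rewrite !E, cubic_lin1, (cubic_sym12 U F HU HF x y p _ _ (HV x y H)), cubic_lin1, !cubic_lin3; ring. }
assert (HF' : csmooth2 V F) by now apply csmooth2_sub with U.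
assert (HL' : forall x y, V x y -> lagrangian_at F (x, y)) by auto.
assert (HT' : forall x y, V x y -> type2_at F (x, y)) by auto.
constructor; auto.
- intros x y H.
  (* Two null vectors of product 1 have Gram determinant -1, so their coefficient determinant cannot
     vanish. *)
  assert (G := gram F x y (rho x y * a1 x y) (rho x y * b1 x y) (sig x y * a2 x y) (sig x y * b2 x y)).
  destruct (HN' x y H) as (N1 & N2 & N3); rewrite !metric_herm, N1, N2, N3 in G.
  intros K; rewrite K in G; simpl in G; unfold Re in G; simpl in G; lra.
- intros x y H; rewrite (field_cubic V F HVo HF' HL' _ _ _ _ _ _ x y S1' S2' H).
  refine (null_cubic V F HL' HT' x y (_, _) H _ _); cbn [fst snd]; [|apply HN', H].
  apply (null_pair_nonzero _ _ _ C1_nz (HN' x y H)).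
- intros x y H; rewrite (field_cubic V F HVo HF' HL' _ _ _ _ _ _ x y S3' S4' H).
  refine (null_cubic V F HL' HT' x y (_, _) H _ _); cbn [fst snd]; [|apply HN', H].
  apply (null_pair_nonzero _ _ _ (Cconj_neq_0 _ C1_nz) (null_pair_swap _ _ _ (HN' x y H))).
- intros x y H; rewrite (field_cubic V F HVo HF' HL' _ _ _ _ _ _ x y S1' S2' H).
  assert (E := homog x y (rho x y) (sig x y) (a1 x y, b1 x y) (a2 x y, b2 x y) H); cbn [fst snd] in E.
  rewrite E, <- Hcc by auto; unfold rho, sig.
  assert (ka x y <> 0) by (apply Hk, HV, H); assert (cc x y <> 0) by apply HB, H; field; auto.
Qed.

End NormalizedFrame.

Lemma local_null_frame U F x0 y0 : open2 U -> csmooth2 U F ->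
  (forall x y, U x y -> lagrangian_at F (x, y)) -> (forall x y, U x y -> type2_at F (x, y)) ->
  (forall x y, U x y -> lorentzian_at F (x, y)) ->
  U x0 y0 -> trace_sff F (x0, y0) <> zero2 ->
  exists d c1 e1 c2 e2, 0 < d /\ (forall x y, box x0 y0 d x y -> U x y) /\
    null_frame (box x0 y0 d) F c1 e1 c2 e2.
Proof.
intros HU HF HL HT HLo H0 Htr.
set (Xs := fun x y => dd2 1 0 F x y); set (Xt := fun x y => dd2 0 1 F x y).
assert (Ss : csmooth2 U Xs).
{ apply (csmooth2_dd2 U (fun _ _ => 1) (fun _ _ => 0)); auto; apply smooth_const; exact HU. }
assert (St : csmooth2 U Xt).
{ apply (csmooth2_dd2 U (fun _ _ => 0) (fun _ _ => 1)); auto; apply smooth_const; exact HU. }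
set (A := fun x y => Re (herm (Xs x y) (Xs x y))).
set (B := fun x y => Re (herm (Xs x y) (Xt x y))).
set (C := fun x y => Re (herm (Xt x y) (Xt x y))).
assert (SA : smooth_on U A) by (apply (csmooth_herm U Xs Xs); auto).
assert (SB : smooth_on U B) by (apply (csmooth_herm U Xs Xt); auto).
assert (SC : smooth_on U C) by (apply (csmooth_herm U Xt Xt); auto).
assert (hreal : forall x y a b c e, U x y -> herm (dd2 a b F x y) (dd2 c e F x y) =
  RtoC (a * c * A x y + (a * e + b * c) * B x y + b * e * C x y)).
{ intros x y a b c e H.
  assert (R0 : forall a b c e, Im (herm (dd2 a b F x y) (dd2 c e F x y)) = 0).
  { intros; apply (lagrangian_herm F (x, y)); auto using tangent_dd2. }
  assert (Rss : herm (Xs x y) (Xs x y) = RtoC (A x y)) by (apply Ceq_intro; [reflexivity|apply R0]).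
  assert (Rst : herm (Xs x y) (Xt x y) = RtoC (B x y)) by (apply Ceq_intro; [reflexivity|apply R0]).
  assert (Rtt : herm (Xt x y) (Xt x y) = RtoC (C x y)) by (apply Ceq_intro; [reflexivity|apply R0]).
  assert (Rts : herm (Xt x y) (Xs x y) = RtoC (B x y)) by (rewrite herm_conj, Rst; apply Cconj_RtoC).
  rewrite (dd2_linear F x y a b), (dd2_linear F x y c e); fold (Xs x y) (Xt x y).
  rewrite herm_comb_l, !herm_comb_r, Rss, Rst, Rts, Rtt, !Cconj_RtoC, !RtoC_plus, !RtoC_mult, !RtoC_plus, !RtoC_mult; ring. }
assert (HD : forall x y, U x y -> 0 < B x y * B x y - A x y * C x y).
{ intros x y H; assert (Gr := gram F x y 1 0 0 1); assert (Hg := lorentzian_gdet_neg F x y (HLo x y H)).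
  rewrite !metric_herm in Gr; change (A x y * C x y - B x y * B x y = (1 * 1 - 0 * 0) * (1 * 1 - 0 * 0) * gdet F (x, y)) in Gr.
  lra. }
set (D := fun x y => B x y * B x y - A x y * C x y) in *.
assert (SD : smooth_on U D).
{ apply (smooth_minus U HU (fun x y => B x y * B x y) (fun x y => A x y * C x y)); now apply smooth_mult. }
assert (Heps : exists eps, eps * eps = 1 /\ B x0 y0 + eps * sqrt (D x0 y0) <> 0).
{ assert (Hs : 0 < sqrt (D x0 y0)) by (apply sqrt_lt_R0, HD, H0).
  destruct (Rle_dec 0 (B x0 y0)); [exists 1|exists (-1)]; split; lra. }
destruct Heps as (eps & He & Hq0).
(* [q] is a root of [q^2 - 2 B q + A C], so [(1, - A / q)] and [(- C / q, 1)] are null;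
   [eps] selects the root that does not vanish at the base point. *)
set (q := fun x y => B x y + eps * sqrt (D x y)).
assert (Sq : smooth_on U q).
{ apply (smooth_plus U HU B (fun x y => eps * sqrt (D x y))); [exact SB|].
  apply (smooth_mult U HU (fun _ _ => eps) (fun x y => sqrt (D x y))); [now apply smooth_const|].
  apply smooth_sqrt; auto. }
set (V := fun x y => U x y /\ q x y <> 0).
assert (HV : open2 V).
{ intros x y [H1 H2]; apply locally_2d_and; [now apply HU|].
  apply continuity_2d_pt_neq_0; [now apply (smooth_cont U)|exact H2]. }
assert (sub : forall f, smooth_on U f -> smooth_on V f) by (intros f; apply smooth_on_sub; now intros x y []).
assert (HFV : csmooth2 V F) by (apply csmooth2_sub with U; [now intros x y []|exact HF]).
set (m := fun x y => - A x y * / q x y); set (n := fun x y => - C x y * / q x y).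
assert (Si : smooth_on V (fun x y => / q x y)) by (apply smooth_inv; [exact HV|now intros x y []|auto]).
assert (Sm : smooth_on V m).
{ apply (smooth_mult V HV (fun x y => - A x y) (fun x y => / q x y)); [apply smooth_opp; auto|exact Si]. }
assert (Sn : smooth_on V n).
{ apply (smooth_mult V HV (fun x y => - C x y) (fun x y => / q x y)); [apply smooth_opp; auto|exact Si]. }
(* The product of the two null vectors after elimination of [A * C] by the equation of [q]; it is
   nonzero because the tangent plane is nondegenerate. *)
set (ka := fun x y => 2 * D x y * / q x y).
assert (Sk : smooth_on V ka).
{ apply (smooth_mult V HV (fun x y => 2 * D x y) (fun x y => / q x y)); [|exact Si].
  apply (smooth_mult V HV (fun _ _ => 2) D); [now apply smooth_const|auto]. }
assert (S1 : smooth_on V (fun _ _ => 1)) by now apply smooth_const.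
assert (Hk : forall x y, V x y -> ka x y <> 0).
{ intros x y [H1 H2]; assert (K := HD x y H1); unfold ka.
  apply Rmult_integral_contrapositive; split; [apply Rgt_not_eq; change (0 < 2 * D x y); change (0 < D x y) in K; lra|now apply Rinv_neq_0_compat]. }
assert (HN : forall x y, V x y -> null_pair (dd2 1 (m x y) F x y) (dd2 (n x y) 1 F x y) (RtoC (ka x y))).
{ intros x y [H1 H2]; unfold null_pair; rewrite !hreal by exact H1.
  assert (Q : q x y * q x y = 2 * B x y * q x y - A x y * C x y).
  { assert (K := HD x y H1); assert (K2 := sqrt_sqrt (D x y) (Rlt_le _ _ K)).
    unfold q; transitivity (B x y * B x y + 2 * eps * B x y * sqrt (D x y) + (eps * eps) * (sqrt (D x y) * sqrt (D x y))); [ring|].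
    rewrite He, K2; unfold D; ring. }
  assert (QAC : A x y * C x y = 2 * B x y * q x y - q x y * q x y) by lra.
  split; [|split]; f_equal; unfold m, n, ka.
  - transitivity (A x y * (q x y * q x y - 2 * B x y * q x y + A x y * C x y) / (q x y * q x y)); [field; exact H2|].
    rewrite QAC; field; exact H2.
  - transitivity (C x y * (q x y * q x y - 2 * B x y * q x y + A x y * C x y) / (q x y * q x y)); [field; exact H2|].
    rewrite QAC; field; exact H2.
  - unfold D; transitivity ((B x y * q x y * q x y + B x y * (A x y * C x y) - 2 * (A x y * C x y) * q x y) / (q x y * q x y)); [field; exact H2|].
    rewrite QAC; field; exact H2. }
assert (V0 : V x0 y0) by now split.
assert (HLV : forall x y, V x y -> lagrangian_at F (x, y)) by (intros x y []; auto).
assert (HTV : forall x y, V x y -> type2_at F (x, y)) by (intros x y []; auto).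
assert (HNs : forall x y, V x y -> null_pair (dd2 (n x y) 1 F x y) (dd2 1 (m x y) F x y) (RtoC (ka x y))).
{ intros x y H; rewrite <- (Cconj_RtoC (ka x y)); now apply null_pair_swap, HN. }
assert (Hkc : RtoC (ka x0 y0) <> 0%C) by (intros K; apply (Hk x0 y0 V0), RtoC_inj, K).
(* Type 2 kills the two pure coefficients. If both mixed ones vanished too, the point would be
   minimal; otherwise the null direction with a nonzero coefficient is taken as [N1]. *)
destruct (Req_dec (cubic F x0 y0 (1, m x0 y0) (1, m x0 y0) (n x0 y0, 1)) 0) as [K1|K1].
- destruct (Req_dec (cubic F x0 y0 (n x0 y0, 1) (n x0 y0, 1) (1, m x0 y0)) 0) as [K2|K2].
  + exfalso; apply Htr.
    set (p1 := (1, m x0 y0)) in *; set (p2 := (n x0 y0, 1)) in *.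
    assert (Hdet : fst p1 * snd p2 - fst p2 * snd p1 <> 0).
    { destruct (HN x0 y0 V0) as (N1 & N2 & N3).
      assert (Gr := gram F x0 y0 1 (m x0 y0) (n x0 y0) 1); rewrite !metric_herm, N1, N2, N3 in Gr.
      intros K; unfold p1, p2 in K; cbn [fst snd] in K; rewrite K in Gr.
      assert (Hkk := Hk x0 y0 V0); simpl in Gr; nra. }
    refine (cubic_zero_minimal V F HLV x0 y0 p1 p2 _ V0 _ Hkc (HN x0 y0 V0) _).
    * apply Rlt_not_eq, lorentzian_gdet_neg; auto.
    * apply (cubic_zero V F HV HFV HLV x0 y0 p1 p2 V0 Hdet).
      -- apply (null_cubic V F HLV HTV x0 y0 p1 V0); [|apply (HN x0 y0 V0)].
         exact (null_pair_nonzero _ _ _ Hkc (HN x0 y0 V0)).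
      -- exact K1.
      -- rewrite (cubic_sym12 V F HV HFV x0 y0 p1 p2 p2 V0), (cubic_sym23 V F HV HFV HLV x0 y0 p2 p1 p2 V0); exact K2.
      -- apply (null_cubic V F HLV HTV x0 y0 p2 V0); [|apply (HN x0 y0 V0)].
         exact (null_pair_nonzero _ _ _ Hkc (HNs x0 y0 V0)).
  + destruct (normalized_frame V F HV HFV HLV HTV n (fun _ _ => 1) (fun _ _ => 1) m ka x0 y0) as (d & c1 & e1 & c2 & e2 & P1 & P2 & P3); auto.
    exists d, c1, e1, c2, e2; split; [exact P1|split; [|exact P3]]; intros x y H; now destruct (P2 x y H).
- destruct (normalized_frame V F HV HFV HLV HTV (fun _ _ => 1) m n (fun _ _ => 1) ka x0 y0) as (d & c1 & e1 & c2 & e2 & P1 & P2 & P3); auto.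
  exists d, c1, e1, c2, e2; split; [exact P1|split; [|exact P3]]; intros x y H; now destruct (P2 x y H).
Qed.

(** * Local congruence *)

(** The partials are carried as explicit functions because their continuity is needed, both for the
    joint continuity of [u], [v] and for [local_surjectivity]. *)
Definition local_coordinates (x0 y0 d : R) (u v : R -> R -> R) : Prop :=
  exists u1 u2 v1 v2 : R -> R -> R, forall x y, box x0 y0 d x y ->
    (is_derive (fun z => u z y) x (u1 x y) /\ is_derive (fun z => u x z) y (u2 x y) /\
     is_derive (fun z => v z y) x (v1 x y) /\ is_derive (fun z => v x z) y (v2 x y)) /\
    (continuity_2d_pt u1 x y /\ continuity_2d_pt u2 x y /\
     continuity_2d_pt v1 x y /\ continuity_2d_pt v2 x y) /\
    u1 x y * v2 x y - u2 x y * v1 x y <> 0.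

(** Along the frame the Jacobian of [(u, v)] is triangular with diagonal [1], [s]; in the chart it
    is therefore [s / D], with [D] the determinant of the frame. The partials follow by Cramer's
    rule. *)
Lemma frame_coordinates x0 y0 d F a1 b1 a2 b2 d' u v m s : s <> 0 -> d' <= d ->
  null_frame (box x0 y0 d) F a1 b1 a2 b2 -> smooth_on (box x0 y0 d) m ->
  (forall x y, box x0 y0 d' x y ->
    is_rdd (a1 x y) (b1 x y) u x y 1 /\ is_rdd (a2 x y) (b2 x y) u x y (m x y) /\
    is_rdd (a1 x y) (b1 x y) v x y 0 /\ is_rdd (a2 x y) (b2 x y) v x y s) ->
  local_coordinates x0 y0 d' u v.
Proof.
intros Hs Hd NF Sm H.
set (U := box x0 y0 d) in *.
assert (HU : open2 U) by exact (nf_open _ _ _ _ _ _ NF).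
assert (Hdet := nf_det _ _ _ _ _ _ NF).
set (D := fun x y => a1 x y * b2 x y - a2 x y * b1 x y).
assert (SD : smooth_on U D).
{ apply (smooth_minus U HU (fun x y => a1 x y * b2 x y) (fun x y => a2 x y * b1 x y)); apply smooth_mult; apply NF. }
assert (Si : smooth_on U (fun x y => / D x y)) by (apply smooth_inv; auto).
assert (mul : forall f g, smooth_on U f -> smooth_on U g -> smooth_on U (fun x y => f x y * g x y)) by (intros; now apply smooth_mult).
assert (cst : forall c, smooth_on U (fun _ _ => c)) by (intros; now apply smooth_const).
assert (Sa1 := nf_a1 _ _ _ _ _ _ NF); assert (Sb1 := nf_b1 _ _ _ _ _ _ NF).
assert (Sa2 := nf_a2 _ _ _ _ _ _ NF); assert (Sb2 := nf_b2 _ _ _ _ _ _ NF).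
set (u1 := fun x y => (b2 x y - b1 x y * m x y) * / D x y).
set (u2 := fun x y => (a1 x y * m x y - a2 x y) * / D x y).
set (v1 := fun x y => (b1 x y * - s) * / D x y).
set (v2 := fun x y => (a1 x y * s) * / D x y).
exists u1, u2, v1, v2; intros x y Hxy.
assert (HUxy : U x y) by now apply box_incl with d'.
assert (Hxyd : D x y <> 0) by now apply Hdet.
destruct (H x y Hxy) as (H1 & H2 & H3 & H4).
assert (K : forall f l1 l2 c e l, is_rdd (a1 x y) (b1 x y) f x y l1 -> is_rdd (a2 x y) (b2 x y) f x y l2 ->
  ((c * b2 x y - e * a2 x y) * l1 + (e * a1 x y - c * b1 x y) * l2) / D x y = l -> is_rdd c e f x y l).
{ intros f l1 l2 c e l K1 K2 <-; exact (is_rdd_dir _ _ _ _ _ _ _ _ _ c e (Hdet x y HUxy) K1 K2). }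
split; [|split].
- split; [|split; [|split]].
  + assert (G : is_rdd 1 0 u x y (u1 x y)) by (apply (K u _ _ _ _ _ H1 H2); unfold u1; field; exact Hxyd).
    destruct (is_rdd_elim _ _ _ _ _ _ G) as (G1 & _ & G2); now replace (u1 x y) with (partial1 u x y) by lra.
  + assert (G : is_rdd 0 1 u x y (u2 x y)) by (apply (K u _ _ _ _ _ H1 H2); unfold u2; field; exact Hxyd).
    destruct (is_rdd_elim _ _ _ _ _ _ G) as (_ & G1 & G2); now replace (u2 x y) with (partial2 u x y) by lra.
  + assert (G : is_rdd 1 0 v x y (v1 x y)) by (apply (K v _ _ _ _ _ H3 H4); unfold v1; field; exact Hxyd).
    destruct (is_rdd_elim _ _ _ _ _ _ G) as (G1 & _ & G2); now replace (v1 x y) with (partial1 v x y) by lra.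
  + assert (G : is_rdd 0 1 v x y (v2 x y)) by (apply (K v _ _ _ _ _ H3 H4); unfold v2; field; exact Hxyd).
    destruct (is_rdd_elim _ _ _ _ _ _ G) as (_ & G1 & G2); now replace (v2 x y) with (partial2 v x y) by lra.
- split; [|split; [|split]]; refine (smooth_cont U _ x y _ HUxy).
  + apply (mul (fun x y => b2 x y - b1 x y * m x y) (fun x y => / D x y)); [|exact Si].
    apply (smooth_minus U HU b2 (fun x y => b1 x y * m x y)); auto.
  + apply (mul (fun x y => a1 x y * m x y - a2 x y) (fun x y => / D x y)); [|exact Si].
    apply (smooth_minus U HU (fun x y => a1 x y * m x y) a2); auto.
  + apply (mul (fun x y => b1 x y * - s) (fun x y => / D x y)); [|exact Si].
    apply (mul b1 (fun _ _ => - s)); auto.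
  + apply (mul (fun x y => a1 x y * s) (fun x y => / D x y)); [|exact Si].
    apply (mul a1 (fun _ _ => s)); auto.
- replace (u1 x y * v2 x y - u2 x y * v1 x y) with (s / D x y).
  + apply Rmult_integral_contrapositive; split; [exact Hs|now apply Rinv_neq_0_compat].
  + unfold u1, u2, v1, v2.
    transitivity (s * (a1 x y * b2 x y - a2 x y * b1 x y) / (D x y * D x y)); [fold (D x y)|]; field; exact Hxyd.
Qed.

(** Partial derivatives control [u] only along the axes. Being continuous they are bounded near each
    point, which makes [u] Lipschitz there and so jointly continuous. *)
Lemma C1_continuous x0 y0 d (u u1 u2 : R -> R -> R) : 
  (forall x y, box x0 y0 d x y -> is_derive (fun z => u z y) x (u1 x y) /\ is_derive (fun z => u x z) y (u2 x y) /\
     continuity_2d_pt u1 x y /\ continuity_2d_pt u2 x y) ->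
  forall x y, box x0 y0 d x y -> continuity_2d_pt u x y.
Proof.
intros H x y Hxy.
destruct (H x y Hxy) as (_ & _ & C1 & C2).
assert (B : forall f, continuity_2d_pt f x y -> locally_2d (fun a b => Rabs (f a b) <= Rabs (f x y) + 1) x y).
{ intros f Cf; specialize (Cf (mkposreal 1 Rlt_0_1)); simpl in Cf.
  apply locally_2d_impl with (2 := Cf), locally_2d_forall; intros a b Hab.
  replace (f a b) with ((f a b - f x y) + f x y) by ring; apply Rle_trans with (1 := Rabs_triang _ _); lra. }
destruct (box_shrink x y 1 _ Rlt_0_1 (locally_2d_and _ _ _ _ (box_open x0 y0 d x y Hxy)
  (locally_2d_and _ _ _ _ (B u1 C1) (B u2 C2)))) as (e & He & HB).
set (k := Rabs (u1 x y) + Rabs (u2 x y) + 1).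
assert (P1 := Rabs_pos (u1 x y)); assert (P2 := Rabs_pos (u2 x y)).
assert (Hk : 0 < k) by (unfold k; lra).
assert (L := box_lipschitz x y e u u1 u2 k).
intros eps.
assert (Hd' : 0 < Rmin e (eps / (4 * k))).
{ apply Rmin_pos; [apply He|]; apply Rdiv_lt_0_compat; [apply eps|lra]. }
exists (mkposreal _ Hd'); simpl; intros a b Ha Hb.
assert (M1 := Rmin_l e (eps / (4 * k))); assert (M2 := Rmin_r e (eps / (4 * k))).
apply Rle_lt_trans with (k * (Rabs (a - x) + Rabs (b - y))).
- apply L.
  + intros x' y' H'; destruct (HB x' y' H') as (HU & B1 & B2); destruct (H x' y' HU) as (D1 & D2 & _).
    split; [exact D1|split; [exact D2|]]; unfold k; lra.
  + split; lra.
  + apply box_center; lra.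
- apply Rlt_le_trans with (k * (eps / (4 * k) + eps / (4 * k))).
  + apply Rmult_lt_compat_l; lra.
  + assert (He' := cond_pos eps); apply Rle_trans with (eps / 2); [right; field|]; lra.
Qed.

Definition model (f : R -> R -> C2) : Prop :=
  f = model1 \/ exists r, 0 < r /\ f = model2 r.

Lemma local_normal_form U F x0 y0 : open2 U -> csmooth2 U F ->
  (forall x y, U x y -> lagrangian_at F (x, y)) -> (forall x y, U x y -> type2_at F (x, y)) ->
  (forall x y, U x y -> lorentzian_at F (x, y)) ->
  U x0 y0 -> trace_sff F (x0, y0) <> zero2 ->
  exists d u v Phi f, 0 < d /\ (forall x y, box x0 y0 d x y -> U x y) /\
    local_coordinates x0 y0 d u v /\ holomorphic_isometry Phi /\ model f /\
    forall x y, box x0 y0 d x y -> Phi (F x y) = f (u x y) (v x y).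
Proof.
intros HU HF HL HT HLo H0 Htr.
destruct (local_null_frame U F x0 y0 HU HF HL HT HLo H0 Htr) as (d & a1 & b1 & a2 & b2 & Hd & HBU & NF).
destruct (structure_equations _ F a1 b1 a2 b2 NF) as (om & la & Som & Sla & HS).
assert (S1 := fun x y H => proj1 (proj1 (HS x y H))).
assert (S2 := fun x y H => proj1 (proj2 (proj1 (HS x y H)))).
assert (S3 := fun x y H => proj1 (proj2 (proj2 (proj1 (HS x y H))))).
assert (S4 := fun x y H => proj2 (proj2 (proj2 (proj1 (HS x y H))))).
assert (S5 := fun x y H => proj1 (proj2 (HS x y H))).
assert (S6 := fun x y H => proj1 (proj2 (proj2 (HS x y H)))).
assert (S7 := fun x y H => proj1 (proj2 (proj2 (proj2 (HS x y H))))).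
assert (S8 := fun x y H => proj2 (proj2 (proj2 (proj2 (HS x y H))))).
(* Since [om^2 + la^2] is constant, its value at the base point decides the case on the whole
   square. *)
destruct (Req_dec (om x0 y0 * om x0 y0 + la x0 y0 * la x0 y0) 0) as [K0|K0].
- destruct (flat_normal_form x0 y0 d F a1 b1 a2 b2 om la Hd NF S1 S2 S3 S4) as (d' & u & v & z1 & z2 & p & Hd' & HP & HF').
  + intros x y H.
    assert (Q := first_integral x0 y0 d F a1 b1 a2 b2 om la NF Som Sla S5 S6 S7 S8 x y H).
    rewrite K0 in Q; split; nra.
  + destruct model1_comb as (A1 & A2 & HA & HM).
    assert (Hk : (- Ci)%C <> 0%C).
    { intros K; apply (f_equal Im) in K; unfold Im in K; simpl in K; lra. }
    destruct (congruence_of_null_pairs p z1 z2 A1 A2 (- Ci)%C Hk HP HA) as (Phi & HPhi & HE).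
    exists d', u, v, Phi, model1; split; [apply Hd'|]; split; [|split; [|split; [|split]]]; auto.
    * intros x y H; apply HBU; apply box_incl with (2 := H); apply Hd'.
    * apply (frame_coordinates x0 y0 d F a1 b1 a2 b2 d' u v (fun _ _ => 0) (-1)); auto; [lra|apply Hd'| |].
      -- apply smooth_const; apply NF.
      -- intros x y H; apply HF', H.
    * now left.
    * intros x y H; destruct (HF' x y H) as (-> & _); rewrite HE; symmetry; apply HM.
- set (r := sqrt (om x0 y0 * om x0 y0 + la x0 y0 * la x0 y0)).
  assert (Hp : 0 < om x0 y0 * om x0 y0 + la x0 y0 * la x0 y0) by nra.
  assert (Hr : 0 < r) by now apply sqrt_lt_R0.
  assert (Hrr : om x0 y0 * om x0 y0 + la x0 y0 * la x0 y0 = r * r) by (symmetry; apply sqrt_sqrt; lra).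
  destruct (curved_normal_form x0 y0 d F a1 b1 a2 b2 om la Hd NF S1 S2 S3 S4 Som Sla S5 S6 S7 S8 r Hr Hrr)
    as (d' & u & v & z1 & z2 & p & Hd' & HP & HF').
  destruct (model2_comb r Hr) as (A1 & A2 & HA & HM).
  assert (Hk : (Ci * RtoC (/ (2 * r)))%C <> 0%C).
  { intros K; apply (f_equal Im) in K; unfold Im in K; simpl in K.
    assert (0 < / (2 * r)) by (apply Rinv_0_lt_compat; lra); lra. }
  destruct (congruence_of_null_pairs p z1 z2 A1 A2 _ Hk HP HA) as (Phi & HPhi & HE).
  exists d', u, v, Phi, (model2 r); split; [apply Hd'|]; split; [|split; [|split; [|split]]]; auto.
  + intros x y H; apply HBU; apply box_incl with (2 := H); apply Hd'.
  + apply (frame_coordinates x0 y0 d F a1 b1 a2 b2 d' u v la 1); [lra|apply Hd'|exact NF|exact Sla|].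
    intros x y H; apply HF', H.
  + right; now exists r.
  + intros x y H; destruct (HF' x y H) as (-> & _); rewrite HE; symmetry; apply HM.
Qed.

(** * Open sets in charts and the final assembly *)

Lemma open_open2 (D : R * R -> Prop) : open D -> open2 (fun x y => D (x, y)).
Proof.
intros H x y Hxy; apply locally_2d_locally; generalize (H (x, y) Hxy); apply filter_imp; now intros [].
Qed.

Lemma open2_open (V : R -> R -> Prop) : open2 V -> open (fun p : R * R => V (fst p) (snd p)).
Proof. intros H [x y] Hxy; now apply locally_2d_locally, H. Qed.

Lemma preimage_open2 U V (u v : R -> R -> R) : open2 U -> open2 V ->
  (forall x y, U x y -> continuity_2d_pt u x y /\ continuity_2d_pt v x y) ->
  open2 (fun x y => U x y /\ V (u x y) (v x y)).
Proof.
intros HU HV HC x y [Hxy Huv]; destruct (HC x y Hxy) as [Cu Cv]; destruct (HV _ _ Huv) as [e He].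
apply locally_2d_and; [now apply HU|].
apply locally_2d_impl with (2 := locally_2d_and _ _ _ _ (Cu e) (Cv e)), locally_2d_forall.
intros a b [Ha Hb]; now apply He.
Qed.

(** Seen in a chart [j], the set is the preimage of [V] under the transition map, which is
    continuous on the open overlap. Injectivity of chart [i] identifies the transition value with
    the given point of [V]. *)
Lemma chart_image_open (M : surface) (i : chart (surface_atlas M)) (V : R -> R -> Prop) :
  open2 V -> (forall x y, V x y -> dom (surface_atlas M) i (x, y)) ->
  surf_open (fun m : M => exists x y, V x y /\ param (surface_atlas M) i (x, y) = m).
Proof.
intros HV HD j.
destruct (transition_smooth _ (surface_atlas M) j i) as (t1 & t2 & Ht).
assert (HO := open_open2 _ (overlap_open _ (surface_atlas M) j i)).
assert (HC : forall x y, overlap _ (surface_atlas M) j i (x, y) -> continuity_2d_pt t1 x y /\ continuity_2d_pt t2 x y).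
{ intros x y H; destruct (Ht _ H) as (_ & _ & S1 & S2); exact (conj (proj1 (S1 0%nat)) (proj1 (S2 0%nat))). }
assert (HP := open2_open _ (preimage_open2 _ V t1 t2 HO HV HC)); cbv beta in HP.
intros [p1 p2] [Hp (x & y & Hxy & E)].
assert (Op : overlap _ (surface_atlas M) j i (p1, p2)) by (split; [exact Hp|exists (x, y); auto]).
destruct (Ht _ Op) as (T1 & T2 & _).
assert (E2 : (t1 p1 p2, t2 p1 p2) = (x, y)).
{ exact (param_inj _ (surface_atlas M) i _ _ T1 (HD x y Hxy) (eq_trans T2 (eq_sym E))). }
injection E2 as E3 E4.
rewrite <- E3, <- E4 in Hxy; generalize (HP (p1, p2) (conj Op Hxy)); apply filter_imp; intros [a b]; cbn [fst snd]; intros [Oq Vq].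
split; [apply Oq|]; exists (t1 a b), (t2 a b); split; [exact Vq|]; apply (Ht _ Oq).
Qed.

Theorem theorem6p5 (M : surface) (X : M -> C2)
  (Himm : immersion X)
  (Hlor : lorentzian X)
  (Hlag : lagrangian X)
  (Hiso : proper_lightlike_isotropic X)
  (Htype : type2 X) :
  forall m : M, exists W : M -> Prop, surf_open W /\ W m /\
    exists Phi : C2 -> C2, holomorphic_isometry Phi /\
      (congruent_via X W Phi model1 \/
       exists r : R, 0 < r /\ congruent_via X W Phi (model2 r)).
Proof.
intros m.
destruct (param_cover _ (surface_atlas M) m) as (i & [x0 y0] & Hp0 & Em).
set (F := in_chart X i).
set (U := fun x y => dom (surface_atlas M) i (x, y)).
assert (HU : open2 U) by apply open_open2, dom_open.
assert (HF : csmooth2 U F).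
{ split; split; intros x y H; apply (proj1 Himm i (x, y) H). }
destruct (local_normal_form U F x0 y0 HU HF (fun x y H => Hlag i (x, y) H) (fun x y H => Htype i (x, y) H)
  (fun x y H => Hlor i (x, y) H) Hp0 (proj2 Hiso i (x0, y0) Hp0))
  as (d & u & v & Phi & f & Hd & HB & (u1 & u2 & v1 & v2 & HC) & HPhi & Hf & HE).
assert (B0 : box x0 y0 d x0 y0) by now apply box_center.
destruct (HC x0 y0 B0) as (_ & (C1 & C2 & C3 & C4) & Hdet).
destruct (local_surjectivity x0 y0 d u v u1 u2 v1 v2 Hd (fun x y H => proj1 (HC x y H)) C1 C2 C3 C4 Hdet)
  as (e & He & Hsurj).
set (Om := box (u x0 y0) (v x0 y0) e).
(* Surjectivity says that the image of the square contains [Om]; keeping only the points mapped into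
   [Om] makes the image equal to this open set. *)
set (V := fun x y => box x0 y0 d x y /\ Om (u x y) (v x y)).
assert (Cu : forall x y, box x0 y0 d x y -> continuity_2d_pt u x y).
{ apply (C1_continuous x0 y0 d u u1 u2); intros x y H; destruct (HC x y H) as ((D1 & D2 & _) & (K1 & K2 & _) & _); auto. }
assert (Cv : forall x y, box x0 y0 d x y -> continuity_2d_pt v x y).
{ apply (C1_continuous x0 y0 d v v1 v2); intros x y H; destruct (HC x y H) as ((_ & _ & D1 & D2) & (_ & _ & K1 & K2) & _); auto. }
assert (HV : open2 V).
{ apply (preimage_open2 (box x0 y0 d) Om u v); [apply box_open|apply box_open|auto]. }
exists (fun m : M => exists x y, V x y /\ param (surface_atlas M) i (x, y) = m).
split; [|split].
- apply chart_image_open; [exact HV|]; intros x y [H _]; now apply HB.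
- exists x0, y0; split; [split; [exact B0|now apply box_center]|exact Em].
- exists Phi; split; [exact HPhi|].
  enough (K : congruent_via X (fun m : M => exists x y, V x y /\ param (surface_atlas M) i (x, y) = m) Phi f).
  { destruct Hf as [-> | (r & Hr & ->)]; [now left|right; now exists r]. }
  exists (fun p => Om (fst p) (snd p)); split; [apply open2_open, box_open|].
  intros z; split.
  + intros (m' & (x & y & [Hxy HO] & <-) & ->); exists (u x y, v x y); split; [exact HO|].
    exact (HE x y Hxy).
  + intros ([s t] & HO & ->); destruct (Hsurj s t HO) as (x & y & Hxy & Eu & Ev).
    exists (param (surface_atlas M) i (x, y)); split.
    * exists x, y; split; [split; [exact Hxy|]|reflexivity]; rewrite Eu, Ev; exact HO.
    * cbn [fst snd]; rewrite <- Eu, <- Ev; symmetry; exact (HE x y Hxy).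
Qed.
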